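(* Let $k$ be a field of characteristic $0$, $\widetilde{W}$ a finite reflection group on a graded finite-dimensional $k$-vector space $\widetilde V$, $G$ a good normal subgroup of $\widetilde W$, $W=\widetilde W/G$, $V$ the tangent space to $\widetilde V/G$ at $0$, and $p:\widetilde V\to\widetilde V/G\hookrightarrow V$. Let $x\in\widetilde V$, with stabilizers $\widetilde W_x$ in $\widetilde W$ and $G_x$ in $G$. Then $G_x$ is good in $\widetilde W_x$; moreover, the canonical map from the tangent space to $\widetilde V/G_x$ at (the image of) $x$ to $V$ is injective, and it induces an isomorphism of reflection groups $\widetilde W_x/G_x\xrightarrow{\sim}W_{p(x)}$, where $W_{p(x)}$ is the stabilizer of $p(x)$ in $W$.
   Context: A grading on a finite-dimensional $k$-vector space is an algebraic action of $k^\times$ with strictly positive weights; $GL_{grad}(\widetilde V)$ is the group of elements of $GL(\widetilde V)$ commuting with this action, and $\widetilde W\subset GL_{grad}(\widetilde V)$. A reflection is an automorphism $g$ of finite order with $\ker(g-1)$ a hyperplane; a finite linear group is a reflection group if generated by its reflections. For a vector space $V$, $k[V]$ is the symmetric algebra of $V^*$. Put $B=k[\widetilde V]$, $\widetilde V/G=\operatorname{Spec}B^G$, $B^G_+$ the ideal of $B^G$ spanned by homogeneous elements of positive degree, and $V=(B^G_+/(B^G_+)^2)^*$. Let $N(G)$ be the normalizer of $G$ in $GL_{grad}(\widetilde V)$. Fix a graded $N(G)$-equivariant splitting $V^*\to B^G_+$; it induces a surjection $A=k[V]\to B^G$ with kernel $I$, i.e. a closed immersion $\widetilde V/G\hookrightarrow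 V$. $A_+$ is the ideal of positive-degree elements of $A$. The normal subgroup $G$ is called good in $\widetilde W$ if $G$ is of complete intersection (the minimal number of generators of $I$ is $\dim V-\dim\widetilde V$) and $W$ acts trivially on $I/A_+I$; in that case $W$ is a reflection group on $V$. ''$G_x$ good in $\widetilde W_x$'' is the same notion for the reflection group $\widetilde W_x$ on $\widetilde V$ and its normal subgroup $G_x$. The canonical map on tangent spaces is the differential at the image of $x$ of $\widetilde V/G_x\to\widetilde V/G\hookrightarrow V$, the tangent space of $V$ at any point being identified with $V$. The group $\widetilde W_x/G_x$ is regarded as a reflection group via its action on the tangent space to $\widetilde V/G_x$ at $x$. A morphism of reflection groups is a group homomorphism sending each reflection to $1$ or to a reflection; an isomorphism is an invertible such morphism. *)

(* Defs.v *)
From HB Require Import structures.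
From mathcomp Require Import all_boot all_order all_algebra all_fingroup.
From mathcomp Require Import all_character.
From mathcomp Require Import mpoly.
From mathcomp Require Import boolp functions.

Set Implicit Arguments.
Unset Strict Implicit.
Unset Printing Implicit Defensive.

Import GRing.Theory.
Local Open Scope ring_scope.

(* Conventions.  Vector spaces with a chosen homogeneous basis are spaces of  *)
(* row vectors 'rV[k]_n, and groups act on them on the right, v |-> v *m rG g, *)
(* as in mxrepresentation.  The grading is given by the weights d i > 0 of    *)
(* the basis vectors.  The ring k['rV[k]_n] is {mpoly k[n]}, 'X_i being the   *)
(* i-th coordinate function, of degree d i.                                   *)

Section ReflectionGroups.
Variable k : fieldType.

Definition is_hyperplane (U : lmodType k) (H : U -> Prop) : Prop :=
  exists2 phi : {linear U -> k^o},
    (exists u, phi u != 0) & (forall u, H u <-> phi u = 0).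

Definition is_reflection (U : lmodType k) (s : U -> U) : Prop :=
  [/\ linear s,
      exists2 r, (0 < r)%N & (forall u, iter r s u = u)
    & is_hyperplane (fun u => s u - u = 0)].

Definition reflections (U : lmodType k) (gT : finGroupType) (H : {set gT})
    (act : gT -> U -> U) : {set gT} :=
  [set h in H | `[< is_reflection (act h) >]].

Definition is_reflection_group (U : lmodType k) (gT : finGroupType)
    (H : {set gT}) (act : gT -> U -> U) : Prop :=
  [/\ (forall h, h \in H -> linear (act h)),
      (forall u, act 1%g u = u) /\
      {in H &, forall g h u, act (g * h)%g u = act h (act g u)},
      (forall h, h \in H -> (forall u, act h u = u) -> h = 1%g)
    & <<reflections H act>>%g = H].

Definition is_reflection_morphism (U1 U2 : lmodType k)
    (gT1 gT2 : finGroupType) (H1 : {set gT1}) (act1 : gT1 -> U1 -> U1)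
    (H2 : {set gT2}) (act2 : gT2 -> U2 -> U2) (phi : gT1 -> gT2) : Prop :=
  [/\ {in H1, forall h, phi h \in H2},
      {in H1 &, {morph phi : g h / (g * h)%g}}
    & {in reflections H1 act1, forall s,
        phi s = 1%g \/ phi s \in reflections H2 act2}].

Definition is_reflection_isomorphism (U1 U2 : lmodType k)
    (gT1 gT2 : finGroupType) (H1 : {set gT1}) (act1 : gT1 -> U1 -> U1)
    (H2 : {set gT2}) (act2 : gT2 -> U2 -> U2) (phi : gT1 -> gT2) : Prop :=
  [/\ is_reflection_group H1 act1, is_reflection_group H2 act2,
      is_reflection_morphism H1 act1 H2 act2 phi
    & exists psi : gT2 -> gT1,
      [/\ is_reflection_morphism H2 act2 H1 act1 psi,
          {in H1, cancel phi psi} & {in H2, cancel psi phi}]].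

End ReflectionGroups.

Section GradedPolynomials.
Variables (k : fieldType) (n : nat).

Definition wdeg (d : 'I_n -> nat) (m : 'X_{1..n}) : nat :=
  (\sum_(i < n) m i * d i)%N.

Lemma wdeg0 d : wdeg d 0%MM = 0%N.
Proof. by rewrite /wdeg big1 // => i _; rewrite mnm0E. Qed.

Lemma wdegD d : {morph wdeg d : m1 m2 / (m1 + m2)%MM >-> (m1 + m2)%N}.
Proof.
by move=> m1 m2; rewrite /wdeg -big_split; apply: eq_bigr => i _ /=; rewrite mnmDE mulnDl.
Qed.

HB.instance Definition _ d := isMeasure.Build n (wdeg d) (wdeg0 d) (wdegD d).

(* The span of the homogeneous elements of positive degree of S. *)
Definition pos_part (d : 'I_n -> nat) (S : {mpoly k[n]} -> Prop)
    (p : {mpoly k[n]}) : Prop :=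
  exists2 s : seq {mpoly k[n]},
    {in s, forall q, S q /\ exists2 c, (0 < c)%N & q \is c.-homog for (wdeg d)}
    & p = \sum_(q <- s) q.

Definition ideal_mul (S T : {mpoly k[n]} -> Prop) (p : {mpoly k[n]}) : Prop :=
  exists2 s : seq ({mpoly k[n]} * {mpoly k[n]}),
    {in s, forall u, S u.1 /\ T u.2} & p = \sum_(u <- s) u.1 * u.2.

Definition generates (r : nat) (h : 'I_r -> {mpoly k[n]})
    (I : {mpoly k[n]} -> Prop) : Prop :=
  forall p, I p <->
    exists c : 'I_r -> {mpoly k[n]}, p = \sum_(i < r) c i * h i.

Definition min_number_of_generators (I : {mpoly k[n]} -> Prop) (r : nat) : Prop :=
  (exists h : 'I_r -> {mpoly k[n]}, generates h I) /\
  (forall s (h : 'I_s -> {mpoly k[n]}), generates h I -> (r <= s)%N).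

(* The polynomial function y |-> p (y *m A). *)
Definition mx_subst (A : 'M[k]_n) (p : {mpoly k[n]}) : {mpoly k[n]} :=
  p \mPo [tuple \sum_(i < n) A i j *: 'X_i | j < n].

(* The element t of the multiplicative group acting with weights d. *)
Definition grading_mx (d : 'I_n -> nat) (t : k) : 'M[k]_n :=
  diag_mx (\row_i t ^+ d i).

Definition GLgrad (d : 'I_n -> nat) (A : 'M[k]_n) : Prop :=
  A \in unitmx /\ forall t : k, t != 0 -> comm_mx A (grading_mx d t).

End GradedPolynomials.

Section InvariantRing.
Variables (k : fieldType) (n : nat) (gT : finGroupType).
Variables (rho : gT -> 'M[k]_n) (H : {set gT}).

Definition invariant : {pred {mpoly k[n]}} :=
  fun p => [forall g in H, mx_subst (rho g) p == p].

Lemma invariantP p :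
  reflect {in H, forall g, mx_subst (rho g) p = p} (p \in invariant).
Proof. by apply: (iffP forall_inP) => h g gH; apply/eqP/h. Qed.

Lemma invariant_subalg_closed : subalg_closed invariant.
Proof.
split=> [|a p q /invariantP hp /invariantP hq|p q /invariantP hp /invariantP hq];
  apply/invariantP => g gH; rewrite /mx_subst.
- exact: comp_mpoly1.
- rewrite linearP; congr (_ *: _ + _); [exact: hp | exact: hq].
- rewrite rmorphM; congr (_ * _); [exact: hp | exact: hq].
Qed.

HB.instance Definition _ :=
  GRing.isSubalgClosed.Build k {mpoly k[n]} invariant invariant_subalg_closed.

Record invring := InvRing { inv_val : {mpoly k[n]}; _ : inv_val \in invariant }.

HB.instance Definition _ := [isSub for inv_val].
HB.instance Definition _ := [Choice of invring by <:].
HB.instance Definition _ := [SubChoice_isSubAlgebra of invring by <:].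
HB.instance Definition _ := [SubNzRing_isSubComNzRing of invring by <:].

Variable x : 'rV[k]_n.

Definition inv_eval (b : invring) : k := (val b).@[x 0].

(* The Zariski tangent space of Spec of the invariant ring at the image of x, *)
(* as the space of k-derivations to the residue field k at that point.        *)
Definition point_derivation : {pred invring -> k^o} :=
  fun D => `[< linear D /\
    forall a b, D (a * b) = inv_eval a * D b + inv_eval b * D a >].

Lemma point_derivation_submod_closed : submod_closed point_derivation.
Proof.
split=> [|a D E /asboolP [lD dD] /asboolP [lE dE]]; apply/asboolP; split.
- by move=> c u v; rewrite /GRing.zero /= scaler0 addr0.
- by move=> u v; rewrite /GRing.zero /= !mulr0 addr0.
- move=> c u v; change (a *: D (c *: u + v) + E (c *: u + v) =
    c *: (a *: D u + E u) + (a *: D v + E v)).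
  rewrite lD lE !scalerDr !scalerA [a * c]mulrC -!addrA.
  by congr (_ + _); rewrite addrCA.
- move=> u v; change (a * D (u * v) + E (u * v) =
    inv_eval u * (a * D v + E v) + inv_eval v * (a * D u + E u)).
  rewrite dD dE !mulrDr !mulrA ![a * inv_eval _]mulrC -!addrA.
  by congr (_ + _); rewrite addrCA.
Qed.

HB.instance Definition _ :=
  GRing.isSubmodClosed.Build k (invring -> k^o) point_derivation
    point_derivation_submod_closed.

Record tangent := Tangent {
  tan_val : invring -> k^o; _ : tan_val \in point_derivation }.

HB.instance Definition _ := [isSub for tan_val].
HB.instance Definition _ := [Choice of tangent by <:].
HB.instance Definition _ := [SubChoice_isSubLmodule of tangent by <:].

(* The differential of y |-> y *m rho g, i.e. D |-> (b |-> D (b o g)).  It     *)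
(* makes sense when g normalizes H and fixes x (tangent_actE below); the      *)
(* defaults of insubd are never used for such g.                              *)
Definition tangent_act (g : gT) (D : tangent) : tangent :=
  insubd D (fun b => val D (insubd b (mx_subst (rho g) (val b)))).

(* The action of cosets of H, through a representative. *)
Definition tangent_quo_act (c : coset_of H) : tangent -> tangent :=
  tangent_act (repr c).

(* The differential at the image of x of y |-> (f_0 y, ..., f_(m-1) y), the   *)
(* default of insubd being irrelevant when all f_j are H-invariant.           *)
Definition tangent_map (m : nat) (f : 'I_m -> {mpoly k[n]}) (D : tangent) :
    'rV[k]_m :=
  \row_j val D (insubd 0 (f j)).

End InvariantRing.

Arguments tangent_act {k n gT rho H x}.
Arguments tangent_quo_act {k n gT rho H x}.
Arguments tangent_map {k n gT rho H x m}.

Section TangentAction.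
Variables (k : fieldType) (n : nat) (gT : finGroupType).
Variables (Wt H : {group gT}) (rho : mx_representation k Wt n).
Hypothesis sHW : H \subset Wt.

Lemma mx_substM (A B : 'M[k]_n) (p : {mpoly k[n]}) :
  mx_subst A (mx_subst B p) = mx_subst (A *m B) p.
Proof.
rewrite [mx_subst B p]comp_mpolyEX [RHS]comp_mpolyEX /mx_subst raddf_sum /=; apply: eq_bigr => u _.
rewrite comp_mpolyZ !comp_mpolyX rmorph_prod /=; congr (_ *: _).
apply: eq_bigr => j _; rewrite rmorphXn /= !tnth_mktuple raddf_sum /=.
congr (_ ^+ _).
under [RHS]eq_bigr => l _ do rewrite mxE scaler_suml.
rewrite exchange_big /=; apply: eq_bigr => i _.
rewrite comp_mpolyZ comp_mpolyXU -tnth_nth tnth_mktuple scaler_sumr.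
by apply: eq_bigr => l _; rewrite scalerA mulrC.
Qed.

Lemma mx_subst_eval (A : 'M[k]_n) (p : {mpoly k[n]}) (y : 'rV[k]_n) :
  (mx_subst A p).@[y 0] = p.@[(y *m A) 0].
Proof.
rewrite /mx_subst comp_mpolyEX [p in RHS]mpolyE !raddf_sum /=.
apply: eq_bigr => u _; rewrite comp_mpolyX !mevalZ rmorph_prod /=.
rewrite mevalX; congr (_ * _); apply: eq_bigr => j _.
rewrite rmorphXn /= tnth_mktuple raddf_sum /= mxE; congr (_ ^+ _).
by apply: eq_bigr => i _; rewrite mevalZ mevalXU mulrC.
Qed.

Lemma invariant_mx_subst g p : g \in Wt -> g \in 'N(H)%g ->
  p \in invariant rho H -> mx_subst (rho g) p \in invariant rho H.
Proof.
move=> gW gN /invariantP hp; apply/invariantP => h hH.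
have hW := subsetP sHW h hH.
have hgH : (h ^ g)%g \in H by rewrite memJ_norm.
rewrite mx_substM -repr_mxM // conjgC repr_mxM ?groupJ // -mx_substM.
by rewrite hp.
Qed.

Lemma tangent_actE (x : 'rV[k]_n) (g : gT) (D : tangent rho H x)
    (b b' : invring rho H) :
    g \in rstab rho x -> g \in 'N(H)%g ->
    val b' = mx_subst (rho g) (val b) ->
  val (tangent_act g D) b = val D b'.
Proof.
rewrite inE => /andP[gW /eqP xg] gN b'E.
pose sub c := insubd c (mx_subst (rho g) (val c)) : invring rho H.
have subE c : val (sub c) = mx_subst (rho g) (val c).
  by rewrite /sub val_insubd invariant_mx_subst //; case: c.
have subP : (fun c => val D (sub c)) \in point_derivation (rho := rho) (H := H) x.
  have /asboolP[lD dD] : val D \in point_derivation x by case: D.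
  apply/asboolP; split=> [a u v|u v].
    rewrite (_ : sub _ = a *: sub u + sub v) ?lD //.
    by apply: val_inj; rewrite /= !subE /mx_subst linearP.
  rewrite (_ : sub _ = sub u * sub v) ?dD; last first.
    by apply: val_inj; rewrite /= !subE /mx_subst rmorphM.
  by rewrite /inv_eval !subE !mx_subst_eval xg.
rewrite /tangent_act val_insubd subP; congr (val D _).
by apply: val_inj; rewrite subE.
Qed.

End TangentAction.

Section Quotient.
Variables (k : fieldType) (n : nat) (d : 'I_n -> nat) (gT : finGroupType).
Variables (rho : gT -> 'M[k]_n) (G : {set gT}).

(* Membership in the normalizer of rho(G) in GL_grad. *)
Definition normalizer_grad (A : 'M[k]_n) : Prop :=
  [/\ GLgrad d A,
      {in G, forall g, exists2 h, h \in G & invmx A *m rho g *m A = rho h}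
    & {in G, forall h, exists2 g, g \in G & invmx A *m rho g *m A = rho h}].

Definition inv_plus : {mpoly k[n]} -> Prop :=
  pos_part d (fun p => p \in invariant rho G).

(* An N(G)-equivariant graded splitting V^* -> B^G_+, given by the images     *)
(* f_j of a homogeneous basis of V^* = B^G_+ / (B^G_+)^2, of degrees e_j; the *)
(* dual basis identifies V with 'rV[k]_m and k[V] with {mpoly k[m]}.          *)
(* Equivariance of a linear section means stability of its image, the span    *)
(* of f.                                                                      *)
Definition is_splitting (m : nat) (e : 'I_m -> nat) (f : 'I_m -> {mpoly k[n]}) :
    Prop :=
  [/\ forall j, [/\ f j \in invariant rho G, (0 < e j)%N
                  & f j \is (e j).-homog for (wdeg d)],
      forall b, inv_plus b -> exists! c : 'rV[k]_m,
        ideal_mul inv_plus inv_plus (b - \sum_j c 0 j *: f j)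
    & forall A, normalizer_grad A ->
        exists M : 'M[k]_m, forall j, mx_subst A (f j) = \sum_i M i j *: f i].

(* The morphism p : V~ -> V and the kernel I of k[V] -> B^G. *)
Definition quo_map (m : nat) (f : 'I_m -> {mpoly k[n]}) (y : 'rV[k]_n) :
    'rV[k]_m :=
  \row_j (f j).@[y 0].

Definition quo_ideal (m : nat) (f : 'I_m -> {mpoly k[n]}) (P : {mpoly k[m]}) :
    Prop :=
  P \mPo [tuple f j | j < m] = 0.

(* rV is the action of Wt / G on V making p equivariant:                      *)
(* p (y *m rho g) = p y *m rV (coset G g), as polynomials in y.  It is        *)
(* uniquely determined by the splitting f.                                    *)
Definition is_quo_action (Wt : {set gT}) (m : nat) (f : 'I_m -> {mpoly k[n]})
    (rV : coset_of G -> 'M[k]_m) : Prop :=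
  {in Wt, forall g, forall j,
    mx_subst (rho g) (f j) = \sum_i rV (coset G g) i j *: f i}.

Definition is_complete_intersection (m : nat) (f : 'I_m -> {mpoly k[n]}) :
    Prop :=
  exists2 r, (r + n)%N = m & min_number_of_generators (quo_ideal f) r.

Definition acts_trivially_on_relations (Wt : {set gT}) (m : nat)
    (e : 'I_m -> nat) (f : 'I_m -> {mpoly k[n]}) (rV : coset_of G -> 'M[k]_m) :
    Prop :=
  {in (Wt / G)%g, forall w, forall P, quo_ideal f P ->
    ideal_mul (pos_part e (fun=> True)) (quo_ideal f) (mx_subst (rV w) P - P)}.

(* G is good in the reflection group Wt, with respect to the splitting f and  *)
(* the action rV of Wt / G on V.                                              *)
Definition is_good (Wt : {set gT}) (m : nat) (e : 'I_m -> nat)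
    (f : 'I_m -> {mpoly k[n]}) (rV : coset_of G -> 'M[k]_m) : Prop :=
  [/\ is_reflection_group Wt (fun g (v : 'rV[k]_n) => v *m rho g),
      (G <| Wt)%g,
      is_complete_intersection f
    & acts_trivially_on_relations Wt e f rV].

End Quotient.

(* Main.v *)
(** Averaging generators of I gives W-invariant generators h_i, because W acts
    trivially on I / A_+ I.  The morphism from V~/G_x to V~/G is etale at x, so
    the tangent space of V~/G_x at x embeds into V, with image the common kernel
    T of the differentials of the h_i at p(x).  These are fixed by the
    stabiliser of p(x), which therefore acts trivially on V/T: its reflections
    on V are its reflections on T.  A reflection of V~ acts on V as 1 or as a
    reflection, and W~_x is generated by reflections, hence so is its image.

    The last fact is Steinberg's theorem.  Let P be generated by the reflections
    fixing x and c be the product of the linear forms of the other reflections.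
    As B is locally free over the invariants of W~ (Chevalley), c times the
    indicator function of P comes from the tensor square of B over these
    invariants, locally at the origin: this only has to be checked at generic
    points of hyperplanes.  Evaluating at a multiple of x gives W~_x = P.

    For the goodness of G_x, write f_i - p(x)_i as a polynomial Z_i in generators
    of the invariants of G_x centred at x.  Substituting Z turns the h_i into
    generators of I' modulo A'_+ I'.  Correcting Z by elements of I' kills those
    with independent differentials.  The remaining ones, at most m' - dim V~ in
    number, have zero differential, so modulo A'_+ I' they do not depend on the
    choice of Z, and they are fixed by W~_x. *)

(* The presentation of V~/G_x is graded at the origin whereas x is usually another point, so the
   comparison A -> A' is not graded. Completion and Artin-Rees are avoided as follows. Powers of
   maximal ideals descend from invariants of G_x to invariants of G after multiplication by a
   function that is 1 at x and 0 on the rest of its orbit. Relations in I' are then approximated to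
   any order by images of relations of f. As I' is homogeneous with positive weights, components of
   a relation beyond the degrees of the images of the h_i already lie in A'_+ I', so approximation
   to a finite order gives spanning.

   A reflection s acts on V with s - 1 of rank at most one for the following reason. At a generic
   point y of its hyperplane, s - 1 sends each linear function on V to a multiple of one invariant
   norm. If the cofactor vanishes at y, the result has order two at y on the quotient, so it is the
   differential of a relation and is fixed by s; an element of finite order then forces it to be 0.
   Hence only the scalar value of the cofactor at y matters. *)
From HB Require Import structures.
From mathcomp Require Import all_boot all_order all_algebra all_fingroup.
From mathcomp Require Import all_character.
From mathcomp Require Import mpoly ring boolp.
Require Import Defs.

Set Implicit Arguments.
Unset Strict Implicit.
Unset Printing Implicit Defensive.

Import GRing.Theory.
Local Open Scope ring_scope.

(** * Polynomials, ideals and linear forms *)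

Section Substitution.
Variables (k : fieldType) (n : nat).
Implicit Types p q : {mpoly k[n]}.

Lemma mpoly_ring_ind (P : {mpoly k[n]} -> Prop) :
    (forall c, P c%:MP) -> (forall i, P 'X_i) ->
    (forall p q, P p -> P q -> P (p + q)) ->
    (forall p q, P p -> P q -> P (p * q)) -> forall p, P p.
Proof.
move=> PC PX PD PM; elim/mpolyind => [|c m p _ _ Pp]; first exact: (PC 0).
apply: (PD) => //; rewrite -mul_mpolyC; apply: (PM) => //.
rewrite mpolyXE_id; elim/big_ind: _ => [|u v|i _]; [exact: (PC 1) | exact: PM |].
by elim: (m i) => [|r Pr]; [rewrite expr0; exact: (PC 1) | rewrite exprS; exact: PM].
Qed.

(** Convertible both to [mx_subst] and to the left-hand side of [quo_ideal], so that one family of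
    lemmas serves for all substitutions. *)
Definition msub m (h : 'I_m -> {mpoly k[n]}) (P : {mpoly k[m]}) : {mpoly k[n]} :=
  P \mPo [tuple h i | i < m].

HB.instance Definition _ m (h : 'I_m -> {mpoly k[n]}) :=
  GRing.LRMorphism.copy (msub h) (comp_mpoly [tuple h i | i < m]).

HB.instance Definition _ (A : 'M[k]_n) :=
  GRing.LRMorphism.copy (mx_subst A)
    (comp_mpoly [tuple \sum_(i < n) A i j *: 'X_i | j < n]).

Lemma msubX m (h : 'I_m -> {mpoly k[n]}) i : msub h 'X_i = h i.
Proof. by rewrite /msub comp_mpolyXU -tnth_nth tnth_mktuple. Qed.

Lemma msubC m (h : 'I_m -> {mpoly k[n]}) c : msub h c%:MP = c%:MP.
Proof. exact: comp_mpolyC. Qed.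

Lemma eq_msub m (g h : 'I_m -> {mpoly k[n]}) : g =1 h -> msub g =1 msub h.
Proof. by move=> gh P; rewrite /msub; congr (P \mPo _); apply: eq_mktuple. Qed.

Lemma msub_eval m (h : 'I_m -> {mpoly k[n]}) P (v : 'I_n -> k) :
  (msub h P).@[v] = P.@[fun i => (h i).@[v]].
Proof.
by rewrite comp_mpoly_meval; apply: meval_eq => i; rewrite tnth_mktuple.
Qed.

Lemma mx_substE (A : 'M[k]_n) : mx_subst A = msub (fun j => \sum_i A i j *: 'X_i).
Proof. by []. Qed.

Lemma mx_substX (A : 'M[k]_n) j : mx_subst A 'X_j = \sum_i A i j *: 'X_i.
Proof. by rewrite mx_substE msubX. Qed.

Lemma msub_id p : msub (fun i => 'X_i) p = p.
Proof. exact: comp_mpoly_id. Qed.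

Lemma mx_subst1 p : mx_subst 1%:M p = p.
Proof.
rewrite mx_substE -[RHS]msub_id; apply: eq_msub => j.
rewrite (bigD1 j) //= mxE eqxx scale1r big1 ?addr0 // => i ij.
by rewrite mxE (negPf ij) scale0r.
Qed.

End Substitution.

Lemma msub_msub (k : fieldType) m n r (g : 'I_n -> {mpoly k[r]})
    (h : 'I_m -> {mpoly k[n]}) P :
  msub g (msub h P) = msub (fun i => msub g (h i)) P.
Proof.
elim/mpoly_ring_ind: P => [c|i|p q ep eq|p q ep eq].
- by rewrite !msubC.
- by rewrite !msubX.
- by rewrite !rmorphD /= ep eq.
- by rewrite !rmorphM /= ep eq.
Qed.

Lemma mx_subst_msub (k : fieldType) m n (A : 'M[k]_n) (h : 'I_m -> {mpoly k[n]}) P :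
  mx_subst A (msub h P) = msub (fun i => mx_subst A (h i)) P.
Proof. exact: msub_msub. Qed.

Section Infinite.
Variable k : fieldType.
Hypothesis hk : [pchar k] =i pred0.

Lemma pnatr_neq0 r : (0 < r)%N -> r%:R != 0 :> k.
Proof. by rewrite ((pcharf0P k).1 hk) lt0n. Qed.

(** In characteristic 0 the first [size p] natural numbers are distinct, too many to be roots. *)
Lemma poly_nonroot (p : {poly k}) : p != 0 -> exists c, p.[c] != 0.
Proof.
move=> p0; pose s := [seq i%:R : k | i <- iota 0 (size p)].
have us : uniq s.
  rewrite map_inj_in_uniq ?iota_uniq // => i j _ _ eij.
  wlog lij : i j eij / (i <= j)%N.
    move=> H; case/orP: (leq_total i j) => le; first exact: H eij le.
    by apply/esym/(H j i).
  apply/eqP; rewrite eqn_leq lij /= leqNgt; apply/negP => lt.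
  have := pnatr_neq0 (r := j - i); rewrite subn_gt0 lt => /(_ isT).
  by rewrite natrB // eij subrr eqxx.
have : ~~ all (root p) s.
  apply/negP => /max_poly_roots => /(_ p0 us).
  by rewrite size_map size_iota ltnn.
by case/allPn=> c _ c0; exists c.
Qed.

(** Induction on the degree. On every line parallel to an axis [p] restricts to a univariate
    polynomial with all values 0, so its partial derivatives vanish everywhere and are zero by
    induction; in characteristic 0 this leaves only constants. *)
Lemma mpoly_vanish n (p : {mpoly k[n]}) :
  (forall v : 'I_n -> k, p.@[v] = 0) -> p = 0.
Proof.
move: (leqnn (msize p)); move: {2}(msize p) => N.
elim: N p => [|N IH] p sp pv.
  apply/mpolyP=> m; rewrite mcoeff0; apply: memN_msupp_eq0.
  by apply: msize_mdeg_ge; rewrite (leq_trans sp).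
have dp0 i : p^`M(i) = 0.
  apply: IH => [|v].
    apply/bigmax_leqP_seq => m; rewrite mcoeff_msupp mcoeff_deriv => mp _.
    have : (m + U_(i))%MM \in msupp p.
      by rewrite mcoeff_msupp; apply: contraNneq mp => ->; rewrite mul0rn.
    by move/msize_mdeg_lt; rewrite mdegD mdeg1 addn1 => /leq_trans/(_ sp).
  pose L := mmap (@polyC k) (fun j => (v j)%:P + (j == i)%:R *: 'X).
  have LE q t : (L q).[t] = q.@[fun j => v j + (j == i)%:R * t].
    elim/mpoly_ring_ind: q => [c|j|q r eq er|q r eq er].
    - by rewrite /L mmapC hornerC mevalC.
    - by rewrite /L mmapX mmap1U mevalXU hornerD hornerC hornerZ hornerX.
    - by rewrite [L _]raddfD hornerD eq er mevalD.
    - by rewrite [L _]rmorphM hornerM eq er mevalM.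
  have dLE q : (L q)^`().[0] = q^`M(i).@[v].
    have L0 r : (L r).[0] = r.@[v].
      by rewrite LE; apply: meval_eq => j; rewrite mulr0 addr0.
    elim/mpoly_ring_ind: q => [c|j|q r eq er|q r eq er].
    - by rewrite /L mmapC derivC horner0 mderivC meval0.
    - rewrite /L mmapX mmap1U derivD derivC derivZ derivX add0r hornerZ hornerC.
      rewrite mderivX mnm1E mevalZ eq_sym mulr1.
      case: eqP => [->|_]; last by rewrite mul0r.
      by rewrite (_ : (_ - _)%MM = 0%MM) ?mpolyX0 ?meval1 ?mulr1 //; apply/mnmP=> l; rewrite mnmBE subnn mnm0E.
    - by rewrite [L _]raddfD derivD hornerD eq er mderivD mevalD.
    - by rewrite [L _]rmorphM derivM hornerD !hornerM eq er mderivM mevalD !mevalM !L0.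
  rewrite -dLE (_ : L p = 0) ?deriv0 ?horner0 //.
  apply/eqP/negPn/negP=> /poly_nonroot [c]; rewrite LE pv eqxx //.
have pC m : m != 0%MM -> p@_m = 0.
  move=> m0; have [i mi] : exists i, m i != 0%N.
    apply/existsP; apply: contraNT m0 => /existsPn h.
    by apply/eqP/mnmP=> i; rewrite mnm0E; apply/eqP/negPn/h.
  have := congr1 (mcoeff (m - U_(i))%MM) (dp0 i).
  rewrite mcoeff_deriv submK ?lep1mP // mcoeff0 => /eqP.
  by rewrite -mulr_natr mulf_eq0 (negPf (pnatr_neq0 _)) // orbF => /eqP.
have pE : p = (p@_0%MM)%:MP.
  apply/mpolyP=> m; rewrite mcoeffC.
  by case: (eqVneq m 0%MM) => [->|m0]; rewrite ?mulr1 // mulr0 pC.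
by have := pv (fun _ => 0); rewrite pE mevalC => ->; rewrite mpolyC0.
Qed.

Lemma mpoly_nonroot n (p : {mpoly k[n]}) : p != 0 -> exists v : 'rV[k]_n, p.@[v 0] != 0.
Proof.
move=> p0; apply: contrapT => H; move/eqP: p0; apply; apply: mpoly_vanish => v.
apply/eqP/negPn/negP => pv; apply: H; exists (\row_i v i).
by rewrite (meval_eq (v2 := v)) // => i; rewrite mxE.
Qed.

End Infinite.

Section Ideals.
Variables (k : fieldType) (n : nat).
Implicit Types (S : {mpoly k[n]} -> Prop) (p q : {mpoly k[n]}).

Definition is_ideal S : Prop :=
  [/\ S 0, forall p q, S p -> S q -> S (p + q) & forall p q, S q -> S (p * q)].

Lemma idealN S p : is_ideal S -> S p -> S (- p).
Proof. by case=> _ _ SM Sp; rewrite -mulN1r; apply: SM. Qed.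

Lemma idealB S p q : is_ideal S -> S p -> S q -> S (p - q).
Proof. by move=> idS; have [_ SD _] := idS => Sp Sq; apply: SD => //; apply: idealN. Qed.

Lemma idealZ S c p : is_ideal S -> S p -> S (c *: p).
Proof. by case=> _ _ SM Sp; rewrite -mul_mpolyC; apply: SM. Qed.

Lemma ideal_sum S (I : Type) (r : seq I) (P : pred I) F :
  is_ideal S -> (forall i, P i -> S (F i)) -> S (\sum_(i <- r | P i) F i).
Proof. by case=> S0 SD _ SF; elim/big_ind: _. Qed.

Lemma ideal_msub S m (g h : 'I_m -> {mpoly k[n]}) P :
  is_ideal S -> (forall i, S (g i - h i)) -> S (msub g P - msub h P).
Proof.
move=> idS; have [S0 SD SM] := idS => Sgh.
elim/mpoly_ring_ind: P => [c|i|p q Sp Sq|p q Sp Sq].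
- by rewrite !msubC subrr.
- by rewrite !msubX.
- by rewrite !rmorphD /= opprD addrACA; apply: SD.
- rewrite !rmorphM /= (_ : _ - _ = msub g p * (msub g q - msub h q) +
    msub h q * (msub g p - msub h p)); first by apply: (SD); apply: SM.
  by ring.
Qed.

Definition mdvd a p := exists q, p = a * q.

Lemma mdvd_ideal a : is_ideal (mdvd a).
Proof.
split=> [|_ _ [p ->] [q ->]|p _ [q ->]]; first by exists 0; rewrite mulr0.
  by exists (p + q); rewrite mulrDr.
by exists (p * q); rewrite mulrCA.
Qed.

End Ideals.

Section LinearForms.
Variables (k : fieldType) (n : nat).
Implicit Types (p q : {mpoly k[n]}) (u : 'cV[k]_n).

Definition lin u : {mpoly k[n]} := \sum_i u i 0 *: 'X_i.

Lemma linE u (y : 'rV[k]_n) : (lin u).@[y 0] = (y *m u) 0 0.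
Proof.
rewrite raddf_sum mxE; apply: eq_bigr => i _ /=.
by rewrite mevalZ mevalXU mulrC.
Qed.

Lemma mcoeff_lin u i : (lin u)@_U_(i) = u i 0.
Proof.
rewrite raddf_sum (bigD1 i) //= mcoeffZ mcoeffXU eqxx mulr1 big1 ?addr0 // => j ji.
by rewrite mcoeffZ mcoeffXU (negPf ji) mulr0.
Qed.

Lemma lin_is_linear : linear lin.
Proof.
move=> c u v; rewrite /lin scaler_sumr -big_split; apply: eq_bigr => i _ /=.
by rewrite !mxE scalerDl scalerA.
Qed.
HB.instance Definition _ := GRing.isLinear.Build k 'cV[k]_n {mpoly k[n]} _ lin lin_is_linear.

Lemma lin_eq0 u : (lin u == 0) = (u == 0).
Proof.
apply/eqP/eqP => [u0|->]; last by rewrite raddf0.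
by apply/matrixP=> i j; rewrite ord1 -mcoeff_lin u0 mcoeff0 mxE.
Qed.

Lemma mx_subst_lin (A : 'M[k]_n) u : mx_subst A (lin u) = lin (A *m u).
Proof.
rewrite raddf_sum /= /lin.
under eq_bigr => j _ do rewrite linearZ /= mx_substX scaler_sumr.
rewrite exchange_big; apply: eq_bigr => i _ /=; rewrite mxE scaler_suml.
by apply: eq_bigr => j _; rewrite scalerA mulrC.
Qed.

Lemma mx_substX_sub (u : 'cV[k]_n) (w : 'rV[k]_n) j :
  mx_subst (1%:M + u *m w) 'X_j - 'X_j = w 0 j *: lin u.
Proof.
have Xj : 'X_j = lin (delta_mx j 0).
  rewrite /lin (bigD1 j) //= mxE !eqxx scale1r big1 ?addr0 // => i ij.
  by rewrite mxE (negPf ij) scale0r.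
rewrite Xj mx_subst_lin mulmxDl mul1mx [lin (_ + _)]raddfD addrC addrA addNr add0r /=.
rewrite -linearZ /=; congr lin; apply/matrixP=> i l; rewrite ord1 -mulmxA -colE mxE.
by rewrite big_ord1 !mxE mulrC.
Qed.

(** The matrix fixes the hyperplane of [u] pointwise, and it suffices to look at the variables. The
    quotients are the divided differences of Chevalley's argument. *)
Lemma mdvd_transvection (u : 'cV[k]_n) (w : 'rV[k]_n) p :
  mdvd (lin u) (mx_subst (1%:M + u *m w) p - p).
Proof.
rewrite -[X in _ - X]msub_id mx_substE; apply: ideal_msub => [|j]; first exact: mdvd_ideal.
have := mx_substX_sub u w j; rewrite mx_substX => ->.
by exists (w 0 j)%:MP; rewrite mulrC mul_mpolyC.
Qed.

(** This matrix projects onto the hyperplane of [u]. Its substitution is restriction to that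
    hyperplane, so divisibility by [lin u] becomes vanishing under a ring morphism into a domain,
    whence [lin_prime]. *)
Lemma lin_projector u : u != 0 ->
  exists w : 'rV[k]_n, (1%:M + u *m w) *m u = 0.
Proof.
move=> u0; have [i ui] : exists i, u i 0 != 0.
  apply/existsP; apply: contraNT u0 => /existsPn h; apply/eqP/matrixP=> i j.
  by rewrite ord1 mxE; apply/eqP/negPn/h.
exists (- (u i 0)^-1 *: delta_mx 0 i); apply/matrixP=> a b.
rewrite mulmxDl mul1mx -mulmxA -scalemxAl -rowE -scalemxAr !mxE big_ord1 !mxE !ord1.
by rewrite mulNr [u a 0 * _]mulrC mulrA mulVf // mul1r subrr.
Qed.

Lemma mdvd_linP u (w : 'rV[k]_n) p : (1%:M + u *m w) *m u = 0 ->
  mdvd (lin u) p <-> mx_subst (1%:M + u *m w) p = 0.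
Proof.
move=> uw; split=> [[q ->]|e0].
  by rewrite rmorphM /= mx_subst_lin uw raddf0 mul0r.
have := mdvd_transvection u w p; rewrite e0 sub0r => /(idealN (mdvd_ideal _)).
by rewrite opprK.
Qed.

Lemma lin_prime u p q : u != 0 -> mdvd (lin u) (p * q) ->
  mdvd (lin u) p \/ mdvd (lin u) q.
Proof.
move=> /lin_projector [w uw]; rewrite !(mdvd_linP _ uw) rmorphM /= => /eqP.
by rewrite mulf_eq0 => /orP[] /eqP ->; [left | right].
Qed.

End LinearForms.

Lemma linear_bundle (k : fieldType) (U V : lmodType k) (f : U -> V) :
  linear f -> exists phi : {linear U -> V}, phi =1 f.
Proof.
move=> lf; pose m := GRing.isLinear.Build k U V _ f lf.
by exists (HB.pack_for {linear U -> V} f m).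
Qed.

Section Reflections.
Variables (k : fieldType) (n : nat).

Lemma is_reflection_mxP (A : 'M[k]_n) :
  is_reflection (fun v : 'rV[k]_n => v *m A) <->
  (exists2 r, (0 < r)%N & forall v : 'rV[k]_n, iter r (fun y => y *m A) v = v) /\
  exists (u : 'cV[k]_n) (w : 'rV[k]_n), [/\ u != 0, w != 0 & A = 1%:M + u *m w].
Proof.
split=> [[_ fin [phi [v0 phi0] phiP]]|[fin [u [w [u0 w0 AE]]]]].
  split=> //; pose c : 'cV[k]_n := \col_i phi (delta_mx 0 i).
  have phiE v : phi v = (v *m c) 0 0.
    rewrite {1}[v]row_sum_delta linear_sum mxE; apply: eq_bigr => i _.
    by rewrite linearZ mxE.
  (* Subtracting [phi v *: v1] moves [v] into the fixed hyperplane, so [A - 1] is determined by its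
     value at [v1]. *)
  pose v1 := (phi v0)^-1 *: v0.
  have phi1 : phi v1 = 1 by rewrite linearZ /= /GRing.scale /= mulVf.
  have AE : A = 1%:M + c *m (v1 *m (A - 1%:M)).
    apply/row_matrixP => i; rewrite !rowE mulmxDr mulmx1.
    set v := delta_mx 0 i : 'rV_n.
    have /phiP : phi (v - phi v *: v1) = 0.
      by rewrite linearB linearZ /= phi1 /GRing.scale /= mulr1 subrr.
    rewrite mulmxBl -scalemxAl => /subr0_eq /(canRL (subrK _)) ->.
    rewrite mulmxA [v *m c](_ : _ = (phi v)%:M); last first.
      by apply/matrixP=> a b; rewrite !ord1 phiE [RHS]mxE.
    by rewrite mul_scalar_mx mulmxBr mulmx1 scalerBr addrA addrAC.
  exists c, (v1 *m (A - 1%:M)); split => //.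
    by apply: contraNneq phi0 => c0; rewrite phiE c0 mulmx0 mxE.
  apply/eqP => w0; have := phiP v1; rewrite phi1 => -[H _].
  have /H/eqP : v1 *m A - v1 = 0 by rewrite -[v1 in X in _ - X]mulmx1 -mulmxBr.
  by rewrite oner_eq0.
split; [by move=> a v1 v2; rewrite mulmxDl scalemxAl | exact: fin |].
have lphi : linear (fun v : 'rV[k]_n => ((v *m u) 0 0 : k^o)).
  by move=> a v1 v2; rewrite mulmxDl -scalemxAl !mxE.
have [phi phiE] := linear_bundle lphi; exists phi => [|v].
  have [i ui] : exists i, u i 0 != 0.
    apply/existsP; apply: contraNT u0 => /existsPn h; apply/eqP/matrixP=> i j.
    by rewrite ord1 mxE; apply/eqP/negPn/h.
  by exists (delta_mx 0 i); rewrite phiE -rowE mxE.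
rewrite phiE AE mulmxDr mulmx1 addrC addKr mulmxA.
set s := (v *m u) 0 0; have -> : v *m u = s%:M.
  by apply/matrixP=> a b; rewrite !ord1 [RHS]mxE.
rewrite mul_scalar_mx; split=> [/eqP|->]; last by rewrite scale0r.
by rewrite scaler_eq0 (negPf w0) orbF => /eqP.
Qed.

End Reflections.

(** * Homogeneous components under substitution *)

Section Homogeneous.
Variables (k : fieldType).

Lemma mcoeff_pihomog n (mf : measure n) D (p : {mpoly k[n]}) u :
  (pihomog mf D p)@_u = if mf u == D then p@_u else 0.
Proof.
rewrite pihomogE raddf_sum /=.
have z v : v != u -> (p@_v *: 'X_[v])@_u = 0.
  by move=> /negPf vu; rewrite mcoeffZ mcoeffX vu mulr0.
case: ifP => uD; last first.
  by rewrite big1 // => v /eqP vD; apply: z; apply: contraFneq uD => <-; apply/eqP.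
case: (boolP (u \in msupp p)) => up.
  rewrite big_mkcond (bigD1_seq u) ?msupp_uniq //= uD mcoeffZ mcoeffX eqxx mulr1.
  by rewrite big1 ?addr0 // => v /z ->; rewrite if_same.
rewrite big1_seq ?(memN_msupp_eq0 up) // => v /andP[_ vp].
by apply: z; apply: contraNneq up => <-.
Qed.

Lemma dhomog_bigprod n (mg : measure n) (I : Type) (r : seq I) (F : I -> {mpoly k[n]}) D :
  (forall i, F i \is (D i).-homog for mg) ->
  \prod_(i <- r) F i \is (\sum_(i <- r) D i)%N.-homog for mg.
Proof.
move=> hF; apply: (big_ind2 (fun p d => p \is d.-homog for mg)) => //.
  exact: dhomog1.
by move=> p d q e hp hq; apply: dhomogM.
Qed.

Lemma dhomog_msub n m (mf : measure m) (mg : measure n) (h : 'I_m -> {mpoly k[n]}) D p :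
  (forall j, h j \is (mf U_(j)%MM).-homog for mg) ->
  p \is D.-homog for mf -> msub h p \is D.-homog for mg.
Proof.
move=> hh /dhomogP hp; rewrite [p]mpolyE raddf_sum /=.
rewrite big_seq; apply: rpred_sum => u up; rewrite linearZ /=; apply: rpredZ.
rewrite mpolyXE_id rmorph_prod /= -(hp u up) mfE; apply: dhomog_bigprod => i.
by rewrite rmorphXn /= msubX mulnC; apply: dhomogMn.
Qed.

Lemma pihomog_msub n m (mf : measure m) (mg : measure n) (h : 'I_m -> {mpoly k[n]}) D p :
  (forall j, h j \is (mf U_(j)%MM).-homog for mg) ->
  pihomog mg D (msub h p) = msub h (pihomog mf D p).
Proof.
move=> hh; rewrite {1}(pihomog_partitionE (leqnn (mmeasure mf p))).
have E (j : nat) : pihomog mg D (msub h (pihomog mf j p)) =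
    if j == D then msub h (pihomog mf D p) else 0.
  have hj := dhomog_msub hh (pihomogP mf j p).
  case: eqP => [jD|/eqP jD]; last by rewrite (pihomog_ne0 jD).
  by rewrite -jD pihomog_dE.
rewrite (raddf_sum (msub h)) (raddf_sum (pihomog mg D)) /=.
under eq_bigr => j _ do rewrite E.
case: (ltnP D (mmeasure mf p)) => lt.
  rewrite (bigD1 (Ordinal lt)) //= eqxx big1 ?addr0 // => i iD.
  by rewrite ifN //; apply: contra iD => /eqP iD; apply/eqP/val_inj.
rewrite big1 => [|i _]; last by rewrite ifN // neq_ltn (leq_trans (ltn_ord i)).
rewrite (_ : pihomog mf D p = 0) ?raddf0 //; apply/mpolyP=> u.
rewrite mcoeff_pihomog mcoeff0; case: eqP => // uD; apply: memN_msupp_eq0.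
by apply: (@mmeasure_mnm_ge _ _ mf); rewrite uD.
Qed.

Lemma dhomog_lin n (A : 'M[k]_n) j : \sum_i A i j *: 'X_i \is 1.-homog for mdeg.
Proof.
by apply: rpred_sum => i _; apply: rpredZ; rewrite dhomogX /= mdeg1.
Qed.

Lemma msize_mx_subst n (A : 'M[k]_n) (p : {mpoly k[n]}) :
  (msize (mx_subst A p) <= msize p)%N.
Proof.
apply/bigmax_leqP_seq => u + _; rewrite mcoeff_msupp ltnNge; apply: contra => le.
have := mcoeff_pihomog mdeg (mdeg u) (mx_subst A p) u; rewrite eqxx => <-.
rewrite mx_substE (@pihomog_msub _ _ mdeg) => [|j]; last by rewrite /= mdeg1 dhomog_lin.
rewrite (_ : pihomog _ _ _ = 0) ?raddf0 ?mcoeff0 //; apply/mpolyP=> v.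
rewrite mcoeff_pihomog mcoeff0; case: eqP => // uv; apply: memN_msupp_eq0.
by apply: msize_mdeg_ge; rewrite uv.
Qed.

End Homogeneous.

Section IdealMul.
Variables (k : fieldType) (n : nat).
Implicit Types (S T : {mpoly k[n]} -> Prop) (p q : {mpoly k[n]}).

Lemma ideal_mul0 S T : ideal_mul S T 0.
Proof. by exists [::]; rewrite ?big_nil. Qed.

Lemma ideal_mul1 S T p q : S p -> T q -> ideal_mul S T (p * q).
Proof.
move=> Sp Tq; exists [:: (p, q)]; last by rewrite big_seq1.
by move=> u; rewrite inE => /eqP ->.
Qed.

Lemma ideal_mulD S T p q : ideal_mul S T p -> ideal_mul S T q -> ideal_mul S T (p + q).
Proof.
move=> [s hs ->] [t ht ->]; exists (s ++ t); last by rewrite big_cat.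
by move=> u; rewrite mem_cat => /orP[/hs|/ht].
Qed.

Lemma ideal_mul_ind S T (P : {mpoly k[n]} -> Prop) :
    P 0 -> (forall p q, P p -> P q -> P (p + q)) ->
    (forall p q, S p -> T q -> P (p * q)) ->
  forall p, ideal_mul S T p -> P p.
Proof.
move=> P0 PD PM p [s hs ->]; rewrite big_seq; elim/big_ind: _ => // u /hs [].
exact: PM.
Qed.

Lemma ideal_mul_sum S T (I : Type) (r : seq I) (P : pred I) F :
  (forall i, P i -> ideal_mul S T (F i)) -> ideal_mul S T (\sum_(i <- r | P i) F i).
Proof. by move=> SF; elim/big_ind: _ => //; [exact: ideal_mul0 | exact: ideal_mulD]. Qed.

Lemma ideal_mulMl S T a p :
  (forall b, S b -> S (a * b)) -> ideal_mul S T p -> ideal_mul S T (a * p).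
Proof.
move=> Sa; elim/ideal_mul_ind: p / => [|p q hp hq|p q Sp Tq].
- by rewrite mulr0; apply: ideal_mul0.
- by rewrite mulrDr; apply: ideal_mulD.
- by rewrite mulrA; apply: ideal_mul1 => //; apply: Sa.
Qed.

Lemma ideal_mulMr S T a p :
  (forall b, T b -> T (a * b)) -> ideal_mul S T p -> ideal_mul S T (a * p).
Proof.
move=> Ta; elim/ideal_mul_ind: p / => [|p q hp hq|p q Sp Tq].
- by rewrite mulr0; apply: ideal_mul0.
- by rewrite mulrDr; apply: ideal_mulD.
- by rewrite mulrCA; apply: ideal_mul1 => //; apply: Ta.
Qed.

Lemma ideal_mulS (S S' T T' : {mpoly k[n]} -> Prop) p :
    (forall q, S q -> S' q) -> (forall q, T q -> T' q) ->
  ideal_mul S T p -> ideal_mul S' T' p.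
Proof. by move=> SS' TT' [s hs ->]; exists s => // u /hs [/SS' ? /TT' ?]. Qed.

Lemma ideal_mul_ideal S T :
  (forall a b, S b -> S (a * b)) -> is_ideal (ideal_mul S T).
Proof.
move=> SM; split; [exact: ideal_mul0 | by move=> p q; apply: ideal_mulD |].
by move=> p q; apply: ideal_mulMl => b; apply: SM.
Qed.

End IdealMul.

Section Action.
Variables (k : fieldType) (n : nat) (gT : finGroupType) (Wt : {group gT}).
Variable rho : mx_representation k Wt n.
Implicit Types (p q : {mpoly k[n]}) (g h : gT) (H : {group gT}).

Lemma mx_subst_rM g h p : g \in Wt -> h \in Wt ->
  mx_subst (rho (g * h)%g) p = mx_subst (rho g) (mx_subst (rho h) p).
Proof. by move=> gW hW; rewrite mx_substM repr_mxM. Qed.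

Lemma mx_subst_r1 p : mx_subst (rho 1%g) p = p.
Proof. by rewrite repr_mx1 mx_subst1. Qed.

Lemma mx_subst_rK g p : g \in Wt -> mx_subst (rho g^-1%g) (mx_subst (rho g) p) = p.
Proof. by move=> gW; rewrite -mx_subst_rM ?groupV // mulVg mx_subst_r1. Qed.

Lemma mx_subst_rKV g p : g \in Wt -> mx_subst (rho g) (mx_subst (rho g^-1%g) p) = p.
Proof. by move=> gW; rewrite -mx_subst_rM ?groupV // mulgV mx_subst_r1. Qed.

Definition trace H p : {mpoly k[n]} := \sum_(g in H) mx_subst (rho g) p.

Lemma trace_is_additive H : additive (trace H).
Proof. by move=> p q; rewrite /trace -sumrB; apply: eq_bigr => g _; rewrite raddfB. Qed.
HB.instance Definition _ H :=
  GRing.isAdditive.Build {mpoly k[n]} {mpoly k[n]} (trace H) (trace_is_additive H).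

Lemma trace_invariant H p : H \subset Wt -> trace H p \in invariant rho H.
Proof.
move=> sHW; apply/invariantP => h hH; rewrite raddf_sum /=.
rewrite [RHS](reindex_inj (mulgI h)) /=; apply: eq_big => g; first by rewrite groupMl.
by move=> gH; rewrite mx_subst_rM ?(subsetP sHW).
Qed.

Lemma traceMl H u p : u \in invariant rho H -> trace H (u * p) = u * trace H p.
Proof.
move=> /invariantP uI; rewrite mulr_sumr; apply: eq_bigr => g gH.
by rewrite rmorphM /= uI.
Qed.

Lemma trace_id H u : u \in invariant rho H -> trace H u = u *+ #|H|.
Proof.
by move=> /invariantP uI; rewrite -sumr_const; apply: eq_bigr => g /uI.
Qed.

Lemma invariantS (H H' : {set gT}) : H' \subset H ->
  {subset invariant rho H <= invariant rho H'}.
Proof. by move=> sH p /invariantP pI; apply/invariantP => g /(subsetP sH)/pI. Qed.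

End Action.

(** * Chevalley's theorem near the origin *)

Section Chevalley.
Variables (k : fieldType) (n : nat) (gT : finGroupType) (Wt : {group gT}).
Variable rho : mx_representation k Wt n.
Hypothesis hk : [pchar k] =i pred0.
Implicit Types (p q u t : {mpoly k[n]}) (g h : gT).

Local Notation inv := (invariant rho Wt).
Local Notation ev0 p := (p.@[(0 : 'rV[k]_n) 0]).
Local Notation act g := (mx_subst (rho g)).

(** The rank-one form of a reflection; the finite order asked for by [is_reflection] comes from the
    finite group, see [mxreflectionP]. *)
Definition mxreflection g : Prop :=
  exists (u : 'cV[k]_n) (w : 'rV[k]_n), [/\ u != 0, w != 0 & rho g = 1%:M + u *m w].

Definition hilbert_ideal : {mpoly k[n]} -> Prop :=
  ideal_mul (fun=> True) (fun u => u \in inv /\ ev0 u = 0).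

Lemma hilbert_is_ideal : is_ideal hilbert_ideal.
Proof. exact: ideal_mul_ideal. Qed.

Lemma hilbert_act g p : g \in Wt -> hilbert_ideal p -> hilbert_ideal (act g p).
Proof.
move=> gW; elim/ideal_mul_ind: p / => [|p q hp hq|p q _ [qI q0]].
- by rewrite raddf0; case: hilbert_is_ideal.
- by rewrite raddfD; case: hilbert_is_ideal => _ + _; apply.
- rewrite rmorphM /= (invariantP _ _ _ qI) //; exact: ideal_mul1.
Qed.

(** The Hilbert ideal is stable under the group, so the elements fixing [p] modulo it form a
    subgroup. *)
Lemma hilbert_gen (S : {set gT}) p : S \subset Wt -> <<S>>%g = Wt ->
  {in S, forall s, hilbert_ideal (act s p - p)} ->
  {in Wt, forall g, hilbert_ideal (act g p - p)}.
Proof.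
move=> sSW genS hS g.
have [h0 hD hM] := hilbert_is_ideal.
have gX : group_set [set g in Wt | `[< hilbert_ideal (act g p - p) >]].
  apply/group_setP; split=> [|a b].
    by rewrite inE group1; apply/asboolP; rewrite mx_subst_r1 subrr.
  rewrite !inE => /andP[aW /asboolP ha] /andP[bW /asboolP hb].
  rewrite groupM //; apply/asboolP; rewrite mx_subst_rM //.
  rewrite (_ : _ - p = act a (act b p - p) + (act a p - p)).
    by apply: hD => //; apply: hilbert_act.
  by rewrite raddfB addrA subrK.
move=> gW; have /subsetP/(_ g) : <<S>>%g \subset Group gX.
  rewrite gen_subG; apply/subsetP => s sS; rewrite inE (subsetP sSW) //=.
  exact/asboolP/hS.
by rewrite genS => /(_ gW); rewrite inE => /andP[_ /asboolP].
Qed.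

(** Over the invariants localised at the origin, [u ord0] is in the ideal of the other [u i]; [t] is
    the common denominator. *)
Definition locally_redundant l (u : 'I_l.+1 -> {mpoly k[n]}) : Prop :=
  exists t (c : 'I_l -> {mpoly k[n]}), [/\ t \in inv, ev0 t != 0,
    forall i, c i \in inv & t * u ord0 = \sum_i c i * u (lift ord0 i)].

Hypothesis genW : <<[set g in Wt | `[< mxreflection g >]]>>%g = Wt.

(** Induction on the degree of [q ord0]. The divided differences of the [q i] by a reflection
    satisfy the same relation in lower degree, so [q ord0] is invariant modulo the Hilbert ideal,
    hence congruent to its average. *)
Lemma chevalley l (u q : 'I_l.+1 -> {mpoly k[n]}) :
    (forall i, u i \in inv) -> \sum_i u i * q i = 0 ->
  ~ locally_redundant u -> hilbert_ideal (q ord0).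
Proof.
move=> uI + nred.
have [h0 hD hM] := hilbert_is_ideal.
move: {2}(msize _) (leqnn (msize (q ord0))) => N.
elim: N q => [|N IH] q.
  rewrite leqn0 msize_poly_eq0 => /eqP -> _; exact: h0.
move=> sq rel.
have hs : {in [set g in Wt | `[< mxreflection g >]], forall s,
    hilbert_ideal (act s (q ord0) - q ord0)}.
  move=> s; rewrite inE => /andP[sW /asboolP [a [w [a0 _ rs]]]].
  have /fin_all_exists [D DE] i : exists Di, act s (q i) - q i = lin a * Di.
    by rewrite rs; apply: mdvd_transvection.
  rewrite DE; apply: (hM); have la0 : lin a != 0 by rewrite lin_eq0.
  have [D0|D0] := eqVneq (D ord0) 0; first by rewrite D0.
  apply: IH.
    rewrite -ltnS (leq_trans _ sq) //.
    have : (msize (lin a * D ord0) <= msize (q ord0))%N.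
      rewrite -DE (leq_trans (mmeasureD_le _ _ _)) // mmeasureN geq_max leqnn andbT.
      exact: msize_mx_subst.
    rewrite msizeM // (_ : msize (lin a) = 2) //.
    apply/eqP; rewrite eqn_leq; apply/andP; split.
      rewrite (leq_trans (mmeasure_sum _ _ _ _)) //; apply/bigmax_leqP => i _.
      by rewrite (leq_trans (mmeasureZ_le _ _ _)) // mmeasureX /= mdeg1.
    have [i ai] : exists i, a i 0 != 0.
      apply/existsP; apply: contraNT a0 => /existsPn h; apply/eqP/matrixP=> i j.
      by rewrite ord1 mxE; apply/eqP/negPn/h.
    have := @msize_mdeg_lt _ _ (lin a) U_(i)%MM; rewrite mdeg1; apply.
    by rewrite mcoeff_msupp mcoeff_lin.
  apply: (mulfI la0); rewrite mulr0 mulr_sumr.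
  transitivity (act s (\sum_i u i * q i) - \sum_i u i * q i); last by rewrite rel raddf0 subrr.
  rewrite rmorph_sum -sumrB; apply: eq_bigr => i _ /=.
  by rewrite rmorphM /= (invariantP _ _ _ (uI i)) // -mulrBr DE mulrCA.
have hW := hilbert_gen _ genW hs.
have {hW} : hilbert_ideal (trace rho Wt (q ord0) - q ord0 *+ #|Wt|).
  rewrite -sumr_const -sumrB; apply: ideal_sum; first exact: hilbert_is_ideal.
  by move=> g gW; apply: hW => //; apply/subsetP => s; rewrite inE => /andP[].
have tI : trace rho Wt (q ord0) \in inv by apply: trace_invariant.
(* If the average did not vanish at the origin, averaging the whole relation would make [u ord0]
   redundant. *)
case: (eqVneq (ev0 (trace rho Wt (q ord0))) 0) => [t0|t0]; last first.
  case: nred; exists (trace rho Wt (q ord0)), (fun i => - trace rho Wt (q (lift ord0 i))).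
  split=> // [i|]; first by rewrite rpredN trace_invariant.
  have := congr1 (trace rho Wt) rel; rewrite raddf0 raddf_sum big_ord_recl /=.
  rewrite traceMl // => /eqP; rewrite addr_eq0 => /eqP; rewrite mulrC => ->.
  rewrite -sumrN; apply: eq_bigr => i _.
  by rewrite traceMl ?mulNr 1?mulrC.
have ht : hilbert_ideal (trace rho Wt (q ord0)).
  by rewrite -[X in hilbert_ideal X]mul1r; apply: ideal_mul1.
move=> /(idealB hilbert_is_ideal ht); rewrite opprB addrC subrK -scaler_nat.
have c0 : #|Wt|%:R != 0 :> k by rewrite pnatr_neq0 // cardG_gt0.
by move=> /(idealZ (#|Wt|%:R^-1) hilbert_is_ideal); rewrite scalerA mulVf // scale1r.
Qed.

Definition hilbert_free l (q : 'I_l -> {mpoly k[n]}) : Prop :=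
  forall c : 'I_l -> k, hilbert_ideal (\sum_i c i *: q i) -> forall i, c i = 0.

(** If [u ord0] is not redundant, [chevalley] puts [q ord0] into the Hilbert ideal, against
    freeness. Otherwise eliminating it leaves a shorter relation with entries
    [t * q i + c i * q ord0]; these are still free, because invariants are congruent to their values
    at the origin and that of [t] is nonzero. *)
Lemma hilbert_free_indep l (u q : 'I_l -> {mpoly k[n]}) :
    (forall i, u i \in inv) -> hilbert_free q -> \sum_i u i * q i = 0 ->
  forall i, u i = 0.
Proof.
have [h0 hD hM] := hilbert_is_ideal.
elim: l u q => [|l IH] u q uI fq rel; first by case.
case: (EM (locally_redundant u)) => [[t [c [tI t0 cI tu]]]|nred]; last first.
  have /fq/(_ ord0) : hilbert_ideal (\sum_i (i == ord0)%:R *: q i).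
    rewrite (bigD1 ord0) //= scale1r big1 ?addr0; first exact: chevalley nred.
    by move=> i /negPf ->; rewrite scale0r.
  by move/eqP; rewrite oner_eq0.
have hinv p : p \in inv -> hilbert_ideal (p - (ev0 p)%:MP).
  move=> pI; rewrite -[X in hilbert_ideal X]mul1r; apply: ideal_mul1 => //.
  split; last by rewrite mevalB mevalC subrr.
  by rewrite rpredB // -[_%:MP]mulr1 mul_mpolyC rpredZ ?rpred1.
have uS i : u (lift ord0 i) = 0.
  apply: (IH (fun i => u (lift ord0 i)) (fun i => t * q (lift ord0 i) + c i * q ord0) _ _ _ i) => // [a ha|].
    pose b j := if unlift ord0 j is Some i then ev0 t * a i
                else \sum_i a i * ev0 (c i).
    have hb : hilbert_ideal (\sum_j b j *: q j).
      rewrite big_ord_recl /b unlift_none.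
      rewrite (eq_bigr (fun j => (ev0 t * a j) *: q (lift ord0 j))) => [|j _]; last by rewrite (liftK ord0 j).
      suff /(idealB hilbert_is_ideal ha) : hilbert_ideal (\sum_i a i *: (t * q (lift ord0 i) + c i * q ord0) -
          ((\sum_i a i * ev0 (c i)) *: q ord0 + \sum_i (ev0 t * a i) *: q (lift ord0 i))).
        by rewrite opprB addrC subrK.
      rewrite scaler_suml -big_split -sumrB /=; apply: ideal_sum => [|j _]; first exact: hilbert_is_ideal.
      rewrite (_ : _ - _ = a j *: ((c j - (ev0 (c j))%:MP) * q ord0 + (t - (ev0 t)%:MP) * q (lift ord0 j))).
        by apply: idealZ; [exact: hilbert_is_ideal | apply: hD; rewrite mulrC; apply: hM; apply: hinv].
      rewrite -!mul_mpolyC !rmorphM /=; ring.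
    move=> j; have := fq _ hb (lift ord0 j); rewrite /b (liftK ord0 j) => /eqP.
    by rewrite mulf_eq0 (negPf t0) => /eqP.
  under eq_bigr => j _ do rewrite mulrDr.
  rewrite big_split /=.
  have e := congr1 ( *%R t) rel; rewrite /= mulr0 big_ord_recl mulrDr mulrA tu in e.
  apply: etrans e; rewrite addrC mulr_suml mulr_sumr.
  by congr (_ + _); apply: eq_bigr => j _; ring.
move=> i; case: (unliftP ord0 i) => [j ->|->] //.
have /eqP : t * u ord0 = 0 by rewrite tu big1 // => j _; rewrite uS mulr0.
rewrite mulf_eq0 => /orP[/eqP tz|/eqP //].
by rewrite tz meval0 eqxx in t0.
Qed.

End Chevalley.

(** * Separation of points by invariants *)

Section Separation.
Variables (k : fieldType) (n : nat) (gT : finGroupType) (Wt : {group gT}).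
Variable rho : mx_representation k Wt n.
Hypothesis hk : [pchar k] =i pred0.

Lemma interpolation (y : 'rV[k]_n) (r : seq 'rV[k]_n) : y \notin r ->
  exists p : {mpoly k[n]}, p.@[y 0] = 1 /\ {in r, forall z : 'rV[k]_n, p.@[z 0] = 0}.
Proof.
elim: r => [|z r IH]; first by exists 1; rewrite meval1.
rewrite inE negb_or => /andP[yz /IH [p [py pr]]].
have [i yzi] : exists i, y 0 i - z 0 i != 0.
  apply/existsP; apply: contraNT yz => /existsPn h; apply/eqP/matrixP=> i j.
  by rewrite ord1; apply/eqP; rewrite -subr_eq0; apply/negPn/h.
exists ((y 0 i - z 0 i)^-1 *: ('X_i - (z 0 i)%:MP) * p); split=> [|z'].
  by rewrite mevalM mevalZ mevalB mevalXU mevalC mulVf // py mulr1.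
rewrite inE mevalM mevalZ mevalB mevalXU mevalC => /orP[/eqP->|/pr ->].
  by rewrite subrr mulr0 mul0r.
by rewrite mulr0.
Qed.

(** Interpolate on the whole [H]-orbits of [r] and average; as [H] fixes [y], this keeps the value
    at [y], and [y] is on none of these orbits. *)
Lemma sep_invariant (H : {group gT}) (y : 'rV[k]_n) (r : seq 'rV[k]_n) :
    H \subset Wt -> {in H, forall h, y *m rho h = y} -> y \notin r ->
  exists p, [/\ p \in invariant rho H, p.@[y 0] = 1
              & {in r, forall z : 'rV[k]_n, p.@[z 0] = 0}].
Proof.
move=> sHW yH yr.
have [|q [qy qr]] := @interpolation y [seq z *m rho h | z <- r, h <- enum H].
  apply: contra yr => /allpairsP [[z h] /= [zr]]; rewrite mem_enum => hH yz.
  suff -> : y = z by [].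
  apply: (can_inj (repr_mxK rho (subsetP sHW h hH))).
  by rewrite -yz yH.
exists (#|H|%:R^-1 *: trace rho H q); split=> [||z zr].
- by rewrite rpredZ // trace_invariant.
- rewrite mevalZ raddf_sum /=; under eq_bigr => h hH do rewrite mx_subst_eval yH // qy.
  by rewrite sumr_const mulVf // pnatr_neq0 // cardG_gt0.
rewrite mevalZ raddf_sum /= big1 ?mulr0 // => h hH; rewrite mx_subst_eval qr //.
by apply: allpairs_f => //; rewrite mem_enum.
Qed.

Lemma coef_invariant (H : {set gT}) (F : {poly {mpoly k[n]}}) i :
  {in H, forall h, map_poly (mx_subst (rho h)) F = F} -> F`_i \in invariant rho H.
Proof.
by move=> hF; apply/invariantP => h hH; rewrite -{2}(hF h hH) coef_map.
Qed.

End Separation.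

(** * Local bases over the invariants *)

Section LocalBasis.
Variables (k : fieldType) (n : nat) (gT : finGroupType) (Wt : {group gT}).
Variable rho : mx_representation k Wt n.
Implicit Types (p q u t : {mpoly k[n]}).

Local Notation inv := (invariant rho Wt).
Local Notation ev0 p := (p.@[(0 : 'rV[k]_n) 0]).
Local Notation act g := (mx_subst (rho g)).
Local Notation hilbert_ideal := (hilbert_ideal rho).

Definition locgen N (b : 'I_N -> {mpoly k[n]}) p : Prop :=
  exists t c, [/\ t \in inv, ev0 t != 0, forall i, c i \in inv & t * p = \sum_i c i * b i].

Lemma locgenD N (b : 'I_N -> {mpoly k[n]}) p q :
  locgen b p -> locgen b q -> locgen b (p + q).
Proof.
move=> [t [c [tI t0 cI tp]]] [t' [c' [tI' t0' cI' tp']]].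
exists (t * t'), (fun i => t' * c i + t * c' i); split=> [||i|].
- by rewrite rpredM.
- by rewrite mevalM mulf_neq0.
- by rewrite rpredD ?rpredM.
under eq_bigr => i _ do rewrite mulrDl -!mulrA.
by rewrite big_split -!mulr_sumr -tp -tp' /=; ring.
Qed.

Lemma locgenMl N (b : 'I_N -> {mpoly k[n]}) p q :
  p \in inv -> locgen b q -> locgen b (p * q).
Proof.
move=> pI [t [c [tI t0 cI tp]]]; exists t, (fun i => p * c i); split=> // [i|].
  by rewrite rpredM.
under eq_bigr => i _ do rewrite -mulrA.
by rewrite -mulr_sumr -tp mulrCA.
Qed.

Lemma locgen0 N (b : 'I_N -> {mpoly k[n]}) : locgen b 0.
Proof.
exists 1, (fun=> 0); split=> [||i|]; rewrite ?rpred1 ?rpred0 // ?meval1 ?oner_eq0 //.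
by rewrite mulr0 big1 // => i _; rewrite mul0r.
Qed.

Lemma locgen_sum N (b : 'I_N -> {mpoly k[n]}) (I : Type) (r : seq I) (P : pred I) F :
  (forall i, P i -> locgen b (F i)) -> locgen b (\sum_(i <- r | P i) F i).
Proof. by move=> hF; elim/big_ind: _ => //; [exact: locgen0 | exact: locgenD]. Qed.

Lemma locgen_mem N (b : 'I_N -> {mpoly k[n]}) i : locgen b (b i).
Proof.
exists 1, (fun j => (j == i)%:R); split=> [||j|]; rewrite ?rpred1 // ?meval1 ?oner_eq0 //.
  by rewrite rpred_nat.
rewrite mul1r (bigD1 i) //= eqxx mul1r big1 ?addr0 // => j /negPf ->.
by rewrite mul0r.
Qed.

Lemma locgen_exists : exists N (b : 'I_N -> {mpoly k[n]}), forall p, locgen b p.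
Proof.
pose T := {ffun 'I_n -> 'I_#|Wt|}.
pose b (i : 'I_#|T|) : {mpoly k[n]} := 'X_[[multinom (enum_val i : T) j | j < n]].
exists #|T|, b => p.
suff gX m : locgen b 'X_[m].
  rewrite [p]mpolyE; apply: locgen_sum => m _; rewrite -mul_mpolyC.
  by apply: locgenMl => //; rewrite -[_%:MP]mulr1 mul_mpolyC rpredZ ?rpred1.
move: {2}(mdeg m) (leqnn (mdeg m)) => D; elim: D m => [|D IH] m mD;
  case: (boolP [forall i, (m i < #|Wt|)%N]) => [/forallP lt|/forallPn [i]].
- have -> : 'X_[m] = b (enum_rank [ffun i => Ordinal (lt i)]); last exact: locgen_mem.
  by rewrite /b enum_rankK; congr ('X_[_]); apply/mnmP => i; rewrite mnmE ffunE.
- move: mD; rewrite leqn0 mdeg_eq0 => /eqP ->; rewrite mnm0E -leqNgt.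
  by rewrite leqNgt cardG_gt0.
- have -> : 'X_[m] = b (enum_rank [ffun i => Ordinal (lt i)]); last exact: locgen_mem.
  by rewrite /b enum_rankK; congr ('X_[_]); apply/mnmP => i; rewrite mnmE ffunE.
rewrite -leqNgt => le.
(* A monic polynomial with invariant coefficients and root ['X_i]: it rewrites the power [#|Wt|] of
   ['X_i] by lower ones. *)
pose F : {poly {mpoly k[n]}} := \prod_(g in Wt) ('X - (act g 'X_i)%:P).
have FI j : F`_j \in inv.
  apply: coef_invariant => h hW; rewrite rmorph_prod [RHS](reindex_inj (mulgI h)) /=.
  apply: eq_big => g; first by rewrite groupMl.
  by move=> gW; rewrite rmorphB /= map_polyX map_polyC /= mx_subst_rM.
have sF : size F = #|Wt|.+1.
  by rewrite /F -big_enum size_prod_XsubC cardE.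
have lF : F`_#|Wt| = 1.
  have /monicP : F \is monic by rewrite /F monic_prod_XsubC.
  by rewrite /lead_coef sF.
have : F.['X_i] = 0.
  rewrite /F horner_prod; apply/eqP/prodf_eq0; exists 1%g; rewrite ?group1 //.
  by rewrite (mx_subst_r1 rho) hornerXsubC subrr.
rewrite horner_coef sF big_ord_recr /= lF mul1r => /eqP; rewrite addrC addr_eq0 => /eqP Xi.
have mE : m = ((m - U_(i) *+ #|Wt|) + U_(i) *+ #|Wt|)%MM.
  rewrite submK //; apply/mnm_lepP => j; rewrite mulmnE mnm1E.
  by case: eqP => [<-|]; rewrite ?mul1n ?mul0n.
rewrite mE mpolyXD -mpolyXn Xi mulrN -mulNr mulr_sumr; apply: locgen_sum => j _.
rewrite mulrCA; apply: locgenMl => //.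
rewrite mulNr -mulN1r; apply: locgenMl; first by rewrite rpredN rpred1.
rewrite mpolyXn -mpolyXD; apply: IH.
rewrite -ltnS (leq_trans _ mD) // {2}mE !mdegD ltn_add2l !mdegMn mdeg1 !mul1n.
exact: ltn_ord.
Qed.

Lemma hilbert_locgen N (b : 'I_N -> {mpoly k[n]}) p :
  (forall q, locgen b q) -> hilbert_ideal p ->
  exists t c, [/\ t \in inv, ev0 t != 0, forall i, c i \in inv /\ ev0 (c i) = 0
    & t * p = \sum_i c i * b i].
Proof.
move=> gb; elim/ideal_mul_ind: p / => [|p q|p q _ [qI q0]].
- exists 1, (fun=> 0); split=> [||i|]; rewrite ?rpred1 ?rpred0 ?meval0 // ?meval1 ?oner_eq0 //.
  by rewrite mulr0 big1 // => i _; rewrite mul0r.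
- move=> [t [c [tI t0 cI tp]]] [t' [c' [tI' t0' cI' tp']]].
  exists (t * t'), (fun i => t' * c i + t * c' i); split=> [||i|].
  + by rewrite rpredM.
  + by rewrite mevalM mulf_neq0.
  + case: (cI i) (cI' i) => [cI1 c0] [cI2 c0'].
    by rewrite rpredD ?rpredM // mevalD !mevalM c0 c0' !mulr0 addr0.
  under eq_bigr => i _ do rewrite mulrDl -!mulrA.
  by rewrite big_split -!mulr_sumr -tp -tp' /=; ring.
have [t [c [tI t0 cI tp]]] := gb p.
exists t, (fun i => q * c i); split=> // [i|].
  by rewrite rpredM ?cI // mevalM q0 mul0r.
under eq_bigr => i _ do rewrite -mulrA.
by rewrite -mulr_sumr -tp mulrA mulrC.
Qed.

Lemma local_basis : exists N (b : 'I_N -> {mpoly k[n]}),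
  hilbert_free rho b /\ forall p, locgen b p.
Proof.
have ex : exists N, `[< exists b : 'I_N -> {mpoly k[n]}, forall p, locgen b p >].
  by have [N [b hb]] := locgen_exists; exists N; apply/asboolP; exists b.
case: (ex_minnP ex) => -[|N] /asboolP [b gb] minN.
  by exists 0%N, b; split=> // c _ [].
exists N.+1, b; split=> // a ha i0; apply/eqP/negPn/negP => ai.
suff /minN : `[< exists b : 'I_N -> {mpoly k[n]}, forall p, locgen b p >].
  by rewrite ltnn.
apply/asboolP; exists (b \o lift i0) => p.
have [t [v [tI t0 vI tE]]] := hilbert_locgen gb ha.
(* The coefficient of [b i0] once the dependence is written out; it is nonzero at the origin since
   [v i0] vanishes there. *)
pose T := t * (a i0)%:MP - v i0.
have cI (c : k) : c%:MP \in inv by rewrite -[_%:MP]mulr1 mul_mpolyC rpredZ ?rpred1.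
have split0 (F : 'I_N.+1 -> {mpoly k[n]}) : \sum_i F i = F i0 + \sum_i F (lift i0 i).
  rewrite (bigD1 i0) //=; congr (_ + _).
  rewrite (reindex_omap (lift i0) (unlift i0)) => [|j ji] /=; last first.
    by case: unliftP ji => [l ->|->]; rewrite ?eqxx.
  by apply: eq_bigl => j; rewrite liftK eqxx andbT eq_sym neq_lift.
have Tb : T * b i0 = \sum_i (v (lift i0 i) - t * (a (lift i0 i))%:MP) * b (lift i0 i).
  have := tE; rewrite !split0 mulrDr mulr_sumr => /eqP.
  rewrite -subr_eq0 opprD addrACA addr_eq0 -sumrB => /eqP e.
  rewrite /T mulrBl -mulrA mul_mpolyC e -sumrN; apply: eq_bigr => i _.
  by rewrite -mul_mpolyC; ring.
have [t' [w [tI' t0' wI tp]]] := gb p.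
exists (T * t'), (fun i => T * w (lift i0 i) + w i0 * (v (lift i0 i) - t * (a (lift i0 i))%:MP)).
have TI : T \in inv by rewrite rpredB ?rpredM //; case: (vI i0).
split=> [||i|] /=.
- by rewrite rpredM.
- rewrite mevalM mulf_neq0 // mevalB mevalM mevalC; case: (vI i0) => _ ->.
  by rewrite subr0 mulf_neq0.
- case: (vI (lift i0 i)) => vI1 _; apply: rpredD; apply: rpredM => //.
  by apply: rpredB => //; apply: rpredM.
rewrite -mulrA tp split0 mulrDr mulrCA Tb !mulr_sumr addrC -big_split /=.
by apply: eq_bigr => i _; ring.
Qed.

End LocalBasis.

(** * Steinberg's theorem on stabilisers *)

Section TensorImage.
Variables (k : fieldType) (n : nat) (gT : finGroupType) (Wt : {group gT}).
Variable rho : mx_representation k Wt n.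
Hypothesis hk : [pchar k] =i pred0.
Hypothesis genW : <<[set g in Wt | `[< mxreflection rho g >]]>>%g = Wt.
Implicit Types (p q u t : {mpoly k[n]}) (z : gT -> {mpoly k[n]}).

Local Notation B := {mpoly k[n]}.
Local Notation inv := (invariant rho Wt).
Local Notation ev0 p := (p.@[(0 : 'rV[k]_n) 0]).
Local Notation act g := (mx_subst (rho g)).

(* The image of B (x)_(B^W) B in the product of copies of B indexed by W, by   *)
(* p (x) q |-> (p * w(q))_w, localised at the origin of V/W.                   *)
Definition tensor_image z : Prop :=
  exists t (s : seq ({mpoly k[n]} * {mpoly k[n]})), [/\ t \in inv, ev0 t != 0
    & {in Wt, forall w, t * z w = \sum_(u <- s) u.1 * act w u.2}].

Lemma tensor_ext z z' : {in Wt, z =1 z'} -> tensor_image z -> tensor_image z'.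
Proof.
move=> zz [t [s [tI t0 zE]]]; exists t, s; split=> // w wW.
by rewrite -(zz w wW) zE.
Qed.

Lemma tensor1 : tensor_image (fun=> 1).
Proof.
exists 1, [:: (1, 1)]; split=> [||w _]; rewrite ?rpred1 ?meval1 ?oner_eq0 //.
by rewrite big_seq1 /= rmorph1.
Qed.

Lemma tensorD z z' : tensor_image z -> tensor_image z' -> tensor_image (fun w => z w + z' w).
Proof.
move=> [t [s [tI t0 zE]]] [t' [s' [tI' t0' zE']]].
exists (t * t'), ([seq (t' * u.1, u.2) | u : B * B <- s] ++ [seq (t * u.1, u.2) | u : B * B <- s']).
split=> [||w wW]; first by rewrite rpredM.
  by rewrite mevalM mulf_neq0.
rewrite big_cat !big_map /=.
under eq_bigr => u _ do rewrite -mulrA.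
rewrite -mulr_sumr -zE // addrC.
under eq_bigr => u _ do rewrite -mulrA.
by rewrite -mulr_sumr -zE' //; ring.
Qed.

Lemma tensorMl q z : tensor_image z -> tensor_image (fun w => q * z w).
Proof.
move=> [t [s [tI t0 zE]]]; exists t, [seq (q * u.1, u.2) | u : B * B <- s]; split=> // w wW.
rewrite big_map mulrCA zE // mulr_sumr.
by apply: eq_bigr => u _ /=; rewrite mulrA.
Qed.

Lemma tensorMr q z : tensor_image z -> tensor_image (fun w => z w * act w q).
Proof.
move=> [t [s [tI t0 zE]]]; exists t, [seq (u.1, u.2 * q) | u : B * B <- s]; split=> // w wW.
rewrite big_map mulrA zE // mulr_suml.
by apply: eq_bigr => u _ /=; rewrite rmorphM mulrA.
Qed.

Lemma tensor0 : tensor_image (fun=> 0).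
Proof. by apply: tensor_ext (tensorMl 0 tensor1) => w _; rewrite mul0r. Qed.

Lemma tensor_sum (I : Type) (r : seq I) (P : pred I) F :
  (forall i, P i -> tensor_image (F i)) -> tensor_image (fun w => \sum_(i <- r | P i) F i w).
Proof.
move=> hF; elim: r => [|i r IH].
  by apply: tensor_ext tensor0 => w _; rewrite big_nil.
case: (boolP (P i)) => Pi.
  by apply: tensor_ext (tensorD (hF i Pi) IH) => w _; rewrite big_cons Pi.
by apply: tensor_ext IH => w _; rewrite big_cons (negPf Pi).
Qed.

Lemma tensor_prod z (I : Type) (r : seq I) (P : pred I) (F G : I -> {mpoly k[n]}) :
  tensor_image z -> tensor_image (fun w => z w * \prod_(i <- r | P i) (F i - act w (G i))).
Proof.
move=> hz; elim: r => [|i r IH].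
  by apply: tensor_ext hz => w _; rewrite big_nil mulr1.
case: (boolP (P i)) => Pi; last first.
  by apply: tensor_ext IH => w _; rewrite big_cons (negPf Pi).
apply: tensor_ext (tensorD (tensorMl (F i) IH) (tensorMl (-1) (tensorMr (G i) IH))) => w _.
by rewrite big_cons Pi; ring.
Qed.

Lemma tensor_coords N (b : 'I_N -> {mpoly k[n]}) z :
    (forall p, locgen rho b p) -> tensor_image z ->
  exists t c, [/\ t \in inv, ev0 t != 0
    & {in Wt, forall w, t * z w = \sum_i c i * act w (b i)}].
Proof.
move=> gb [t [s [tI t0 zE]]].
suff [t' [c [tI' t0' cE]]] : exists t' c, [/\ t' \in inv, ev0 t' != 0
    & {in Wt, forall w, t' * (\sum_(u <- s) u.1 * act w u.2) = \sum_i c i * act w (b i)}].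
  exists (t' * t), c; split=> [||w wW]; first by rewrite rpredM.
    by rewrite mevalM mulf_neq0.
  by rewrite -mulrA zE // cE.
elim: s {zE} => [|u s [t1 [c [tI1 t10 cE]]]].
  exists 1, (fun=> 0); split=> [||w _]; rewrite ?rpred1 ?meval1 ?oner_eq0 //.
  by rewrite big_nil mulr0 big1 // => i _; rewrite mul0r.
have [t2 [c2 [tI2 t20 cI2 cE2]]] := gb u.2.
exists (t1 * t2), (fun i => t1 * u.1 * c2 i + t2 * c i); split=> [||w wW].
- by rewrite rpredM.
- by rewrite mevalM mulf_neq0.
have := congr1 (act w) cE2; rewrite rmorphM rmorph_sum /= (invariantP _ _ _ tI2) //.
move=> cw; rewrite big_cons mulrDr.
have -> : t1 * t2 * (u.1 * act w u.2) = t1 * u.1 * (t2 * act w u.2) by ring.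
rewrite cw [t1 * t2]mulrC -[t2 * t1 * _]mulrA cE // !mulr_sumr -big_split /=.
by apply: eq_bigr => i _; rewrite rmorphM /= (invariantP _ _ _ (cI2 i)) //; ring.
Qed.

(** Multiplying by [e] and summing over the group turns the hypothesis into a relation among the
    [b i] with coefficients the traces of [e * c i]. These vanish for every [e], and the trace form
    is nondegenerate. *)
Lemma tensor_coords_uniq N (b c : 'I_N -> {mpoly k[n]}) :
    hilbert_free rho b -> {in Wt, forall w, \sum_i c i * act w (b i) = 0} ->
  forall i, c i = 0.
Proof.
move=> fb c0.
have tr0 e i : trace rho Wt (e * c i) = 0.
  move: i; apply: (hilbert_free_indep hk genW _ fb) => [i|]; first exact: trace_invariant.
  transitivity (\sum_(w in Wt) act w (e * \sum_i c i * act w^-1%g (b i))).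
    rewrite /trace; under eq_bigr => i _ do rewrite mulr_suml.
    rewrite exchange_big /=; apply: eq_bigr => w wW.
    rewrite rmorphM rmorph_sum mulr_sumr; apply: eq_bigr => i _ /=.
    by rewrite !rmorphM /= mx_subst_rKV // mulrA.
  by apply: big1 => w wW; rewrite c0 ?groupV // mulr0 raddf0.
(* This [e] makes [e * c i] the norm of [c i], an invariant, whose trace is [#|Wt|] times itself. *)
move=> i; have := tr0 (\prod_(w in Wt | w != 1%g) act w (c i)) i.
have -> : \prod_(w in Wt | w != 1%g) act w (c i) * c i = \prod_(w in Wt) act w (c i).
  by rewrite [RHS](bigD1 1%g) //= mx_subst_r1 mulrC.
rewrite trace_id; last first.
  apply/invariantP => h hW; rewrite rmorph_prod [RHS](reindex_inj (mulgI h)) /=.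
  apply: eq_big => g; first by rewrite groupMl.
  by move=> gW; rewrite mx_subst_rM.
move/eqP; rewrite -scaler_nat mscalerI (negPf (pnatr_neq0 hk (cardG_gt0 _))) /=.
move=> /prodf_eq0 [w wW /eqP cw].
by rewrite -(mx_subst_rK rho (c i) wW) cw raddf0.
Qed.

(** Compare the unique coordinates of [lin a * p * z] computed in two ways: the prime [lin a] must
    divide those of [lin a * z], up to a denominator, and dividing gives coordinates for [z]. *)
Lemma tensor_lin_coprime a p z : a != 0 -> ~ mdvd (lin a) p ->
    tensor_image (fun w => lin a * z w) -> tensor_image (fun w => p * z w) ->
  tensor_image z.
Proof.
move=> a0 ap; have [N [b [fb gb]]] := local_basis rho.
move=> /(tensor_coords gb) [t [c [tI t0 cE]]] /(tensor_coords gb) [t' [c' [tI' t0' cE']]].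
have la0 : lin a != 0 by rewrite lin_eq0.
have e i : p * (t' * c i) - lin a * (t * c' i) = 0.
  apply: (tensor_coords_uniq (b := b) (c := fun i => p * (t' * c i) - lin a * (t * c' i)) fb _) => w wW.
  under eq_bigr => j _ do rewrite mulrBl -!mulrA.
  by rewrite sumrB -!mulr_sumr -cE // -cE' //; ring.
have /fin_all_exists [h hE] i : exists h, t' * c i = lin a * h.
  have /(lin_prime a0)[//|//] : mdvd (lin a) (p * (t' * c i)).
  by exists (t * c' i); apply/eqP; rewrite -subr_eq0 e.
exists (t' * t), [seq (h i, b i) | i <- enum 'I_N]; split=> [||w wW].
- by rewrite rpredM.
- by rewrite mevalM mulf_neq0.
apply: (mulfI la0); rewrite mulrCA -mulrA cE //.
rewrite big_map big_enum /= !mulr_sumr; apply: eq_bigr => i _.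
by rewrite mulrA hE mulrA.
Qed.

(** Reduction to codimension one: the linear factors are removed one at a time, and the middle
    hypothesis is membership at the generic point of each hyperplane. *)
Lemma tensor_lin_prod (r : seq 'cV[k]_n) z : {in r, forall a, a != 0} ->
    (forall a, a != 0 -> exists2 q, ~ mdvd (lin a) q & tensor_image (fun w => q * z w)) ->
  tensor_image (fun w => (\prod_(a <- r) lin a) * z w) -> tensor_image z.
Proof.
move=> + hz; elim: r => [_|a r IH hr].
  by apply: tensor_ext => w _; rewrite big_nil mul1r.
have a0 : a != 0 by apply: hr; rewrite mem_head.
rewrite (_ : (fun w => _) = (fun w => lin a * ((\prod_(a <- r) lin a) * z w))); last first.
  by apply/funext => w; rewrite big_cons mulrA.
move=> h; apply: IH => [b br|]; first by apply: hr; rewrite inE br orbT.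
have [q aq hq] := hz a a0; apply: tensor_lin_coprime a0 aq h _.
by apply: tensor_ext (tensorMl (\prod_(a <- r) lin a) hq) => w _; rewrite mulrCA.
Qed.

End TensorImage.

Section Steinberg.
Variables (k : fieldType) (n : nat) (gT : finGroupType) (Wt : {group gT}).
Variable rho : mx_representation k Wt n.
Hypothesis hk : [pchar k] =i pred0.
Hypothesis faithW : {in Wt, forall g, rho g = 1%:M -> g = 1%g}.
Implicit Types (p q u t : {mpoly k[n]}) (z : gT -> {mpoly k[n]}).

Local Notation act g := (mx_subst (rho g)).
Local Notation tensor := (tensor_image rho).

Lemma rstabP (x : 'rV[k]_n) g :
  reflect (g \in Wt /\ x *m rho g = x) (g \in rstab rho x).
Proof. by rewrite inE; apply: (iffP andP) => -[gW /eqP]. Qed.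

(* Locally at [y], the indicator functions of the cosets of the stabiliser of *)
(* [y] belong to the image of the tensor product.                             *)
Lemma tensor_coset (y : 'rV[k]_n) v : v \in Wt ->
  exists2 q, q.@[y 0] != 0
    & tensor (fun w => if (w * v^-1)%g \in rstab rho y then q else 0).
Proof.
move=> vW; set C := rstab_group rho y.
have sCW : C \subset Wt by apply: rstab_sub.
have sCvW : (C :^ v)%G \subset Wt by rewrite /= -(conjGid vW) conjSg.
(* For each [w] outside the coset of [v], an invariant of the stabiliser of [y *m rho v] that
   separates this point from [y *m rho w]. *)
have /fin_all_exists [p pP] (w : gT) : exists p, w \in Wt -> (w * v^-1)%g \notin C ->
    p \in invariant rho (C :^ v)%G /\ p.@[(y *m rho w) 0] != p.@[(y *m rho v) 0].
  case: (boolP (w \in Wt)) => wW; last by exists 0.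
  case: (boolP ((w * v^-1)%g \in C)) => [|wC]; first by exists 0.
  have [|||p [pI p1 p0]] := @sep_invariant _ _ _ _ rho hk (C :^ v)%G (y *m rho v) [:: y *m rho w].
  - exact: sCvW.
  - move=> h /imsetP [c /rstabP [cW yc] ->].
    by rewrite -mulmxA -repr_mxM ?groupJ // conjgE mulgA mulgV mul1g repr_mxM // mulmxA yc.
  - rewrite inE; apply: contra wC => /eqP yv; apply/rstabP; rewrite groupM ?groupV //.
    by rewrite repr_mxM ?groupV // mulmxA -yv repr_mxK.
  by exists p => _ _; split=> //; rewrite p1 p0 ?mem_head // eq_sym oner_eq0.
pose D := [pred w | (w \in Wt) && ((w * v^-1)%g \notin C)].
pose F w := act w (p w).
(* In the tensor built from these factors, the one indexed by [w] kills the component at [w] off the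
   coset, and on the coset all components equal this product, since each [p w] is invariant under
   [C :^ v]. *)
exists (\prod_(w in gT | D w) (F w - act v (p w))).
  rewrite rmorph_prod /=; apply/prodf_neq0 => w /andP[wW wC].
  have [_] := pP w wW wC; rewrite mevalB subr_eq0 /F !mx_subst_eval.
  done.
apply: tensor_ext (tensor_prod (index_enum gT) [pred w | D w] F p (tensor1 rho)) => w wW /=.
rewrite mul1r; case: ifPn => wC.
  apply: eq_bigr => w' /andP[w'W w'C]; congr (_ - _).
  have [/invariantP pI _] := pP w' w'W w'C.
  have {1}-> : w = (v * (w * v^-1) ^ v)%g by rewrite conjgE !mulgA mulgV mul1g mulgKV.
  by rewrite mx_subst_rM ?groupJ ?groupM ?groupV // pI // memJ_conjg.
by rewrite (bigD1 w) /= ?wW //= /F subrr mul0r.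
Qed.

(** Sum the indicators of the cosets [C :* v] over all [v] in [P], after taking the product of the
    [q v] as common factor; each element of [P] is counted [#|C|] times. *)
Lemma tensor_union (C P : {group gT}) (y : 'rV[k]_n) (c : {mpoly k[n]}) :
    C \subset P -> P \subset Wt ->
    {in P, forall v, exists2 q, q.@[y 0] != 0
      & tensor (fun w => if (w * v^-1)%g \in C then q * c else 0)} ->
  exists2 q, q.@[y 0] != 0 & tensor (fun w => q * (if w \in P then c else 0)).
Proof.
move=> sCP sPW hq.
have /fin_all_exists [q qP] (v : gT) : exists q, v \in P -> q.@[y 0] != 0 /\
    tensor (fun w => if (w * v^-1)%g \in C then q * c else 0).
  case: (boolP (v \in P)) => [/hq [q q0 qt]|_]; last by exists 0.
  by exists q => _.
pose Q := \prod_(v in P) q v.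
exists Q; first by rewrite rmorph_prod; apply/prodf_neq0 => v /qP [].
have c0 : #|C|%:R != 0 :> k by rewrite pnatr_neq0 // cardG_gt0.
have h v : v \in P -> tensor (fun w => if (w * v^-1)%g \in C then Q * c else 0).
  move=> vP; have [_ qt] := qP v vP.
  apply: tensor_ext (tensorMl (\prod_(v' in P | v' != v) q v') qt) => w _.
  by case: ifP => _; rewrite ?mulr0 // mulrA /Q [in RHS](bigD1 v) //= [q v * _]mulrC.
apply: tensor_ext (tensorMl (#|C|%:R^-1)%:MP (tensor_sum (index_enum gT) h)) => w wW /=.
rewrite -big_mkcondr /= sumr_const; case: ifP => wP; last first.
  rewrite mulr0 (_ : #|_| = 0%N) ?mulr0n ?mulr0 //; apply: eq_card0 => v.
  rewrite !inE; apply/negP => /andP[vP wv]; move: wP.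
  by rewrite -(mulgKV v w) groupM // (subsetP sCP).
have e v : ((v \in P) && ((w * v^-1)%g \in C)) = (v \in (C :* w)%g).
  rewrite mem_rcoset -[(v * _)%g]invgK groupV invMg invgK.
  case: (boolP ((w * v^-1)%g \in C)) => wv; rewrite ?andbT ?andbF //.
  by rewrite -[v \in _]groupV -(groupMl _ wP) (subsetP sCP).
rewrite (_ : #|(fun i : gT => (i \in P) && ((w * i^-1)%g \in C))| = #|C|); last first.
  by rewrite -(card_rcoset C w); apply: eq_card => v; rewrite -e.
by rewrite mul_mpolyC -scaler_nat scalerA mulVf // scale1r.
Qed.

(** By faithfulness some coordinate function distinguishes [w] from [v]; the differences are linear
    forms, and the one for [w] kills the component at [w]. *)
Lemma tensor_delta v : v \in Wt -> exists2 r : seq 'cV[k]_n, {in r, forall a, a != 0}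
  & tensor (fun w => (\prod_(a <- r) lin a) * (if w == v then 1 else 0)).
Proof.
move=> vW.
have sep w : w \in Wt -> w != v -> exists i, col i (rho w - rho v) != 0.
  move=> wW wv; apply/existsP; apply: contraNT wv => /existsPn h.
  have e : rho w = rho v.
    apply/eqP; rewrite -subr_eq0; apply/eqP/matrixP => a b.
    have /eqP/matrixP/(_ a 0) := negPn (h b).
    by rewrite !mxE.
  rewrite eq_mulgV1; apply/eqP/faithW; first by rewrite groupM ?groupV.
  by rewrite repr_mxM ?groupV // e -repr_mxM ?groupV // mulgV repr_mx1.
have [j jP] : exists j : gT -> {mpoly k[n]}, forall w, w \in Wt -> w != v ->
    exists2 a, a != 0 & act w (j w) - act v (j w) = lin a.
  apply: (@fin_all_exists gT (fun=> {mpoly k[n]}) (fun w q => w \in Wt -> w != v ->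
    exists2 a, a != 0 & act w q - act v q = lin a)) => w.
  case: (boolP (w \in Wt)) => wW; last by exists 0.
  case: (boolP (w == v)) => wv; first by exists 0.
  have [i hi] := sep w wW wv; exists 'X_i => _ _; exists (col i (rho w - rho v)) => //.
  by rewrite !mx_substX -sumrB; apply: eq_bigr => l _; rewrite !mxE scalerBl.
have [a aP] : exists a : gT -> 'cV[k]_n, forall w, w \in Wt -> w != v ->
    a w != 0 /\ act w (j w) - act v (j w) = lin (a w).
  apply: (@fin_all_exists gT (fun=> 'cV[k]_n) (fun w b => w \in Wt -> w != v ->
    b != 0 /\ act w (j w) - act v (j w) = lin b)) => w.
  case: (boolP (w \in Wt)) => wW; last by exists 0.
  case: (boolP (w == v)) => wv; first by exists 0.
  by have [b b0 bE] := jP w wW wv; exists b.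
exists [seq a w | w <- enum [pred w | (w \in Wt) && (w != v)]].
  by move=> b /mapP [w]; rewrite mem_enum => /andP[wW wv] ->; case: (aP w wW wv).
apply: tensor_ext (tensor_prod (index_enum gT) [pred w | (w \in Wt) && (w != v)]
  (fun w => act w (j w)) j (tensor1 rho)) => w wW /=.
rewrite mul1r big_map big_enum_cond /=; case: eqVneq => [->|wv]; last first.
  by rewrite mulr0 (bigD1 w) /= ?wW //= subrr mul0r.
rewrite mulr1; apply: eq_big => [w'|w' /andP[wW' wv']]; first by rewrite !inE andbT.
by have [] := aP w' wW' wv'.
Qed.

Lemma tensor_subset (P : {set gT}) : P \subset Wt ->
  exists2 r : seq 'cV[k]_n, {in r, forall a, a != 0}
  & tensor (fun w => (\prod_(a <- r) lin a) * (if w \in P then 1 else 0)).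
Proof.
move=> sPW.
suff: exists2 r : seq 'cV[k]_n, {in r, forall a, a != 0}
  & tensor (fun w => (\prod_(a <- r) lin a) * (if w \in enum P then 1 else 0)).
  by case=> r r0 rt; exists r => //; apply: tensor_ext rt => w _; rewrite mem_enum.
have: uniq (enum P) by apply: enum_uniq.
have: {subset enum P <= Wt} by move=> w; rewrite mem_enum => /(subsetP sPW).
elim: (enum P) => [|v s IH] sW /=.
  by exists [::] => //; apply: tensor_ext (tensor0 rho) => w _; rewrite mulr0.
case/andP => vs us.
have [|r r0 rt] := IH _ us; first by move=> w ws; apply: sW; rewrite inE ws orbT.
have [|r' r0' rt'] := @tensor_delta v; first by apply: sW; rewrite mem_head.
exists (r ++ r'); first by move=> a; rewrite mem_cat => /orP[/r0|/r0'].
apply: tensor_ext (tensorD (tensorMl (\prod_(a <- r') lin a) rt)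
  (tensorMl (\prod_(a <- r) lin a) rt')) => w _.
rewrite big_cat inE /=; case: (eqVneq w v) => [->|_] /=.
  by rewrite (negPf vs) !(mulr0, mulr1, add0r).
by rewrite !mulr0 addr0 mulrCA mulrA.
Qed.

End Steinberg.

Section GenericPoint.
Variables (k : fieldType) (n : nat).
Hypothesis hk : [pchar k] =i pred0.

Lemma generic_row (s : seq 'M[k]_n) :
  exists y : 'rV[k]_n, {in s, forall M, M != 0 -> y *m M != 0}.
Proof.
suff [p p0 pP] : exists2 p : {mpoly k[n]}, p != 0 & forall y : 'rV[k]_n,
    p.@[y 0] != 0 -> {in s, forall M, M != 0 -> y *m M != 0}.
  by have [y /pP] := mpoly_nonroot hk p0; exists y.
elim: s => [|M s [p p0 pP]]; first by exists 1; rewrite ?oner_eq0.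
have [M0|M0] := eqVneq M 0.
  exists p => // y /pP h M'; rewrite inE => /orP[/eqP->|]; first by rewrite M0 eqxx.
  exact: h.
have [i Mi] : exists i, col i M != 0.
  apply/existsP; apply: contraNT M0 => /existsPn h; apply/eqP/matrixP=> a b.
  by have /eqP/matrixP/(_ a 0) := negPn (h b); rewrite !mxE.
exists (lin (col i M) * p); first by rewrite mulf_neq0 ?lin_eq0.
move=> y; rewrite mevalM mulf_eq0 negb_or => /andP[yM /pP h] M'.
rewrite inE => /orP[/eqP-> _|]; last exact: h.
apply: contraNneq yM => yM0.
by rewrite linE colE mulmxA yM0 mul0mx mxE.
Qed.

End GenericPoint.

Section SteinbergTheorem.
Variables (k : fieldType) (n : nat) (gT : finGroupType) (Wt : {group gT}).
Variable rho : mx_representation k Wt n.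
Hypothesis hk : [pchar k] =i pred0.
Hypothesis faithW : {in Wt, forall g, rho g = 1%:M -> g = 1%g}.

(** Project a generic row to the hyperplane: an element that fixes the projection fixes the whole
    hyperplane, since its restriction minus 1 is one of the finitely many matrices avoided. *)
Lemma generic_hyperplane_point (a : 'cV[k]_n) : a != 0 ->
  exists2 y : 'rV[k]_n, y *m a = 0 & {in rstab rho y, forall g,
    g != 1%g -> exists2 w : 'rV[k]_n, w != 0 & rho g = 1%:M + a *m w}.
Proof.
move=> a0; have [w0 aw0] := lin_projector a0; set A := 1%:M + a *m w0 in aw0.
have [y yP] := generic_row hk [seq A *m (rho g - 1%:M) | g <- enum Wt].
exists (y *m A); first by rewrite -mulmxA aw0 mulmx0.
move=> g /rstabP [gW yg] g1.
have AP : A *m (rho g - 1%:M) = 0.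
  apply/eqP/negPn/negP => h; have := yP (A *m (rho g - 1%:M)).
  rewrite (map_f (fun g => A *m (rho g - 1%:M))) ?mem_enum // => /(_ isT h)/eqP; apply.
  by rewrite mulmxA mulmxBr mulmx1 yg subrr.
have gE : rho g - 1%:M = a *m (- (w0 *m (rho g - 1%:M))).
  by apply/eqP; rewrite mulmxN -subr_eq0 opprK mulmxA -{1}[rho g - _]mul1mx -mulmxDl AP.
exists (- (w0 *m (rho g - 1%:M))); last by rewrite -gE addrC subrK.
apply: contraNneq g1 => w00; apply/eqP/faithW => //.
by apply/eqP; rewrite -subr_eq0 gE w00 mulmx0.
Qed.

Lemma generic_free_point : exists y : 'rV[k]_n, {in rstab rho y, forall g, g = 1%g}.
Proof.
have [y yP] := generic_row hk [seq rho g - 1%:M | g <- enum Wt].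
exists y => g /rstabP [gW yg]; apply: faithW => //; apply/eqP; rewrite -subr_eq0.
apply/negPn/negP => h; have := yP (rho g - 1%:M).
rewrite (map_f (fun g => rho g - 1%:M)) ?mem_enum // => /(_ isT h)/eqP; apply.
by rewrite mulmxBr mulmx1 yg subrr.
Qed.

Local Notation act g := (mx_subst (rho g)).
Local Notation tensor := (tensor_image rho).

Theorem steinberg (x : 'rV[k]_n) :
    <<[set g in Wt | `[< mxreflection rho g >]]>>%g = Wt ->
  <<[set g in rstab rho x | `[< mxreflection rho g >]]>>%g = rstab rho x.
Proof.
move=> genW; set T := [set g in rstab rho x | _].
set P := <<T>>%G; rewrite -[<<T>>%g]/(P : {set gT}).
have sPx : P \subset rstab rho x.
  by rewrite gen_subG; apply/subsetP => g; rewrite inE => /andP[].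
have sPW : P \subset Wt := subset_trans sPx (rstab_sub _ _).
have [a aP] : exists a : gT -> 'cV[k]_n, forall g, mxreflection rho g ->
    exists w : 'rV[k]_n, [/\ a g != 0, w != 0 & rho g = 1%:M + a g *m w].
  apply: (@fin_all_exists gT (fun=> 'cV[k]_n) (fun g b => mxreflection rho g ->
    exists w : 'rV[k]_n, [/\ b != 0, w != 0 & rho g = 1%:M + b *m w])) => g.
  by case: (EM (mxreflection rho g)) => [[b [w h]]|h]; [exists b => _; exists w | exists 0].
pose D := [pred g | [&& g \in Wt, `[< mxreflection rho g >] & g \notin rstab rho x]].
pose c := \prod_(g | D g) lin (a g).
pose z w := if w \in P then c else 0.
have zt : tensor z.
  have [r r0 rt] := tensor_subset faithW sPW.
  (* [tensor_subset] gives the indicator of [P] up to linear factors, so it remains to find, for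
     each hyperplane of [b], a multiplier not divisible by [lin b]. *)
  apply: (tensor_lin_prod hk genW r0) => [b b0|]; last first.
    apply: tensor_ext (tensorMl c rt) => w _; rewrite /z.
    by case: ifP => _; rewrite !(mulr0, mulr1) // mulrC.
  have [y yb yP] := generic_hyperplane_point b0.
  suff [q qy qt] : exists2 q, q.@[y 0] != 0 & tensor (fun w => q * z w).
    exists q => // -[q' qE]; move: qy.
    by rewrite qE mevalM linE yb mxE mul0r eqxx.
  set C := rstab_group rho y.
  (* Either [P] is a union of cosets of [C], whose indicators are available at [y], or single
     elements of the cosets have to be isolated by means of [c]. *)
  case: (boolP (C \subset P)) => [sCP|/subsetPn [g gC gP]].
    apply: (tensor_union hk (C := C)) => // v vP.
    have [q q0 qt] := tensor_coset rho hk y (subsetP sPW v vP).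
    exists q => //; apply: tensor_ext (tensorMl c qt) => w _.
    by case: ifP => _; rewrite ?mulr0 // mulrC.
  apply: (tensor_union hk (C := 1%G)) => //; first exact: sub1G.
  move=> v vP; have vW := subsetP sPW v vP.
  have [q q0 qt] := tensor_coset rho hk y vW; exists q => //.
  have g1 : g != 1%g by apply: contraNneq gP => ->; rewrite group1.
  (* The reflection [g] is outside [P], so it moves [x], and [x] is off the hyperplane. Hence all
     nontrivial elements of [C] are reflections moving [x], and their forms occur in [c]. *)
  have xb : x *m b != 0.
    have [w w0 gE] := yP g gC g1; apply: contraNneq gP => xb0.
    apply: mem_gen; rewrite inE; apply/andP; split.
      by apply/rstabP; split; [case/rstabP: gC | rewrite gE mulmxDr mulmx1 mulmxA xb0 mul0mx addr0].
    by apply/asboolP; exists b, w.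
  have CD h : h \in C -> h != 1%g -> D h.
    move=> hC h1; have [w w0 hE] := yP h hC h1; have /rstabP [hW _] := hC.
    rewrite /D /= hW /=; apply/andP; split; first by apply/asboolP; exists b, w.
    apply/negP => /rstabP [_ /eqP]; rewrite hE mulmxDr mulmx1 mulmxA -subr_eq0 addrAC subrr add0r.
    have [s sE] : exists s, x *m b = s%:M.
      by exists ((x *m b) 0 0); apply/matrixP => i j; rewrite !ord1 [RHS]mxE.
    rewrite sE mul_scalar_mx scaler_eq0 (negPf w0) orbF => /eqP s0.
    by move: xb; rewrite sE s0 raddf0 eqxx.
  (* The form of [h] is, up to a scalar, the difference of the images of [j] under [h * v] and [v].
     The corresponding tensor factors kill the components at the [h * v], and at [v] their product
     is a multiple of the forms of [C] in [c]. *)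
  have /fin_all_exists [j jP] (h : gT) : exists j : {mpoly k[n]}, h \in C -> h != 1%g ->
      exists2 s : k, s != 0 & act (h * v)%g j - act v j = s *: lin (a h).
    case: (boolP (h \in C)) => hC; last by exists 0.
    case: (boolP (h == 1%g)) => h1; first by exists 0.
    have /and3P [hW /asboolP /aP [w [ah w0 hE]] _] := CD h hC h1.
    have [i wi] : exists i, w 0 i != 0.
      apply/existsP; apply: contraNT w0 => /existsPn h'; apply/eqP/matrixP=> i l.
      by rewrite ord1 mxE; apply/eqP/negPn/h'.
    exists (act v^-1%g 'X_i) => _ _; exists (w 0 i) => //.
    by rewrite mx_subst_rM // !mx_subst_rKV // hE mx_substX_sub.
  have /fin_all_exists [s sP] (h : gT) : exists s : k, h \in C -> h != 1%g ->
      s != 0 /\ act (h * v)%g (j h) - act v (j h) = s *: lin (a h).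
    case: (boolP (h \in C)) => hC; last by exists 0.
    case: (boolP (h == 1%g)) => h1; first by exists 0.
    by have [s s0 sE] := jP h hC h1; exists s => _ _.
  pose D' := [pred h | (h \in C) && (h != 1%g)].
  pose S := \prod_(h | D' h) s h.
  have S0 : S != 0 by apply/prodf_neq0 => h /andP[hC h1]; case: (sP h hC h1).
  pose R := \prod_(h | D h && ~~ D' h) lin (a h).
  have cE : c = R * \prod_(h | D' h) lin (a h).
    rewrite /c (bigID D') /= mulrC; congr (_ * _); apply: eq_bigl => h.
    by apply: andb_idl => /andP [hC h1]; apply: CD.
  have ht := tensor_prod (index_enum gT) D' (fun h => act (h * v)%g (j h)) j qt.
  apply: tensor_ext (tensorMl (S^-1 *: R) ht) => w wW.
  have -> : ((w * v^-1)%g \in 1%G) = (w == v) by rewrite inE -eq_mulgV1.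
  case: (eqVneq w v) => [->|wv].
    rewrite mulgV (group1 C) /= mulrCA; congr (q * _).
    rewrite (eq_bigr (fun h => s h *: lin (a h))) => [|h /andP[hC h1]]; last by case: (sP h hC h1).
    rewrite scaler_prod -scalerAr -scalerAl scalerA mulfV // scale1r.
    by rewrite -cE.
  case: ifPn => wC; last by rewrite mul0r mulr0.
  rewrite (bigD1 (w * v^-1)%g) /=; last by rewrite wC -eq_mulgV1.
  by rewrite mulgKV subrr mul0r !mulr0.
have [t [s [tI t0 zE]]] := zt.
apply/eqP; rewrite eqEsubset sPx /=; apply/subsetP => g gx.
have /rstabP [gW xg] := gx.
have cx : c.@[x 0] != 0.
  rewrite rmorph_prod; apply/prodf_neq0 => h /and3P[hW /asboolP hr hx].
  have [w [ah w0 hE]] := aP h hr; rewrite /= linE; apply: contra hx => /eqP xa.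
  apply/rstabP; split => //; rewrite hE mulmxDr mulmx1 mulmxA.
  rewrite (_ : x *m a h = 0) ?mul0mx ?addr0 //.
  by apply/matrixP => i j; rewrite !ord1 xa mxE.
(* The coefficient [t] need not be invertible at [x], but it is at some       *)
(* multiple of [x], which has the same stabiliser.                            *)
have [l lt] : exists l : k, (t * c).@[(l *: x) 0] != 0.
  pose L := mmap (@polyC k) (fun i => (x 0 i)%:P * 'X).
  have LE p l : (L p).[l] = p.@[(l *: x) 0].
    elim/mpoly_ring_ind: p => [b|i|p p' e e'|p p' e e'].
    - by rewrite /L mmapC hornerC mevalC.
    - by rewrite /L mmapX mmap1U mevalXU hornerM hornerC hornerX mxE mulrC.
    - by rewrite [L _]raddfD hornerD e e' mevalD.
    - by rewrite [L _]rmorphM hornerM e e' mevalM.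
  have Lt : L t != 0.
    by apply: contraNneq t0 => L0; rewrite -(scale0r x) -LE L0 horner0.
  have Lc : L c != 0.
    by apply: contraNneq cx => L0; rewrite -[x]scale1r -LE L0 horner0.
  have [l] := poly_nonroot hk (mulf_neq0 Lt Lc).
  by rewrite hornerM !LE -mevalM; exists l.
have e h : h \in rstab rho x ->
    (t * z h).@[(l *: x) 0] = \sum_(u <- s) u.1.@[(l *: x) 0] * u.2.@[(l *: x) 0].
  move=> /rstabP [hW xh]; rewrite zE // raddf_sum; apply: eq_bigr => u _ /=.
  by rewrite mevalM mx_subst_eval -scalemxAl xh.
(* A tensor takes equal values at [g] and at 1 on points fixed by [g]; the value at 1 is nonzero
   here, so [z g] is nonzero and [g] is in [P]. *)
have := e _ gx; rewrite -(e 1%g) ?group1 // /z group1.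
case: ifP => // _ /esym/eqP; rewrite mulr0 meval0 (negPf lt) //.
Qed.

End SteinbergTheorem.

(** * The morphism from V~/G_x to V~/G near x *)

Section IdealPowers.
Variables (k : fieldType) (n : nat).
Implicit Types (S J : {mpoly k[n]} -> Prop) (p q : {mpoly k[n]}).

(** The power J^N inside a ring [S], which is either a polynomial ring or a ring of invariants, so
    that powers of maximal ideals can be carried between the two. *)
Fixpoint ipow S J N : {mpoly k[n]} -> Prop :=
  if N is N'.+1 then ideal_mul J (ipow S J N') else S.

Definition is_subring S : Prop :=
  [/\ S 0, S 1, forall p q, S p -> S q -> S (p + q)
    & forall p q, S p -> S q -> S (p * q)].

Lemma ipow0 S J N : is_subring S -> ipow S J N 0.
Proof. by case: N => [[]//|N] _; apply: ideal_mul0. Qed.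

Lemma ipowD S J N p q : is_subring S -> ipow S J N p -> ipow S J N q -> ipow S J N (p + q).
Proof. by case: N => [[_ _ SD _]|N _]; [apply: SD | apply: ideal_mulD]. Qed.

Lemma ipowMl S J N a p : is_subring S -> S a -> ipow S J N p -> ipow S J N (a * p).
Proof.
move=> rS Sa; elim: N p => [|N IH] p /=; first by case: rS => _ _ _; apply.
by apply: ideal_mulMr => q; apply: IH.
Qed.

Lemma ipow_sum S J N (I : Type) (r : seq I) (P : pred I) F : is_subring S ->
  (forall i, P i -> ipow S J N (F i)) -> ipow S J N (\sum_(i <- r | P i) F i).
Proof.
by move=> rS hF; elim/big_ind: _ => //; [exact: ipow0 | move=> p q; exact: ipowD].
Qed.

Lemma ipowS S J N p : is_subring S -> (forall q, J q -> S q) ->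
  ipow S J N.+1 p -> ipow S J N p.
Proof.
move=> rS JS; elim: N p => [|N IH] p.
  have [S0 S1 SD SM] := rS.
  elim/ideal_mul_ind: p / => [|p q|p q /JS Sp Sq] //=; [exact: SD | exact: SM].
elim/ideal_mul_ind: p / => [|p q hp hq|p q Jp /IH hq].
- exact: ipow0.
- exact: ipowD.
- exact: ideal_mul1.
Qed.

Lemma ipow_le S J M N p : is_subring S -> (forall q, J q -> S q) -> (M <= N)%N ->
  ipow S J N p -> ipow S J M p.
Proof.
move=> rS JS; elim: N => [|N IH]; first by rewrite leqn0 => /eqP ->.
rewrite leq_eqVlt => /orP[/eqP -> //|lt] /(ipowS rS JS); exact: IH.
Qed.

Lemma ipow1 S J p : S 1 -> J p -> ipow S J 1 p.
Proof. by move=> S1 Jp; rewrite -[p]mulr1; apply: ideal_mul1. Qed.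

Lemma ipow2 S J p q : S 1 -> J p -> J q -> ipow S J 2 (p * q).
Proof. by move=> S1 Jp Jq; apply: ideal_mul1 => //; apply: ipow1. Qed.

End IdealPowers.

Lemma ipow_map (k : fieldType) m n (f : 'I_m -> {mpoly k[n]})
    (S J : {mpoly k[m]} -> Prop) (S' J' : {mpoly k[n]} -> Prop) N P :
    is_subring S' -> (forall P, S P -> S' (msub f P)) -> (forall P, J P -> J' (msub f P)) ->
  ipow S J N P -> ipow S' J' N (msub f P).
Proof.
move=> rS' SS JJ; elim: N P => [|N IH] P; first exact: SS.
elim/ideal_mul_ind: P / => [|P Q hP hQ|P Q JP hQ].
- by rewrite raddf0; apply: ipow0.
- by rewrite raddfD; apply: ipowD.
- by rewrite rmorphM; apply: ideal_mul1; [apply: JJ | apply: IH].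
Qed.

Lemma ipow_lift (k : fieldType) m n (f : 'I_m -> {mpoly k[n]})
    (S J : {mpoly k[m]} -> Prop) (S' J' : {mpoly k[n]} -> Prop) N p :
    is_subring S ->
    (forall p, S' p -> exists2 P, S P & msub f P = p) ->
    (forall p, J' p -> exists2 P, J P & msub f P = p) ->
  ipow S' J' N p -> exists2 P, ipow S J N P & msub f P = p.
Proof.
move=> rS SS JJ; elim: N p => [|N IH] p; first exact: SS.
elim/ideal_mul_ind: p / => [|p q [P hP <-] [Q hQ <-]|p q /JJ [P hP <-] /IH [Q hQ <-]].
- by exists 0; [apply: ipow0 | rewrite raddf0].
- by exists (P + Q); [apply: ipowD | rewrite raddfD].
- by exists (P * Q); [apply: ideal_mul1 | rewrite rmorphM].
Qed.

(** * Expansions to first order *)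

Section Taylor.
Variables (k : fieldType) (n : nat) (v : 'rV[k]_n).
Implicit Types (p q : {mpoly k[n]}) (c : 'cV[k]_n).

Definition vanish p : Prop := p.@[v 0] = 0.
Definition mxdiff p : 'cV[k]_n := \col_i (p^`M(i)).@[v 0].
(** A section of [mxdiff] with values in the maximal ideal of [v]: columns are thus identified with
    the cotangent space at [v]. *)
Definition clin c : {mpoly k[n]} := \sum_i c i 0 *: ('X_i - (v 0 i)%:MP).
Local Notation mpow := (ipow (fun=> True) vanish).

Lemma true_subring : @is_subring k n (fun=> True).
Proof. by []. Qed.

Lemma vanish_ideal : is_ideal vanish.
Proof.
rewrite /vanish; split=> [|p q p0 q0|p q q0]; first exact: meval0.
  by rewrite mevalD p0 q0 addr0.
by rewrite mevalM q0 mulr0.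
Qed.

Lemma mxdiff_is_linear : linear mxdiff.
Proof. by move=> a p q; apply/colP=> i; rewrite !mxE mderivD mderivZ mevalD mevalZ. Qed.
HB.instance Definition _ := GRing.isLinear.Build k {mpoly k[n]} 'cV[k]_n _ mxdiff mxdiff_is_linear.

Lemma mxdiffM p q : mxdiff (p * q) = p.@[v 0] *: mxdiff q + q.@[v 0] *: mxdiff p.
Proof.
apply/colP=> i; rewrite !mxE mderivM mevalD !mevalM addrC; congr (_ + _).
by rewrite mulrC.
Qed.

Lemma mxdiffC a : mxdiff a%:MP = 0.
Proof. by apply/colP=> i; rewrite !mxE mderivC meval0. Qed.

Lemma mxdiffX i : mxdiff 'X_i = delta_mx i 0.
Proof.
apply/colP=> j; rewrite !mxE mderivX mnm1E mevalZ eqxx andbT eq_sym.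
case: eqP => [->|_]; last by rewrite mul0r.
by rewrite (_ : (_ - _)%MM = 0%MM) ?mpolyX0 ?meval1 ?mulr1 //; apply/mnmP=> l; rewrite mnmBE subnn mnm0E.
Qed.

Lemma mxdiff_clin c : mxdiff (clin c) = c.
Proof.
rewrite raddf_sum /= [RHS]matrix_sum_delta; apply: eq_bigr => i _.
by rewrite big_ord1 linearZ linearB /= mxdiffC subr0 mxdiffX.
Qed.

Lemma clin_vanish c : vanish (clin c).
Proof.
rewrite /vanish raddf_sum big1 // => i _ /=.
by rewrite mevalZ mevalB mevalXU mevalC subrr mulr0.
Qed.

Lemma clin_is_linear : linear clin.
Proof.
move=> a c c'; rewrite /clin scaler_sumr -big_split; apply: eq_bigr => i _ /=.
by rewrite !mxE scalerDl scalerA.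
Qed.
HB.instance Definition _ := GRing.isLinear.Build k 'cV[k]_n {mpoly k[n]} _ clin clin_is_linear.

Lemma mpow1 p : mpow 1 p <-> vanish p.
Proof.
split; last exact: ipow1.
rewrite /=; elim/ideal_mul_ind: p / => [|p q|p q hp _]; case: vanish_ideal => // _ hD hM.
  exact: hD.
by rewrite mulrC; apply: hM.
Qed.

Lemma mpow2_mxdiff p : mpow 2 p -> mxdiff p = 0.
Proof.
rewrite [mpow 2]/=; elim/ideal_mul_ind: p / => [|p q hp hq|p q hp /mpow1 hq]; first exact: raddf0.
  by rewrite raddfD /= hp hq addr0.
by rewrite mxdiffM hp hq !scale0r addr0.
Qed.

Lemma taylor p : mpow 2 (p - (p.@[v 0])%:MP - clin (mxdiff p)).
Proof.
have vB q : vanish (q - (q.@[v 0])%:MP) by rewrite /vanish mevalB mevalC subrr.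
elim/mpoly_ring_ind: p => [a|i|p q hp hq|p q hp hq].
- by rewrite mevalC subrr mxdiffC raddf0 subr0; apply: ideal_mul0.
- rewrite mevalXU mxdiffX /clin (bigD1 i) //= mxE !eqxx scale1r big1 ?addr0 ?subrr.
    exact: ideal_mul0.
  by move=> j /negPf ji; rewrite mxE ji scale0r.
- have := ipowD true_subring hp hq; congr (mpow 2 _).
  by rewrite mevalD !raddfD /=; ring.
have pq : mpow 2 ((p - (p.@[v 0])%:MP) * (q - (q.@[v 0])%:MP)) by apply: ipow2.
have := ipowD true_subring pq (ipowD true_subring
  (ipowMl (a := (p.@[v 0])%:MP) true_subring I hq) (ipowMl (a := (q.@[v 0])%:MP) true_subring I hp)).
congr (mpow 2 _); rewrite mxdiffM mevalM [clin (_ + _)]raddfD /= !linearZ /= -!mul_mpolyC rmorphM /=.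
ring.
Qed.

Lemma mpow2P p : mpow 2 p <-> vanish p /\ mxdiff p = 0.
Proof.
split=> [hp|[p0 dp0]].
  by split; [apply/mpow1; apply: (ipowS true_subring) hp | apply: mpow2_mxdiff].
by have := taylor p; rewrite p0 dp0 !(raddf0, addr0).
Qed.

End Taylor.

Lemma mxdiff_mx_subst (k : fieldType) n (M : 'M[k]_n) (v : 'rV[k]_n) p :
  mxdiff v (mx_subst M p) = M *m mxdiff (v *m M) p.
Proof.
elim/mpoly_ring_ind: p => [a|i|p q hp hq|p q hp hq].
- by rewrite [mx_subst M _]msubC !mxdiffC mulmx0.
- rewrite mx_substX raddf_sum /= mxdiffX -colE [RHS]matrix_sum_delta.
  by apply: eq_bigr => j _; rewrite big_ord1 linearZ /= mxdiffX mxE.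
- by rewrite !raddfD /= hp hq.
by rewrite rmorphM /= !mxdiffM hp hq !mx_subst_eval mulmxDr !scalemxAr.
Qed.

Section Unramified.
Variables (k : fieldType) (n : nat) (gT : finGroupType) (Wt : {group gT}).
Variable rho : mx_representation k Wt n.
Hypothesis hk : [pchar k] =i pred0.
Variable G : {group gT}.
Hypothesis sGW : G \subset Wt.
Variable x : 'rV[k]_n.
Implicit Types (p q b s : {mpoly k[n]}).

Local Notation act g := (mx_subst (rho g)).
Local Notation Gx := (G :&: rstab rho x)%G.

Definition inv_in (H : {set gT}) p : Prop := p \in invariant rho H.
Definition inv_max (H : {set gT}) p : Prop := p \in invariant rho H /\ p.@[x 0] = 0.

Lemma inv_subring (H : {set gT}) : is_subring (inv_in H).
Proof.
rewrite /inv_in; split=> [||p q|p q]; [exact: rpred0 | exact: rpred1 | exact: rpredD |].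
exact: rpredM.
Qed.

Lemma inv_max_in (H : {set gT}) p : inv_max H p -> inv_in H p.
Proof. by case. Qed.

Lemma stab_fix : {in Gx, forall g, x *m rho g = x}.
Proof. by move=> g /setIP [_ /rstabP []]. Qed.

Lemma sGxW : Gx \subset Wt.
Proof. by rewrite subIset // sGW. Qed.

(** Up to the factor [s], invertible at [x], the maximal ideal of the invariants of [G] generates
    that of the invariants of [Gx]. The proof is Lagrange interpolation in a [Gx]-invariant [a] that
    is 1 at [x] and 0 on the rest of the orbit. *)
Lemma unramified : exists s,
  [/\ s \in invariant rho Gx, s.@[x 0] = 1,
      {in G, forall g, g \notin Gx -> s.@[(x *m rho g) 0] = 0}
    & forall b, inv_max Gx b -> ideal_mul (inv_max G) (inv_in Gx) (s * b)].
Proof.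
have [|a [aI ax a0]] := @sep_invariant _ _ _ _ rho hk Gx x
    [seq x *m rho g | g <- enum (G :\: Gx)] sGxW stab_fix.
  apply/mapP => -[g]; rewrite mem_enum => /setDP [gG gGx] xg.
  by case/negP: gGx; rewrite inE gG; apply/rstabP; rewrite (subsetP sGW).
have axg g : g \in G -> g \notin Gx -> a.@[(x *m rho g) 0] = 0.
  by move=> gG gGx; rewrite a0 //; apply/map_f; rewrite mem_enum inE gGx.
pose D g h := (h \in G) && ((g^-1 * h)%g \notin Gx).
pose pi := \prod_(h | D 1%g h) (a - act h a).
have aG g h : g \in Wt -> h \in Gx -> act (g * h)%g a = act g a.
  move=> gW hGx; have hW := subsetP sGxW h hGx.
  by rewrite mx_subst_rM // (invariantP _ _ _ aI).
have piI : pi \in invariant rho Gx.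
  apply/invariantP => u uGx; have /setIP [uG _] := uGx; have uW := subsetP sGxW u uGx.
  rewrite rmorph_prod [RHS](reindex_inj (mulgI u)) /=.
  apply: eq_big => h; rewrite /D ?invg1 ?mul1g; first by rewrite (groupMl _ uG) (groupMl _ uGx).
  move=> /andP[hG _]; have hW := subsetP sGW h hG.
  by rewrite rmorphB /= mx_subst_rM // (invariantP _ _ _ aI).
exists (a * pi); split=> [|||b [bI bx]].
- exact: rpredM.
- rewrite mevalM ax mul1r rmorph_prod big1 // => h /andP[hG hGx] /=.
  by rewrite mevalB ax mx_subst_eval axg ?subr0 //; rewrite invg1 mul1g in hGx.
- by move=> g gG gGx; rewrite mevalM axg // mul0r.
(* The interpolation polynomial taking values proportional to the conjugates of [b * a] at those of
   [a]. Its coefficients are [G]-invariant, and at [a] only the terms with [g] in [Gx] survive. *)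
pose Phi : {poly {mpoly k[n]}} :=
  \sum_(g in G) (act g (b * a))%:P * \prod_(h | D g h) ('X - (act h a)%:P).
have PhiI i : Phi`_i \in invariant rho G.
  apply: coef_invariant => u uG; have uW := subsetP sGW u uG.
  rewrite raddf_sum [RHS](reindex_inj (mulgI u)) /=.
  apply: eq_big => g; first by rewrite groupMl.
  move=> gG; have gW := subsetP sGW g gG.
  rewrite rmorphM /= map_polyC /= mx_subst_rM //; congr (_ * _).
  rewrite rmorph_prod [RHS](reindex_inj (mulgI u)) /=.
  apply: eq_big => h; first by rewrite /D (groupMl _ uG) invMg mulgA mulgKV.
  move=> /andP[hG _]; have hW := subsetP sGW h hG.
  by rewrite rmorphB /= map_polyX map_polyC /= mx_subst_rM.
(* At [x], the conjugate of [b * a] by [g] vanishes through [b] if [g] is in [Gx] and through [a]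
   otherwise. *)
have Phi0 i : (Phi`_i).@[x 0] = 0.
  rewrite -[LHS](coef_map (meval (x 0))) (_ : map_poly _ _ = 0) ?coef0 //.
  rewrite raddf_sum big1 // => g gG /=; rewrite rmorphM /= map_polyC /= mx_subst_eval mevalM.
  case: (boolP (g \in Gx)) => gGx; last by rewrite (axg g) // mulr0 polyC0 mul0r.
  by rewrite stab_fix // bx mul0r polyC0 mul0r.
have PhiE : Phi.[a] = (a * pi * b) *+ #|Gx|.
  rewrite horner_sum (bigID (mem Gx)) /= [X in _ + X]big1 ?addr0; last first.
    move=> g /andP[gG gGx]; rewrite hornerM horner_prod.
    suff -> : \prod_(h | D g h) ('X - (act h a)%:P).[a] = 0 by rewrite mulr0.
    apply/eqP/prodf_eq0; exists 1%g.
      by rewrite /D group1 mulg1 groupV.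
    by rewrite hornerXsubC (mx_subst_r1 rho) subrr.
  rewrite (eq_bigl (mem Gx)) => [|g]; last first.
    by apply: andb_idl => /setIP [].
  rewrite -sumr_const; apply: eq_bigr => g gGx.
  rewrite hornerM hornerC horner_prod (invariantP _ _ _ (rpredM bI aI)) //.
  rewrite mulrC mulrA [a * pi]mulrC -!mulrA [a * b]mulrC; congr (_ * _).
  apply: eq_big => h; last by rewrite hornerXsubC.
  by rewrite /D invg1 mul1g groupMl // groupV.
have c0 : #|Gx|%:R != 0 :> k by rewrite pnatr_neq0 // cardG_gt0.
have -> : a * pi * b = #|Gx|%:R^-1 *: Phi.[a].
  by rewrite PhiE -scaler_nat scalerA mulVf // scale1r.
rewrite -mul_mpolyC horner_coef; apply: ideal_mulMl => [q [qI q0]|].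
  split; last by rewrite mevalM q0 mulr0.
  by rewrite mul_mpolyC rpredZ.
apply: ideal_mul_sum => i _; apply: ideal_mul1; first by split.
exact: rpredX.
Qed.

(* The finite morphism of quotients is etale at x: multiplying by a high power *)
(* of the element s of [unramified] and averaging over G descends powers of    *)
(* the maximal ideal.                                                         *)
Lemma descend N b : b \in invariant rho G ->
  ipow (inv_in Gx) (inv_max Gx) N b -> ipow (inv_in G) (inv_max G) N b.
Proof.
have [s [sI s1 s0 sJ]] := unramified.
have rG := inv_subring G; have rGx := inv_subring Gx.
case: N => [//|N] bI hb.
(* One factor [s] is spent to move each factor from the maximal ideal for [Gx] to the ideal
   generated by the one for [G]. *)
have {}hb : ipow (inv_in Gx) (inv_max G) N.+1 (s ^+ N.+1 * b).
  elim: N.+1 b hb {bI} => [|M IH] b hb; first by rewrite expr0 mul1r.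
  elim/ideal_mul_ind: b / hb => [|p q hp hq|p q hp hq].
  - by rewrite mulr0; apply: ipow0.
  - by rewrite mulrDr; apply: ipowD.
  rewrite exprS mulrACA; have hq' := IH q hq.
  elim/ideal_mul_ind: (s * p) / (sJ p hp) => [|u v hu hv|u v hu hv].
  - by rewrite mul0r; apply: ipow0.
  - by rewrite mulrDl; apply: ipowD.
  by rewrite -mulrA; apply: ideal_mul1 => //; apply: ipowMl.
pose t := trace rho G (s ^+ N.+1).
have tI : t \in invariant rho G by apply: trace_invariant.
have tx : t.@[x 0] != 0.
  rewrite raddf_sum (bigID (mem Gx)) /= [X in _ + X]big1 ?addr0; last first.
    by move=> g /andP[gG gGx]; rewrite mx_subst_eval rmorphXn /= s0 // expr0n.
  rewrite (eq_bigl (mem Gx)) => [|g]; last by apply: andb_idl => /setIP [].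
  rewrite (eq_bigr (fun=> 1)) => [|g gGx]; last first.
    by rewrite mx_subst_eval stab_fix // rmorphXn /= s1 expr1n.
  by rewrite sumr_const pnatr_neq0 // cardG_gt0.
have {}hb : ipow (inv_in G) (inv_max G) N.+1 (t * b).
  (* Since [b] and the factors from [inv_max G] are [G]-invariant, averaging only affects the last
     factor and brings it into the invariants of [G]. *)
  have -> : t * b = trace rho G (s ^+ N.+1 * b).
    by rewrite mulrC [_ * b]mulrC traceMl.
  elim: N.+1 (s ^+ N.+1 * b) hb => [|M IH] p hp; first exact: trace_invariant.
  elim/ideal_mul_ind: p / hp => [|p q hp hq|p q [hp p0] /IH hq].
  - by rewrite raddf0; apply: ideal_mul0.
  - by rewrite raddfD; apply: ideal_mulD.
  by rewrite traceMl //; apply: ideal_mul1.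
(* To divide by [t], nonzero at [x], without localising, write [t x * b] as [t * b - (t - t x) * b]:
   the second term gains one order at each step. *)
suff h i : (i <= N.+1)%N -> ipow (inv_in G) (inv_max G) i b by apply: h.
elim: i => [|i IH] iN; first exact: bI.
have -> : b = (t.@[x 0])^-1 *: (t * b + - (t - (t.@[x 0])%:MP) * b).
  apply/(canRL (scalerK tx)); rewrite -!mul_mpolyC; ring.
rewrite -mul_mpolyC; apply: ipowMl => //.
  by rewrite /inv_in -[_%:MP]mulr1 mul_mpolyC rpredZ ?rpred1.
apply: ipowD => //; first exact: ipow_le (@inv_max_in G) iN hb.
apply: ideal_mul1; last exact: IH (ltnW iN).
split; last by rewrite mevalN mevalB mevalC subrr oppr0.
by rewrite rpredN rpredB // -[_%:MP]mulr1 mul_mpolyC rpredZ ?rpred1.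
Qed.

End Unramified.

Lemma quo_idealE (k : fieldType) n m (f : 'I_m -> {mpoly k[n]}) P :
  quo_ideal f P <-> msub f P = 0.
Proof. by []. Qed.

(** * Tangent spaces of quotients *)

Section Cotangent.
Variables (k : fieldType) (n : nat) (gT : finGroupType) (Wt : {group gT}).
Variable rho : mx_representation k Wt n.
Hypothesis hk : [pchar k] =i pred0.
Variable G : {group gT}.
Hypothesis sGW : G \subset Wt.
Variable x : 'rV[k]_n.
Variables (m : nat) (f : 'I_m -> {mpoly k[n]}).
Hypothesis fI : forall j, f j \in invariant rho G.
Hypothesis fgen : forall p, p \in invariant rho G -> exists P, msub f P = p.

Local Notation Gx := (G :&: rstab rho x)%G.
Local Notation v := (quo_map f x).
Local Notation max2 := (ipow (inv_in rho Gx) (inv_max rho x Gx) 2).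

Lemma constI (H : {set gT}) c : c%:MP \in invariant rho H.
Proof. by rewrite -[_%:MP]mulr1 mul_mpolyC rpredZ ?rpred1. Qed.

Lemma msub_invariant P : msub f P \in invariant rho G.
Proof.
elim/mpoly_ring_ind: P => [c|i|p q hp hq|p q hp hq].
- by rewrite msubC constI.
- by rewrite msubX.
- rewrite rmorphD; exact: rpredD hp hq.
rewrite rmorphM; exact: rpredM hp hq.
Qed.

Lemma meval_quo_map (y : 'rV[k]_n) P : (msub f P).@[y 0] = P.@[(quo_map f y) 0].
Proof. by rewrite msub_eval; apply: meval_eq => i; rewrite mxE. Qed.

Lemma sub_invGx p : p \in invariant rho G -> p \in invariant rho Gx.
Proof. by apply: invariantS; apply: subsetIl. Qed.

Lemma msub_max P : vanish v P -> inv_max rho x G (msub f P).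
Proof. by move=> P0; split; [exact: msub_invariant | rewrite meval_quo_map]. Qed.

Lemma msub_max2 P : ipow (fun=> True) (vanish v) 2 P -> max2 (msub f P).
Proof.
apply: ipow_map; [exact: inv_subring | |].
  by move=> Q _; apply/sub_invGx/msub_invariant.
by move=> Q /msub_max [QI Q0]; split=> //; apply: sub_invGx.
Qed.

Lemma max2D p q : max2 p -> max2 q -> max2 (p + q).
Proof. by apply: ipowD; apply: inv_subring. Qed.

Lemma max2Ml a p : a \in invariant rho Gx -> max2 p -> max2 (a * p).
Proof. by apply: ipowMl; apply: inv_subring. Qed.

Lemma max2Z a p : max2 p -> max2 (a *: p).
Proof. by rewrite -mul_mpolyC; apply: max2Ml; apply: constI. Qed.

Lemma max2N p : max2 p -> max2 (- p).
Proof. by rewrite -scaleN1r; apply: max2Z. Qed.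

Lemma max2M p q : inv_max rho x Gx p -> inv_max rho x Gx q -> max2 (p * q).
Proof. by apply: ipow2; apply: rpred1. Qed.

Lemma sub_max (H : {set gT}) p :
  p \in invariant rho H -> inv_max rho x H (p - (p.@[x 0])%:MP).
Proof. by move=> pI; split; rewrite ?rpredB ?constI // mevalB mevalC subrr. Qed.

(** The cotangent space of V~/G_x at x is spanned by the [f j]: modulo [max2] one may replace [b] by
    [s * b] because [s x = 1], and then apply [unramified]. *)
Lemma cot_surj b : inv_max rho x Gx b -> exists c, max2 (b - msub f (clin v c)).
Proof.
move=> hb; have [s [sI s1 s0 sJ]] := unramified rho hk sGW x.
suff [c hc] : exists c, max2 (s * b - msub f (clin v c)).
  exists c; have -> : b - msub f (clin v c) =
      (s * b - msub f (clin v c)) - (s - (s.@[x 0])%:MP) * b.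
    rewrite s1 mpolyC1; ring.
  by apply: max2D => //; apply: max2N; apply: max2M => //; apply: sub_max.
elim/ideal_mul_ind: (s * b) / (sJ b hb) => [|p q [c hc] [c' hc']|p q [pI p0] qI].
- by exists 0; rewrite !raddf0 addr0; apply: ipow0; apply: inv_subring.
- exists (c + c'); have := max2D hc hc'; congr (max2 _).
  by rewrite !raddfD /=; ring.
have [P PE] := fgen pI; have P0 : vanish v P by rewrite /vanish -meval_quo_map PE.
exists (q.@[x 0] *: mxdiff v P).
have -> : p * q - msub f (clin v (q.@[x 0] *: mxdiff v P)) =
    p * (q - (q.@[x 0])%:MP) + q.@[x 0] *: msub f (P - clin v (mxdiff v P)).
  by rewrite raddfB !linearZ /= PE -!mul_mpolyC; ring.
apply: max2D; first by apply: max2M; [split=> //; apply: sub_invGx | apply: sub_max].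
apply: max2Z; apply: msub_max2.
by have := taylor v P; rewrite P0 mpolyC0 subr0.
Qed.

Lemma cot_surj_inv b : b \in invariant rho Gx ->
  exists c, max2 (b - (b.@[x 0])%:MP - msub f (clin v c)).
Proof. by move=> bI; apply: cot_surj; apply: sub_max. Qed.

(** By [descend] the function is already in the square of the maximal ideal for [G], so it lifts to
    some [Q] of order two at [v]; [clin v c - Q] is the relation. *)
Lemma cot_ker c : max2 (msub f (clin v c)) ->
  exists2 P, quo_ideal f P & mxdiff v P = c.
Proof.
move=> /(descend hk sGW (msub_invariant _)).
case/(ipow_lift (f := f) (S := fun=> True) (J := vanish v)) => [//|p /fgen [P <-]|p [pI p0]|Q Q2 QE].
- by exists P.
- by have [P PE] := fgen pI; exists P => //; rewrite /vanish -meval_quo_map PE.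
exists (clin v c - Q); first by apply/quo_idealE; rewrite raddfB /= QE subrr.
by rewrite raddfB /= mxdiff_clin mpow2_mxdiff // subr0.
Qed.

Lemma quo_ideal_vanish P : quo_ideal f P -> vanish v P.
Proof.
by move/quo_idealE => P0; rewrite /vanish -meval_quo_map P0 meval0.
Qed.

Section Tangent.
Local Notation tang := (tangent rho Gx x).
Local Notation invr := (invring rho Gx).
Implicit Types (D : tang).

(** Lets derivations be computed on polynomials; the default 0 is taken on those that are not
    [Gx]-invariant. *)
Definition tval D (p : {mpoly k[n]}) : k := val D (insubd 0 p).

Lemma insubdE p : p \in invariant rho Gx -> val (insubd (0 : invr) p) = p.
Proof. by move=> pI; rewrite val_insubd pI. Qed.

Lemma tval_val D (b : invr) : tval D (val b) = val D b.
Proof. by rewrite /tval valKd. Qed.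

Lemma tval_linear D a p q : p \in invariant rho Gx -> q \in invariant rho Gx ->
  tval D (a *: p + q) = a * tval D p + tval D q.
Proof.
move=> pI qI; have /asboolP[lD _] : val D \in point_derivation x by case: D.
rewrite /tval (_ : insubd _ _ = a *: insubd (0 : invr) p + insubd 0 q) ?lD //.
by apply: val_inj; rewrite /= !insubdE // rpredD // rpredZ.
Qed.

Lemma tvalM D p q : p \in invariant rho Gx -> q \in invariant rho Gx ->
  tval D (p * q) = p.@[x 0] * tval D q + q.@[x 0] * tval D p.
Proof.
move=> pI qI; have /asboolP[_ dD] : val D \in point_derivation x by case: D.
rewrite /tval (_ : insubd _ _ = insubd (0 : invr) p * insubd 0 q).
  by rewrite dD /inv_eval !insubdE.
by apply: val_inj; rewrite /= !insubdE // rpredM.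
Qed.

Lemma tvalD D p q : p \in invariant rho Gx -> q \in invariant rho Gx ->
  tval D (p + q) = tval D p + tval D q.
Proof. by move=> pI qI; rewrite -[p]scale1r tval_linear // mul1r scale1r. Qed.

Lemma tvalZ D a p : p \in invariant rho Gx -> tval D (a *: p) = a * tval D p.
Proof.
move=> pI; have z : tval D 0 = 0.
  by have := tvalD D (rpred0 (invariant rho Gx)) (rpred0 _); rewrite addr0 => /eqP; rewrite -subr_eq0 opprD addrA subrr sub0r oppr_eq0 => /eqP.
by rewrite -[a *: p]addr0 tval_linear ?rpred0 // z addr0.
Qed.

Lemma tval0 D : tval D 0 = 0.
Proof. by rewrite -(scale0r 0) tvalZ ?rpred0 // mul0r. Qed.

Lemma tvalC D c : tval D c%:MP = 0.
Proof.
have e : tval D 1 = 0.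
  have := tvalM D (rpred1 (invariant rho Gx)) (rpred1 _).
  by rewrite mulr1 meval1 !mul1r => /eqP; rewrite -subr_eq0 opprD addrA subrr sub0r oppr_eq0 => /eqP.
by rewrite -[c%:MP]mulr1 mul_mpolyC tvalZ ?rpred1 // e mulr0.
Qed.

Lemma tval_max2 D p : max2 p -> tval D p = 0.
Proof.
have h : forall p, ideal_mul (inv_max rho x Gx) (inv_in rho Gx) p -> inv_max rho x Gx p.
  move=> q; elim/ideal_mul_ind: q / => [|q r [qI q0] [rI r0]|q r [qI q0] rI].
  - by split; rewrite ?rpred0 ?meval0.
  - by split; rewrite ?rpredD // mevalD q0 r0 addr0.
  by split; rewrite ?rpredM // mevalM q0 mul0r.
move=> hp; suff [] : p \in invariant rho Gx /\ tval D p = 0 by [].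
elim/ideal_mul_ind: p / hp => [|q r [qI q0] [rI r0]|q r [qI q0] /h [rI r0]].
- by rewrite rpred0 tval0.
- by rewrite rpredD // tvalD // q0 r0 addr0.
by rewrite rpredM // tvalM // q0 r0 !mul0r addr0.
Qed.

Lemma tval_msub D P : tval D (msub f P) = (tangent_map f D *m mxdiff v P) 0 0.
Proof.
have fIx j : f j \in invariant rho Gx by apply: sub_invGx.
have mI Q : msub f Q \in invariant rho Gx by apply/sub_invGx/msub_invariant.
elim/mpoly_ring_ind: P => [c|i|p q hp hq|p q hp hq].
- by rewrite msubC tvalC mxdiffC mulmx0 mxE.
- by rewrite msubX mxdiffX -colE !mxE.
- by rewrite rmorphD /= tvalD // hp hq [mxdiff _ (_ + _)]raddfD /= mulmxDr [RHS]mxE.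
rewrite rmorphM /= tvalM // hp hq mxdiffM mulmxDr -!scalemxAr !meval_quo_map.
by rewrite [RHS]mxE; congr (_ + _); rewrite [RHS]mxE.
Qed.

Lemma tval_cot D b c : b \in invariant rho Gx ->
    max2 (b - (b.@[x 0])%:MP - msub f (clin v c)) ->
  tval D b = (tangent_map f D *m c) 0 0.
Proof.
move=> bI hc; have := tval_max2 D hc.
have mI Q : msub f Q \in invariant rho Gx by apply/sub_invGx/msub_invariant.
rewrite -addrA -opprD -[- _]scaleN1r addrC tval_linear ?rpredD ?constI //.
rewrite tvalD ?constI // tvalC add0r mulN1r addrC => /subr0_eq ->.
by rewrite tval_msub mxdiff_clin.
Qed.

Lemma tangent_map_inj : injective (@tangent_map k n gT rho Gx x m f).
Proof.
move=> D E DE; apply: val_inj; apply/funext => b; rewrite -!tval_val.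
have bI : val b \in invariant rho Gx by case: b.
have [c hc] := cot_surj_inv bI.
by rewrite !(tval_cot _ bI hc) DE.
Qed.

(** Let the derivation send [b] to [u *m c], where [c] represents [b] in the cotangent space by
    [cot_surj]. By [cot_ker] two choices of [c] differ by the gradient of a relation, which [u]
    kills. *)
Lemma tangent_map_exists (u : 'rV[k]_m) :
  (forall P, quo_ideal f P -> u *m mxdiff v P = 0) -> exists D, tangent_map f D = u.
Proof.
move=> hu.
have uc c : max2 (msub f (clin v c)) -> u *m c = 0.
  by case/cot_ker => P hP <-; apply: hu.
have /choice [c hc] : forall b : invr, exists c,
    max2 (val b - ((val b).@[x 0])%:MP - msub f (clin v c)).
  by move=> b; apply: cot_surj_inv; case: b.
pose D (b : invr) : k^o := (u *m c b) 0 0.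
have Dchar (b : invr) d : max2 (val b - ((val b).@[x 0])%:MP - msub f (clin v d)) ->
    D b = (u *m d) 0 0.
  move=> hd; apply/eqP; rewrite /D -subr_eq0.
  have /uc : max2 (msub f (clin v (c b - d))).
    have := max2D hd (max2N (hc b)); congr (max2 _).
    by rewrite !raddfB /=; ring.
  by rewrite mulmxBr => /matrixP/(_ 0 0); rewrite !mxE => ->.
have DP : D \in point_derivation (rho := rho) (H := Gx) x.
  apply/asboolP; split=> [a b b'|b b'].
    rewrite (Dchar _ (a *: c b + c b')).
      by rewrite mulmxDr -scalemxAr [LHS]mxE [X in X + _]mxE.
    have := max2D (max2Z a (hc b)) (hc b'); congr (max2 _).
    rewrite /= mevalD mevalZ [clin v (_ + _)]linearP [msub f (_ + _)]linearP /=.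
    by rewrite mpolyCD mpolyCM -!mul_mpolyC; ring.
  rewrite (Dchar _ ((val b).@[x 0] *: c b' + (val b').@[x 0] *: c b)).
    by rewrite mulmxDr -!scalemxAr [LHS]mxE [X in X + _]mxE [X in _ + X]mxE.
  have vI (a : invr) : val a \in invariant rho Gx by case: a.
  have bb : max2 ((val b - ((val b).@[x 0])%:MP) * (val b' - ((val b').@[x 0])%:MP)).
    by apply: max2M; apply: sub_max.
  have := max2D bb (max2D (max2Z (val b).@[x 0] (hc b')) (max2Z (val b').@[x 0] (hc b))).
  congr (max2 _).
  rewrite /= mevalM [clin v (_ + _)]linearP [msub f (_ + _)]linearP !linearZ /=.
  by rewrite mpolyCM -!mul_mpolyC; ring.
exists (Tangent DP); apply/rowP => j; rewrite mxE /= (Dchar _ (delta_mx j 0)).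
  by rewrite -colE mxE.
rewrite insubdE ?sub_invGx // /clin (bigD1 j) //= mxE !eqxx scale1r big1 ?addr0.
  rewrite rmorphB /= msubX msubC mxE subrr; exact: ideal_mul0.
by move=> i /negPf ij; rewrite mxE ij scale0r.
Qed.

End Tangent.

End Cotangent.

(** * Graded Nakayama lemma *)

Section Weighted.
Variables (k : fieldType) (n : nat) (d : 'I_n -> nat).
Hypothesis hd : forall i, (0 < d i)%N.
Implicit Types (p q : {mpoly k[n]}).

Lemma wdegU i : wdeg d U_(i)%MM = d i.
Proof.
rewrite /wdeg (bigD1 i) //= mnm1E eqxx mul1n big1 ?addn0 // => j ji.
by rewrite mnm1E eq_sym (negPf ji).
Qed.

Lemma wdeg_eq0 u : (wdeg d u == 0%N) = (u == 0%MM).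
Proof.
rewrite sum_nat_eq0; apply/forallP/eqP => [h|-> i]; last by rewrite mnm0E.
apply/mnmP=> i; have := h i; rewrite muln_eq0 mnm0E /=.
by rewrite [d i == _]eqn0Ngt hd orbF => /eqP.
Qed.

Lemma meval0E p : p.@[(0 : 'rV[k]_n) 0] = p@_0%MM.
Proof.
elim/mpoly_ring_ind: p => [c|i|p q hp hq|p q hp hq].
- by rewrite mevalC mcoeffC eqxx mulr1.
- by rewrite mevalXU mcoeffX mxE mnm1_eq0.
- by rewrite mevalD mcoeffD hp hq.
by rewrite mevalM hp hq -rmorphM.
Qed.

Lemma pihomog0E p : pihomog (wdeg d) 0 p = (p.@[(0 : 'rV[k]_n) 0])%:MP.
Proof.
apply/mpolyP => u; rewrite mcoeff_pihomog mcoeffC meval0E /= wdeg_eq0.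
by case: eqP => [->|]; rewrite ?mulr1 ?mulr0.
Qed.

Lemma dhomog_pos_vanish p D : (0 < D)%N -> p \is D.-homog for (wdeg d) ->
  p.@[(0 : 'rV[k]_n) 0] = 0.
Proof.
move=> D0 hp; rewrite meval0E; apply: (dhomog_nemf_coeff hp).
by rewrite /= wdeg0 eq_sym -lt0n.
Qed.

Lemma pihomogM s D p q : p \is s.-homog for (wdeg d) ->
  pihomog (wdeg d) D (p * q) = if (s <= D)%N then p * pihomog (wdeg d) (D - s) q else 0.
Proof.
move=> hp; have key (j : nat) : pihomog (wdeg d) D (p * pihomog (wdeg d) j q) =
    if (s + j == D)%N then p * pihomog (wdeg d) j q else 0.
  have hj : p * pihomog (wdeg d) j q \is (s + j).-homog for (wdeg d).
    exact: dhomogM hp (pihomogP _ _ _).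
  by case: eqP => [<-|/eqP ne]; [rewrite pihomog_dE | rewrite (pihomog_ne0 ne)].
rewrite {1}(pihomog_partitionE (leqnn (mmeasure (wdeg d) q))) mulr_sumr.
rewrite (raddf_sum (pihomog (wdeg d) D)) /=.
under eq_bigr => j _ do rewrite key.
case: leqP => sD; last first.
  rewrite big1 // => j _; case: eqP => // e; move: sD.
  by rewrite -e ltnNge leq_addr.
case: (ltnP (D - s) (mmeasure (wdeg d) q)) => lt.
  rewrite (bigD1 (Ordinal lt)) //= subnKC // eqxx big1 ?addr0 // => j jD.
  rewrite ifN //; apply: contra jD => /eqP e; apply/eqP/val_inj => /=.
  by rewrite -e addKn.
rewrite big1 => [|j _]; last first.
  rewrite ifN //; apply/eqP => e; move: lt; rewrite -e addKn leqNgt.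
  by rewrite ltn_ord.
rewrite (_ : pihomog _ _ q = 0) ?mulr0 //; apply/mpolyP=> u.
rewrite mcoeff_pihomog mcoeff0; case: eqP => // uD; apply: memN_msupp_eq0.
by apply: (@mmeasure_mnm_ge _ _ (wdeg d)); rewrite uD.
Qed.

Lemma pihomog_closed_sum (S : {mpoly k[n]} -> Prop) p :
    S 0 -> (forall p q, S p -> S q -> S (p + q)) ->
  (forall D, S (pihomog (wdeg d) D p)) -> S p.
Proof.
move=> S0 SD h; rewrite (pihomog_partitionE (leqnn (mmeasure (wdeg d) p))).
by elim/big_ind: _ => // i _; apply: h.
Qed.

Lemma pos_part_vanish (S : {mpoly k[n]} -> Prop) p :
    (forall D, S (pihomog (wdeg d) D p)) -> p.@[(0 : 'rV[k]_n) 0] = 0 ->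
  pos_part d S p.
Proof.
move=> Sh p0; exists [seq pihomog (wdeg d) D.+1 p | D <- iota 0 (mmeasure (wdeg d) p)].
  move=> q /mapP [D _ ->]; split; first exact: Sh.
  by exists D.+1 => //; apply: pihomogP.
rewrite big_map {1}(pihomog_partitionE (leqnSn (mmeasure (wdeg d) p))).
rewrite big_ord_recl /= pihomog0E p0 mpolyC0 add0r.
by rewrite -[X in iota 0 X]subn0 -/(index_iota _ _) big_mkord.
Qed.

Lemma pos_part_eval0 (S : {mpoly k[n]} -> Prop) p : pos_part d S p -> p.@[(0 : 'rV[k]_n) 0] = 0.
Proof.
case=> s hs ->; rewrite raddf_sum big_seq big1 // => q /hs [_ [c c0 hq]] /=.
exact: dhomog_pos_vanish hq.
Qed.

Lemma vanish0_span p : p.@[(0 : 'rV[k]_n) 0] = 0 -> exists a, p = \sum_i 'X_i * a i.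
Proof.
suff h q : exists a, q - (q.@[(0 : 'rV[k]_n) 0])%:MP = \sum_i 'X_i * a i.
  by move=> p0; have := h p; rewrite p0 mpolyC0 subr0.
elim/mpoly_ring_ind: q => [c|j|q r [a ha] [b hb]|q r [a ha] [b hb]].
- by exists (fun=> 0); rewrite mevalC subrr big1 // => i _; rewrite mulr0.
- exists (fun i => (i == j)%:R); rewrite mevalXU mxE mpolyC0 subr0 (bigD1 j) //= eqxx mulr1.
  by rewrite big1 ?addr0 // => i /negPf ->; rewrite mulr0.
- exists (fun i => a i + b i).
  under eq_bigr => i _ do rewrite mulrDr.
  by rewrite big_split /= -ha -hb mevalD mpolyCD; ring.
exists (fun i => a i * r + (q.@[(0 : 'rV[k]_n) 0])%:MP * b i).
under eq_bigr => i _ do rewrite mulrDr [_%:MP * b i]mulrC !mulrA.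
by rewrite big_split /= -!mulr_suml -ha -hb mevalM mpolyCM; ring.
Qed.

Section Nakayama.
Variable I : {mpoly k[n]} -> Prop.
Hypothesis idI : is_ideal I.
Hypothesis homI : forall D p, I p -> I (pihomog (wdeg d) D p).

(** A_+ I written with the variables as generators of A_+; [aug_mulP] uses that the weights are
    positive. *)
Definition aug_mul p : Prop :=
  exists2 a : 'I_n -> {mpoly k[n]}, forall i, I (a i) & p = \sum_i 'X_i * a i.

Lemma aug_mul_ideal : is_ideal aug_mul.
Proof.
have [I0 ID IM] := idI; split=> [|_ _ [a ha ->] [b hb ->]|p _ [a ha ->]].
- by exists (fun=> 0) => //; rewrite big1 // => i _; rewrite mulr0.
- exists (fun i => a i + b i); first by move=> i; apply: ID.
  by rewrite -big_split; apply: eq_bigr => i _; rewrite mulrDr.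
- exists (fun i => p * a i); first by move=> i; apply: IM.
  by rewrite mulr_sumr; apply: eq_bigr => i _; rewrite mulrCA.
Qed.

Lemma aug_mulP p : ideal_mul (pos_part d (fun=> True)) I p <-> aug_mul p.
Proof.
have [a0 aD aM] := aug_mul_ideal; split=> [|[a ha ->]].
  elim/ideal_mul_ind: p / => // p q /pos_part_eval0/vanish0_span [a ->] Iq.
  exists (fun i => a i * q); first by move=> i; case: idI => _ _; apply.
  by rewrite mulr_suml; apply: eq_bigr => i _; rewrite mulrA.
apply: ideal_mul_sum => i _; apply: ideal_mul1 => //.
by apply: pos_part_vanish => //; rewrite mevalXU mxE.
Qed.

Lemma aug_mulM p q : p.@[(0 : 'rV[k]_n) 0] = 0 -> I q -> aug_mul (p * q).
Proof.
case/vanish0_span => a -> Iq; exists (fun i => a i * q); first by move=> i; case: idI => _ _; apply.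
by rewrite mulr_suml; apply: eq_bigr => i _; rewrite mulrA.
Qed.

Definition spans_mod N (q : 'I_N -> {mpoly k[n]}) : Prop :=
  forall p, I p -> exists c : 'I_N -> k, aug_mul (p - \sum_i c i *: q i).

(** Induction on the degree: in degree [D], the part in [aug_mul] involves components of elements of
    [I] of degree less than [D] only. *)
Lemma nakayama N (q : 'I_N -> {mpoly k[n]}) : (forall i, I (q i)) ->
    (forall i, exists D, q i \is D.-homog for (wdeg d)) ->
  spans_mod q -> generates q I.
Proof.
have [I0 ID IM] := idI; move=> Iq hq span p; split=> [Ip|[c ->]]; last first.
  by apply: ideal_sum => // i _; apply: IM.
pose gen p := exists c : 'I_N -> {mpoly k[n]}, p = \sum_i c i * q i.
have gen0 : gen 0 by exists (fun=> 0); rewrite big1 // => i _; rewrite mul0r.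
have genD r s : gen r -> gen s -> gen (r + s).
  move=> [a ->] [b ->]; exists (fun i => a i + b i); rewrite -big_split.
  by apply: eq_bigr => i _; rewrite mulrDl.
have genM r s : gen s -> gen (r * s).
  move=> [a ->]; exists (fun i => r * a i); rewrite mulr_sumr.
  by apply: eq_bigr => i _; rewrite mulrA.
have genq i c : gen (c *: q i).
  exists (fun j => (j == i)%:R * c%:MP); rewrite (bigD1 i) //= eqxx mul1r mul_mpolyC.
  by rewrite big1 ?addr0 // => j /negPf ->; rewrite !mul0r.
rewrite -/(gen p); apply: pihomog_closed_sum => // D.
elim/ltn_ind: D p Ip => D IH p Ip.
have [c [a Ia e]] := span p Ip.
have -> : p = \sum_i c i *: q i + \sum_i 'X_i * a i by rewrite -e addrC subrK.
rewrite raddfD /= !raddf_sum /=; apply: (genD).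
  apply: (big_ind gen) => // i _; rewrite linearZ /=; have [D' hD'] := hq i.
  by have [e'|ne] := eqVneq D' D; [rewrite pihomog_dE // -e' | rewrite (pihomog_ne0 ne) // scaler0].
apply: (big_ind gen) => // i _.
have hX : ('X_i : {mpoly k[n]}) \is (d i).-homog for (wdeg d).
  by rewrite dhomogX /= wdegU.
rewrite (pihomogM _ _ hX); case: leqP => // le; apply: (genM).
apply: IH => //; rewrite -subn_gt0 subKn //.
Qed.

(** The [h i] need not be homogeneous. Among homogeneous spanning families take one of least size;
    with more than [r] members it would satisfy a linear relation modulo A_+ I and one could be
    dropped. *)
Lemma homogeneous_generators r (h : 'I_r -> {mpoly k[n]}) :
    (forall i, I (h i)) -> spans_mod h ->
  exists2 N, (N <= r)%N & exists q : 'I_N -> {mpoly k[n]},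
    [/\ forall i, I (q i), forall i, exists D, q i \is D.-homog for (wdeg d)
      & generates q I].
Proof.
have [I0 ID IM] := idI; have augI := aug_mul_ideal; have [a0 aD aM] := augI.
move=> Ih span.
pose good N := exists q : 'I_N -> {mpoly k[n]},
  [/\ forall i, I (q i), forall i, exists D, q i \is D.-homog for (wdeg d) & spans_mod q].
have ex : exists N, `[< good N >].
  (* [mmeasure] exceeds every degree that occurs, so the components of degree less than [K] are all
     components of the [h i]. *)
  pose K := (\max_(i < r) mmeasure (wdeg d) (h i))%N.
  pose q (s : 'I_#|{: 'I_r * 'I_K}|) := pihomog (wdeg d) (enum_val s).2 (h (enum_val s).1).
  exists #|{: 'I_r * 'I_K}|; apply/asboolP; exists q; split=> [i|i|p Ip].
  - exact: homI.
  - by exists (enum_val i).2; apply: pihomogP.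
  have [c hc] := span p Ip; exists (fun s => c (enum_val s).1).
  congr (aug_mul (p - _)): hc.
  rewrite -[RHS](reindex (@enum_val _ {: 'I_r * 'I_K}) (P := predT)
     (F := fun s : 'I_r * 'I_K => c s.1 *: pihomog (wdeg d) s.2 (h s.1))) /=; last first.
    exact/onW_bij/enum_val_bij.
  rewrite -(pair_bigA _ (fun (i : 'I_r) (j : 'I_K) => c i *: pihomog (wdeg d) j (h i))) /=.
  apply: eq_bigr => i _; rewrite -scaler_sumr -pihomog_partitionE //.
  exact: leq_bigmax.
case: (ex_minnP ex) => N /asboolP [q [Iq hq qspan]] minN.
exists N; last by exists q; split=> //; apply: nakayama.
rewrite leqNgt; apply/negP => rN.
have /fin_all_exists [T hT] i : exists c : 'I_r -> k, aug_mul (q i - \sum_j c j *: h j).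
  exact: span.
pose TM := \matrix_(i < N, j < r) T i j.
have [a ka] : exists a, row a (kermx TM) != 0.
  apply/existsP; apply: contraTT rN => /existsPn z.
  have : kermx TM = 0 by apply/row_matrixP => a; rewrite row0; apply/eqP/negPn/z.
  move/eqP; rewrite kermx_eq0 /row_free => /eqP rk.
  by rewrite -leqNgt -{1}rk rank_leq_col.
set u := row a (kermx TM) in ka.
have uT : u *m TM = 0 by rewrite -row_mul mulmx_ker row0.
have uq : aug_mul (\sum_i u 0 i *: q i).
  have := ideal_sum (index_enum 'I_N) (P := xpredT) augI (fun i _ => idealZ (u 0 i) augI (hT i)).
  congr (aug_mul _); under eq_bigr => i _ do rewrite scalerBr.
  rewrite sumrB -[RHS]subr0; congr (_ - _).
  under eq_bigr => i _ do rewrite scaler_sumr.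
  rewrite exchange_big big1 // => j _ /=.
  under eq_bigr => i _ do rewrite scalerA.
  rewrite -scaler_suml (_ : \sum_i _ = (u *m TM) 0 j); first by rewrite uT mxE scale0r.
  by rewrite [RHS]mxE; apply: eq_bigr => i _; congr (_ * _); rewrite [RHS]mxE.
have [i0 ui] : exists i, u 0 i != 0.
  apply/existsP; apply: contraNT ka => /existsPn z; apply/eqP/matrixP=> i j.
  by rewrite ord1 [RHS]mxE; apply/eqP/negPn/z.
case: N q Iq hq qspan minN rN T hT TM a u ka uT uq i0 ui => [|N] q Iq hq qspan minN rN T hT TM a u ka uT uq i0 ui.
  by case: i0 {ui}.
suff /minN : `[< good N >] by rewrite ltnn.
apply/asboolP; exists (q \o lift i0); split=> [i|i|p Ip] /=; [exact: Iq | exact: hq |].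
have [c hc] := qspan p Ip.
exists (fun i => c (lift i0 i) - c i0 / u 0 i0 * u 0 (lift i0 i)).
have split0 (F : 'I_N.+1 -> {mpoly k[n]}) : \sum_i F i = F i0 + \sum_i F (lift i0 i).
  rewrite (bigD1 i0) //=; congr (_ + _).
  rewrite (reindex_omap (lift i0) (unlift i0)) => [|j ji] /=; last first.
    by case: unliftP ji => [l ->|->]; rewrite ?eqxx.
  by apply: eq_bigl => j; rewrite liftK eqxx andbT eq_sym neq_lift.
have := aD _ _ hc (idealZ (c i0 / u 0 i0) augI uq); congr (aug_mul _).
have -> : \sum_i (c (lift i0 i) - c i0 / u 0 i0 * u 0 (lift i0 i)) *: q (lift i0 i) =
    \sum_i (c i - c i0 / u 0 i0 * u 0 i) *: q i.
  by rewrite split0 divfK // subrr scale0r add0r.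
under [X in _ = _ - X]eq_bigr => i _ do rewrite scalerBl -scalerA.
by rewrite sumrB opprB -scaler_sumr [RHS]addrA [RHS]addrAC.
Qed.

End Nakayama.

End Weighted.

(** * Minimal presentations of rings of invariants *)

Section Splitting.
Variables (k : fieldType) (n : nat) (d : 'I_n -> nat) (gT : finGroupType).
Variables (Wt : {group gT}) (rho : mx_representation k Wt n).
Hypothesis hk : [pchar k] =i pred0.
Hypothesis hd : forall i, (0 < d i)%N.
Hypothesis hgrad : {in Wt, forall g, GLgrad d (rho g)}.

(** Commutation with the single element [t = 2] suffices: in characteristic 0 its powers are
    distinct. *)
Lemma GLgrad_weights (A : 'M[k]_n) i j : GLgrad d A -> A i j != 0 -> d i = d j.
Proof.
case=> _ /(_ 2%:R) hA Aij; have {}hA := hA (pnatr_neq0 hk (isT : (0 < 2)%N)).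
have := congr1 (fun M : 'M[k]_n => M i j) hA.
rewrite /grading_mx mul_mx_diag mul_diag_mx !mxE [A i j * _]mulrC.
move=> /(mulIf Aij) /eqP; rewrite -!natrX => e; apply/eqP.
wlog lij : i j e {Aij hA} / (d j <= d i)%N.
  move=> H; case/orP: (leq_total (d j) (d i)) => le; first exact: H.
  by rewrite eq_sym; apply: H => //; rewrite eq_sym.
move: e; rewrite eq_sym -subr_eq0 -natrB ?leq_pexp2l // ((pcharf0P k).1 hk) subn_eq0.
by rewrite leq_exp2l // => le; rewrite eqn_leq le lij.
Qed.

Lemma dhomog_grad_lin (A : 'M[k]_n) j : GLgrad d A ->
  \sum_i A i j *: 'X_i \is (wdeg d U_(j)%MM).-homog for (wdeg d).
Proof.
move=> hA; apply: rpred_sum => i _.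
have [->|Aij] := eqVneq (A i j) 0; first by rewrite scale0r rpred0.
by apply: rpredZ; rewrite dhomogX /= !wdegU (GLgrad_weights hA Aij).
Qed.

Lemma pihomog_mx_subst (A : 'M[k]_n) D p : GLgrad d A ->
  pihomog (wdeg d) D (mx_subst A p) = mx_subst A (pihomog (wdeg d) D p).
Proof.
by move=> hA; rewrite mx_substE; apply: pihomog_msub => j; apply: dhomog_grad_lin.
Qed.

Variable H : {group gT}.
Hypothesis sHW : H \subset Wt.

Lemma inv_pihomog D p : p \in invariant rho H -> pihomog (wdeg d) D p \in invariant rho H.
Proof.
move=> /invariantP pI; apply/invariantP => g gH; rewrite -pihomog_mx_subst ?pI //.
exact/hgrad/(subsetP sHW).
Qed.

Variables (m : nat) (e : 'I_m -> nat) (f : 'I_m -> {mpoly k[n]}).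
Hypothesis hf : is_splitting d rho H e f.

Local Notation plus := (inv_plus d rho H).

Lemma splitting_inv j : f j \in invariant rho H.
Proof. by have [+ _ _] := hf => /(_ j) []. Qed.

Lemma splitting_pos j : (0 < e j)%N.
Proof. by have [+ _ _] := hf => /(_ j) []. Qed.

Lemma splitting_homog j : f j \is (wdeg e U_(j)%MM).-homog for (wdeg d).
Proof. by have [+ _ _] := hf => /(_ j) []; rewrite /= wdegU. Qed.

Lemma inv_plus_of p : p \in invariant rho H -> p.@[(0 : 'rV[k]_n) 0] = 0 -> plus p.
Proof. by move=> pI; apply: pos_part_vanish => // D; apply: inv_pihomog. Qed.

Lemma inv_plus_inv p : plus p -> p \in invariant rho H.
Proof. by case=> s hs ->; rewrite big_seq; apply: rpred_sum => q /hs []. Qed.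

(** Induction on the degree: modulo the [f j] a homogeneous invariant is a sum of products of two
    invariants of positive, hence smaller, degree. *)
Lemma splitting_gen p : p \in invariant rho H -> exists P, msub f P = p.
Proof.
pose gen p := exists P, msub f P = p.
have gen0 : gen 0 by exists 0; rewrite raddf0.
have genD q r : gen q -> gen r -> gen (q + r).
  by move=> [P <-] [Q <-]; exists (P + Q); rewrite raddfD.
have genM q r : gen q -> gen r -> gen (q * r).
  by move=> [P <-] [Q <-]; exists (P * Q); rewrite rmorphM.
have genZ c q : gen q -> gen (c *: q).
  by move=> [P <-]; exists (c *: P); rewrite linearZ.
move=> pI; rewrite -/(gen p); apply: (@pihomog_closed_sum _ _ d) => // D.
elim/ltn_ind: D p pI => D IH p pI; set q := pihomog _ D p.
have qI : q \in invariant rho H by apply: inv_pihomog.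
case: (posnP D) => D0.
  by rewrite /q D0 (pihomog0E hd); exists (p.@[(0 : 'rV[k]_n) 0])%:MP; rewrite msubC.
have qh : q \is D.-homog for (wdeg d) by apply: pihomogP.
have qp : plus q by apply: inv_plus_of => //; apply: dhomog_pos_vanish D0 qh.
have [_ /(_ q qp) [c [hc _]] _] := hf.
have -> : q = pihomog (wdeg d) D (\sum_j c 0 j *: f j) +
              pihomog (wdeg d) D (q - \sum_j c 0 j *: f j).
  by rewrite -(raddfD (pihomog (wdeg d) D)) addrC subrK /= pihomog_dE.
apply: (genD).
  rewrite (raddf_sum (pihomog (wdeg d) D)); apply: (big_ind gen) => // j _. rewrite /= linearZ /=; apply: (genZ).
  have [ej|ne] := eqVneq (wdeg e U_(j)%MM) D.
    by rewrite pihomog_dE ?msubX -?ej ?splitting_homog //; exists 'X_j; rewrite msubX.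
  by rewrite (pihomog_ne0 ne (splitting_homog j)).
elim/ideal_mul_ind: (q - _) / hc => [|a b ha hb|_ _ [s hs ->] [t ht ->]].
- by rewrite raddf0.
- by rewrite raddfD; apply: (genD).
rewrite big_seq mulr_suml (raddf_sum (pihomog (wdeg d) D)); apply: (big_ind gen) => // a /hs [aI [i i0 ah]].
rewrite big_seq mulr_sumr (raddf_sum (pihomog (wdeg d) D)); apply: (big_ind gen) => // b /ht [bI [j j0 bh]] /=.
have abh := dhomogM ah bh.
have [ij|ne] := eqVneq (i + j)%N D; last by rewrite (pihomog_ne0 ne abh).
rewrite pihomog_dE -?ij //; apply: (genM).
  by rewrite -(pihomog_dE ah); apply: IH => //; rewrite -ij -[X in (X < _)%N]addn0 ltn_add2l.
by rewrite -(pihomog_dE bh); apply: IH => //; rewrite -ij -[X in (X < _)%N]add0n ltn_add2r.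
Qed.

Lemma splitting_indep (c : 'rV[k]_m) :
  ideal_mul plus plus (\sum_j c 0 j *: f j) -> c = 0.
Proof.
move=> hc; have p0 : plus 0 by exists [::]; rewrite ?big_nil.
have [_ /(_ 0 p0) [c0 [_ uniq0]] _] := hf.
have c00 : c0 = 0.
  by apply: uniq0; rewrite big1 ?subrr => [|j _]; [exact: ideal_mul0 | rewrite mxE scale0r].
have c0N : c0 = - c.
  apply: uniq0; rewrite sub0r (eq_bigr (fun j => - (c 0 j *: f j))) => [|j _].
    by rewrite sumrN opprK.
  by rewrite mxE scaleNr.
by rewrite -[c]opprK -c0N c00 oppr0.
Qed.

Lemma splitting_free (c : 'I_m -> k) : \sum_j c j *: f j = 0 -> forall j, c j = 0.
Proof.
move=> h j; have : \row_j c j = 0.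
  apply: splitting_indep; rewrite (eq_bigr (fun j => c j *: f j)) => [|i _]; last by rewrite mxE.
  by rewrite h; apply: ideal_mul0.
by move/rowP/(_ j); rewrite !mxE.
Qed.

Lemma quo_map0 : quo_map f 0 = 0.
Proof.
apply/rowP => j; rewrite !mxE; apply: (dhomog_pos_vanish _ (splitting_homog j)).
by rewrite /= wdegU splitting_pos.
Qed.

(** A linear term in a relation would be a linear dependence of the [f j] modulo products of
    invariants of positive degree. *)
Lemma quo_ideal_mpow2 P : quo_ideal f P -> ipow (fun=> True) (vanish 0) 2 P.
Proof.
have fI := splitting_inv.
move=> hP; apply/mpow2P; have P0 : vanish 0 P.
  by have := quo_ideal_vanish 0 hP; rewrite quo_map0.
split=> //; apply: trmx_inj; rewrite trmx0; apply: splitting_indep.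
have vp Q : vanish 0 Q -> plus (msub f Q).
  move=> Q0; apply: inv_plus_of; first exact: (msub_invariant fI).
  by rewrite meval_quo_map quo_map0.
have h : ipow (inv_in rho H) plus 2 (msub f (P - clin 0 (mxdiff 0 P))).
  apply: (ipow_map (S := fun=> True) (J := vanish 0)) => //; first exact: inv_subring.
    by move=> Q _; apply: (msub_invariant fI).
  by have := taylor 0 P; rewrite P0 mpolyC0 subr0.
have -> : \sum_j (mxdiff 0 P)^T 0 j *: f j = - msub f (P - clin 0 (mxdiff 0 P)).
  rewrite rmorphB /= ((quo_idealE f P).1 hP) sub0r opprK /clin (raddf_sum (msub f)).
  apply: eq_bigr => j _; rewrite /= linearZ /= rmorphB /= msubX msubC.
  by rewrite [(0 : 'rV[k]_m) 0 j]mxE mpolyC0 subr0 [in LHS]mxE.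
have plusM a b : plus a -> b \in invariant rho H -> plus (a * b).
  move=> ha bI; apply: inv_plus_of; first exact: rpredM (inv_plus_inv ha) bI.
  by rewrite mevalM (pos_part_eval0 ha) mul0r.
rewrite -mulN1r; apply: ideal_mulMl => [b hb|].
  by rewrite mulrC; apply: plusM => //; rewrite rpredN rpred1.
apply: (ideal_mulS _ _ h) => // q; elim/ideal_mul_ind: q / => [|a b ha hb|a b ha hb].
- by exists [::]; rewrite ?big_nil.
- case: ha hb => s hs -> [t ht ->]; exists (s ++ t); last by rewrite big_cat.
  by move=> u; rewrite mem_cat => /orP[/hs|/ht].
exact: plusM.
Qed.

Lemma quo_ideal_pihomog D P : quo_ideal f P -> quo_ideal f (pihomog (wdeg e) D P).
Proof.
move/quo_idealE => P0; apply/quo_idealE.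
by rewrite -(pihomog_msub _ _ splitting_homog) P0 raddf0.
Qed.

End Splitting.

Lemma quo_ideal_ideal (k : fieldType) n m (f : 'I_m -> {mpoly k[n]}) : is_ideal (quo_ideal f).
Proof.
split=> [|P Q /quo_idealE hP /quo_idealE hQ|P Q /quo_idealE hQ]; apply/quo_idealE.
- exact: raddf0.
- by rewrite raddfD /= hP hQ addr0.
- by rewrite rmorphM /= hQ mulr0.
Qed.

(** * Invariant relations *)

Section ReflectionSets.
Variables (k : fieldType) (n : nat) (gT : finGroupType) (Wt : {group gT}).
Variable rho : mx_representation k Wt n.

Lemma iter_mx_repr g r (y : 'rV[k]_n) : g \in Wt ->
  iter r (fun v => v *m rho g) y = y *m rho (g ^+ r)%g.
Proof.
move=> gW; elim: r => [|r IH] /=; first by rewrite expg0 repr_mx1 mulmx1.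
by rewrite IH -mulmxA -repr_mxM ?groupX // expgSr.
Qed.

Lemma mxreflectionP g : g \in Wt ->
  is_reflection (fun v : 'rV[k]_n => v *m rho g) <-> mxreflection rho g.
Proof.
move=> gW; split=> [/is_reflection_mxP []//|h]; apply/is_reflection_mxP; split=> //.
exists #[g]%g => // v; rewrite iter_mx_repr // expg_order repr_mx1 mulmx1 //.
Qed.

Lemma reflectionsE (H : {set gT}) : H \subset Wt ->
  reflections H (fun g (v : 'rV[k]_n) => v *m rho g) =
  [set g in H | `[< mxreflection rho g >]].
Proof.
move=> sHW; apply/setP => g; rewrite !inE; case: (boolP (g \in H)) => //= gH.
by apply/asboolP/asboolP => /mxreflectionP; apply; apply: (subsetP sHW).
Qed.

Lemma is_reflection_group_repr (H : {group gT}) : H \subset Wt ->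
    {in H, forall g, rho g = 1%:M -> g = 1%g} ->
    <<[set g in H | `[< mxreflection rho g >]]>>%g = H ->
  is_reflection_group H (fun g (v : 'rV[k]_n) => v *m rho g).
Proof.
move=> sHW faith gen; split.
- by move=> g gH a u w; rewrite mulmxDl scalemxAl.
- split=> [u|g h gH hH u]; first by rewrite repr_mx1 mulmx1.
  by rewrite repr_mxM ?(subsetP sHW) // mulmxA.
- move=> g gH ug; apply: faith => //; apply/row_matrixP => i.
  by rewrite !rowE ug mulmx1.
by rewrite reflectionsE.
Qed.

Lemma reflection_group_faithful (H : {group gT}) :
  is_reflection_group H (fun g (v : 'rV[k]_n) => v *m rho g) ->
  {in H, forall g, rho g = 1%:M -> g = 1%g}.
Proof. by case=> _ _ faith _ g gH g1; apply: faith => // u; rewrite g1 mulmx1. Qed.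

Lemma reflection_group_gen (H : {group gT}) : H \subset Wt ->
  is_reflection_group H (fun g (v : 'rV[k]_n) => v *m rho g) ->
  <<[set g in H | `[< mxreflection rho g >]]>>%g = H.
Proof. by move=> sHW [_ _ _]; rewrite reflectionsE. Qed.

End ReflectionSets.

Section QuotientAction.
Variables (k : fieldType) (n : nat) (d : 'I_n -> nat) (gT : finGroupType).
Variables (Wt G : {group gT}) (rho : mx_representation k Wt n).
Variables (m : nat) (e : 'I_m -> nat) (f : 'I_m -> {mpoly k[n]}).
Variable rV : mx_representation k (Wt / G)%g m.
Hypothesis hk : [pchar k] =i pred0.
Hypothesis hgrad : {in Wt, forall g, GLgrad d (rho g)}.
Hypothesis hnorm : (G <| Wt)%g.
Hypothesis hf : is_splitting d rho G e f.
Hypothesis hV : is_quo_action rho Wt f rV.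

Lemma sGW_norm : G \subset Wt. Proof. exact: normal_sub hnorm. Qed.
Lemma sWN : Wt \subset 'N(G)%g. Proof. exact: normal_norm hnorm. Qed.

Lemma coset_in g : g \in Wt -> coset G g \in (Wt / G)%g.
Proof. exact: mem_quotient. Qed.

Lemma quoP w : w \in (Wt / G)%g -> exists2 g, g \in Wt & w = coset G g.
Proof. by case/morphimP => g _ gW ->; exists g. Qed.

Lemma msub_quo_action g P : g \in Wt ->
  msub f (mx_subst (rV (coset G g)) P) = mx_subst (rho g) (msub f P).
Proof.
move=> gW; rewrite mx_subst_msub mx_substE msub_msub; apply: eq_msub => j.
rewrite hV // raddf_sum; apply: eq_bigr => i _ /=.
by rewrite linearZ /= msubX.
Qed.

Lemma quo_map_action g y : g \in Wt -> quo_map f (y *m rho g) = quo_map f y *m rV (coset G g).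
Proof.
move=> gW; apply/rowP => j; rewrite !mxE -mx_subst_eval hV // raddf_sum.
by apply: eq_bigr => i _ /=; rewrite mevalZ !mxE mulrC.
Qed.

Lemma quo_ideal_action w P : w \in (Wt / G)%g ->
  quo_ideal f P -> quo_ideal f (mx_subst (rV w) P).
Proof.
case/quoP => g gW -> /quo_idealE P0; apply/quo_idealE.
by rewrite msub_quo_action // P0 raddf0.
Qed.

Lemma quo_action_weights w i j : w \in (Wt / G)%g -> rV w i j != 0 -> e i = e j.
Proof.
case/quoP => g gW ->; set M := rV _ => Mij.
have fh l : f l \is (e l).-homog for (wdeg d).
  by have := splitting_homog hf l; rewrite /= wdegU.
have E := hV gW j; rewrite -/M in E.
have h1 : pihomog (wdeg d) (e j) (mx_subst (rho g) (f j)) = mx_subst (rho g) (f j).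
  by rewrite (pihomog_mx_subst hk) ?pihomog_dE //; apply: hgrad.
have : \sum_l (M l j - (e l == e j)%:R * M l j) *: f l = 0.
  apply/eqP; rewrite (eq_bigr (fun l => M l j *: f l - ((e l == e j)%:R * M l j) *: f l)).
    rewrite sumrB subr_eq0 -E -h1 E (raddf_sum (pihomog (wdeg d) (e j))); apply/eqP.
    apply: eq_bigr => l _; rewrite /= linearZ /=.
    have [el|ne] := eqVneq (e l) (e j); first by rewrite mul1r pihomog_dE // -el.
    by rewrite (pihomog_ne0 ne) // mul0r scale0r scaler0.
  by move=> l _; rewrite scalerBl.
move/(splitting_free hf)/(_ i); have [//|ne] := eqVneq (e i) (e j).
by rewrite mul0r subr0 => /eqP; rewrite (negPf Mij).
Qed.

Lemma dhomog_quo_action w D P : w \in (Wt / G)%g ->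
  P \is D.-homog for (wdeg e) -> mx_subst (rV w) P \is D.-homog for (wdeg e).
Proof.
move=> hw; rewrite mx_substE; apply: dhomog_msub => j; apply: rpred_sum => i _.
have [->|Mij] := eqVneq (rV w i j) 0; first by rewrite scale0r rpred0.
by apply: rpredZ; rewrite dhomogX /= !wdegU (quo_action_weights hw Mij).
Qed.

Hypothesis htriv : acts_trivially_on_relations Wt e f rV.
Hypothesis hci : is_complete_intersection f.

Lemma invariant_relations : exists r (h : 'I_r -> {mpoly k[m]}),
  [/\ (r + n <= m)%N, generates h (quo_ideal f)
    & {in (Wt / G)%g, forall w i, mx_subst (rV w) (h i) = h i}].
Proof.
have idI := quo_ideal_ideal f; have [I0 ID IM] := idI.
have epos := splitting_pos hf.
have augI := aug_mul_ideal idI; have [a0 aD aM] := augI.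
have [r rn [[q0 gq0] _]] := hci.
have Iq0 i : quo_ideal f (q0 i).
  apply/gq0; exists (fun j => (j == i)%:R); rewrite (bigD1 i) //= eqxx mul1r.
  by rewrite big1 ?addr0 // => j /negPf ->; rewrite mul0r.
have span0 : spans_mod (quo_ideal f) q0.
  move=> P /gq0 [c ->]; exists (fun i => (c i).@[(0 : 'rV[k]_m) 0]).
  rewrite -sumrB; apply: ideal_sum => // i _.
  rewrite -mul_mpolyC -mulrBl; apply: aug_mulM => //.
  by rewrite mevalB mevalC subrr.
(* Homogeneity is secured before averaging, so that the averages are homogeneous and [nakayama]
   applies to them. *)
have [N Nr [q [Iq hq gq]]] := homogeneous_generators epos idI
  (fun D P => @quo_ideal_pihomog _ _ _ _ _ _ _ _ _ _ hf D P) Iq0 span0.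
have c0 : #|(Wt / G)%g|%:R != 0 :> k by rewrite pnatr_neq0 // cardG_gt0.
pose h i := #|(Wt / G)%g|%:R^-1 *: trace rV (Wt / G)%G (q i).
have Ih i : quo_ideal f (h i).
  apply: idealZ => //; apply: ideal_sum => // w hw.
  exact: quo_ideal_action.
have hhom i : exists D, h i \is D.-homog for (wdeg e).
  have [D hD] := hq i; exists D; apply: rpredZ; apply: rpred_sum => w hw.
  exact: dhomog_quo_action.
have hinv : {in (Wt / G)%g, forall w i, mx_subst (rV w) (h i) = h i}.
  move=> w hw i; rewrite linearZ /=; congr (_ *: _).
  by apply/(invariantP rV): w hw; apply: trace_invariant.
exists N, h; split=> //; first by rewrite -rn leq_add2r.
apply: (nakayama epos idI) => //.
move=> P IP; have [c cE] := (gq P).1 IP.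
exists (fun i => (c i).@[(0 : 'rV[k]_m) 0]).
rewrite {1}cE -sumrB; apply: ideal_sum => // i _.
set ci := (c i).@[_].
have -> : c i * q i - ci *: h i = (c i - ci%:MP) * q i + ci *: (q i - h i).
  by rewrite -!mul_mpolyC; ring.
apply: aD.
  by apply: aug_mulM => //; rewrite mevalB mevalC subrr.
apply: idealZ => //.
have -> : q i - h i = - (#|(Wt / G)%g|%:R^-1 *: \sum_(w in (Wt / G)%g) (mx_subst (rV w) (q i) - q i)).
  rewrite sumrB sumr_const -[q i *+ _]scaler_nat scalerBr scalerA mulVf // scale1r.
  by rewrite opprB.
apply: idealN => //; apply: idealZ => //; apply: ideal_sum => // w hw.
by apply/(aug_mulP epos idI); apply: htriv.
Qed.

End QuotientAction.

(** * Images of reflections *)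

Section Unipotent.
Variables (k : fieldType) (n : nat) (gT : finGroupType) (Wt : {group gT}).
Variable rho : mx_representation k Wt n.
Hypothesis hk : [pchar k] =i pred0.

(** If [D = (g - 1) c] is fixed by [g], then [g ^ j] sends [c] to [c + j D]; at the order of [g]
    this gives [D = 0] in characteristic 0. *)
Lemma unipotent_col g (c : 'cV[k]_n) : g \in Wt ->
  (rho g - 1%:M) *m ((rho g - 1%:M) *m c) = 0 -> (rho g - 1%:M) *m c = 0.
Proof.
move=> gW; set D := _ *m c => hD.
have gD : rho g *m D = D by apply/eqP; rewrite -subr_eq0 -{2}[D]mul1mx -mulmxBl hD.
have gc : rho g *m c = c + D by rewrite /D mulmxBl mul1mx addrC subrK.
have gj j : rho (g ^+ j)%g *m c = c + j%:R *: D.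
  elim: j => [|j IH]; first by rewrite expg0 repr_mx1 mul1mx scale0r addr0.
  rewrite expgS repr_mxM ?groupX // -mulmxA IH mulmxDr gc -scalemxAr gD.
  by rewrite -natr1 scalerDl scale1r -addrA [D + _]addrC.
have := gj #[g]%g; rewrite expg_order repr_mx1 mul1mx => /eqP.
rewrite addrC -subr_eq subrr eq_sym scaler_eq0.
by rewrite (negPf (pnatr_neq0 hk (order_gt0 g))) => /eqP.
Qed.

Lemma unipotent_row g (c : 'rV[k]_n) : g \in Wt ->
  c *m (rho g - 1%:M) *m (rho g - 1%:M) = 0 -> c *m (rho g - 1%:M) = 0.
Proof.
move=> gW; set D := c *m _ => hD.
have gD : D *m rho g = D by apply/eqP; rewrite -subr_eq0 -{2}[D]mulmx1 -mulmxBr hD.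
have gc : c *m rho g = c + D by rewrite /D mulmxBr mulmx1 addrC subrK.
have gj j : c *m rho (g ^+ j)%g = c + j%:R *: D.
  elim: j => [|j IH]; first by rewrite expg0 repr_mx1 mulmx1 scale0r addr0.
  rewrite expgSr repr_mxM ?groupX // mulmxA IH mulmxDl gc -scalemxAl gD.
  by rewrite -natr1 scalerDl scale1r -addrA [D + _]addrC.
have := gj #[g]%g; rewrite expg_order repr_mx1 mulmx1 => /eqP.
rewrite addrC -subr_eq subrr eq_sym scaler_eq0.
by rewrite (negPf (pnatr_neq0 hk (order_gt0 g))) => /eqP.
Qed.

End Unipotent.

(** * Pointwise stabilisers of hyperplanes *)

Section HyperplaneStabilizer.
Variables (k : fieldType) (n : nat) (gT : finGroupType) (Wt : {group gT}).
Variable rho : mx_representation k Wt n.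
Hypothesis hk : [pchar k] =i pred0.
Hypothesis faithW : {in Wt, forall g, rho g = 1%:M -> g = 1%g}.
Variables (a : 'cV[k]_n) (C : {group gT}).
Hypothesis a0 : a != 0.
Hypothesis sCW : C \subset Wt.
Hypothesis Ca : {in C, forall c, exists w : 'rV[k]_n, rho c = 1%:M + a *m w}.

Local Notation act g := (mx_subst (rho g)).

(** The scalar by which [c] multiplies the normal form is multiplicative in [c]. If it is 1 then
    [rho c - 1] has square 0, so [c] is trivial by [unipotent_row]. *)
Lemma hyperplane_character : exists chi : gT -> k,
  [/\ {in C, forall c, act c (lin a) = chi c *: lin a}, {in C &, injective chi}
    & {in C, forall c, chi c != 0}].
Proof.
have /fin_all_exists [w wP] (c : gT) : exists w : 'rV[k]_n, c \in C -> rho c = 1%:M + a *m w.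
  by case: (boolP (c \in C)) => [/Ca [w h]|_]; [exists w | exists 0].
pose chi c := 1 + (w c *m a) 0 0.
have ca c : c \in C -> rho c *m a = chi c *: a.
  move=> cC; rewrite wP // mulmxDl mul1mx -mulmxA scalerDl scale1r; congr (_ + _).
  have -> : w c *m a = ((w c *m a) 0 0)%:M by apply/matrixP => i j; rewrite !ord1 [RHS]mxE.
  by rewrite mul_mx_scalar [in RHS]mxE mulr1n.
have chiM c c' : c \in C -> c' \in C -> chi (c * c')%g = chi c * chi c'.
  move=> cC c'C; have := ca _ (groupM cC c'C).
  rewrite repr_mxM ?(subsetP sCW) // -mulmxA ca // -scalemxAr ca // scalerA => /eqP.
  rewrite -subr_eq0 -scalerBl scaler_eq0 (negPf a0) orbF subr_eq0 => /eqP <-.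
  by rewrite mulrC.
have chi1 c : c \in C -> chi c = 1 -> c = 1%g.
  move=> cC c1; have cW := subsetP sCW c cC.
  have wa : w c *m a = 0.
    by apply/matrixP => i j; rewrite !ord1 [RHS]mxE; apply: (addrI 1); rewrite addr0.
  apply: faithW => //; apply/eqP; rewrite -subr_eq0; apply/eqP/row_matrixP => i.
  rewrite row0 rowE; apply: (unipotent_row hk cW).
  have -> : rho c - 1%:M = a *m w c by rewrite wP // addrC addKr.
  by rewrite -!mulmxA [w c *m _]mulmxA wa mul0mx !mulmx0.
have chi11 : chi 1%g = 1.
  have /eqP := ca 1%g (group1 C); rewrite repr_mx1 mul1mx -{1}[a]scale1r -subr_eq0 -scalerBl.
  by rewrite scaler_eq0 (negPf a0) orbF subr_eq0 => /eqP.
have chi0 c : c \in C -> chi c != 0.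
  move=> cC; apply/eqP => c0; have := chiM c c^-1%g cC.
  by rewrite groupV cC mulgV chi11 c0 mul0r => /(_ isT) /eqP; rewrite oner_eq0.
exists chi; split=> // [c cC|c c' cC c'C e].
  by rewrite mx_subst_lin ca // linearZ.
apply/eqP; rewrite eq_mulgV1; apply/eqP/chi1; first by rewrite groupM ?groupV.
apply: (mulIf (chi0 c' c'C)); rewrite -chiM ?groupM ?groupV // mulgKV mul1r //.
Qed.

(** A scalar multiple of [lin a ^+ #|C|], written as a norm to make its invariance evident. *)
Definition hyperplane_norm : {mpoly k[n]} := \prod_(c in C) act c (lin a).

Lemma hyperplane_norm_inv : hyperplane_norm \in invariant rho C.
Proof.
apply/invariantP => h hC; rewrite rmorph_prod [RHS](reindex_inj (mulgI h)) /=.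
apply: eq_big => g; first by rewrite groupMl.
by move=> gC; rewrite mx_subst_rM ?(subsetP sCW).
Qed.

Lemma hyperplane_norm_neq0 : hyperplane_norm != 0.
Proof.
apply/prodf_neq0 => c cC; apply: contraNneq a0 => h.
by rewrite -lin_eq0 -(mx_subst_rK rho (lin a) (subsetP sCW c cC)) h raddf0.
Qed.

(* An invariant vanishing on the hyperplane vanishes there to order |C|, since *)
(* C acts on the normal coordinate through a faithful character.              *)
Lemma hyperplane_norm_dvd q : q \in invariant rho C -> mdvd (lin a) q ->
  exists2 r, r \in invariant rho C & q = hyperplane_norm * r.
Proof.
move=> qI adq; have [chi [chiE chi_inj chi0]] := hyperplane_character.
have la0 : lin a != 0 by rewrite lin_eq0.
have dv j : (0 < j)%N -> (j <= #|C|)%N -> mdvd (lin a ^+ j) q.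
  elim: j => [//|[|j] IH] _ jC; first by rewrite expr1.
  have [|b qE] := IH isT; first exact: ltnW.
  (* The [#|C|] distinct values of [chi] cannot all be roots of a polynomial of degree
     [j.+1 < #|C|]. *)
  have [c cC cj] : exists2 c, c \in C & chi c ^+ j.+1 != 1.
    apply: contrapT => H; move: jC; rewrite ltnNge => /negP; apply.
    pose p : {poly k} := 'X^(j.+1) - 1.
    have p0 : p != 0 by rewrite -size_poly_gt0 size_XnsubC.
    have rp : all (root p) [seq chi c | c <- enum C].
      apply/allP => _ /mapP [c + ->]; rewrite mem_enum => cC.
      rewrite rootE !hornerE subr_eq0; apply/eqP; apply: contrapT => ne.
      by apply: H; exists c => //; apply/eqP.
    have := max_poly_roots p0 rp; rewrite size_XnsubC // size_map -cardE ltnS; apply.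
    rewrite map_inj_in_uniq ?enum_uniq // => c c'; rewrite !mem_enum; exact: chi_inj.
  have cW := subsetP sCW c cC.
  have [w rc] := Ca cC.
  have hb : mdvd (lin a) (act c b - b) by rewrite rc; apply: mdvd_transvection.
  have e : (chi c ^+ j.+1) *: act c b = b.
    have aj : lin a ^+ j.+1 != 0 by apply: expf_neq0.
    apply: (mulfI aj); rewrite -qE -[RHS](invariantP _ _ _ qI c cC) qE rmorphM rmorphXn /=.
    by rewrite chiE // exprZn -scalerAl -scalerAr.
  (* Invariance of [q] makes [c] act on the cofactor [b] by a scalar other than 1, whereas it acts
     trivially modulo [lin a]; so [lin a] divides [b]. *)
  have /(idealZ ((chi c ^+ j.+1 - 1)^-1) (mdvd_ideal _)) :
      mdvd (lin a) ((chi c ^+ j.+1 - 1) *: b).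
    have -> : (chi c ^+ j.+1 - 1) *: b = - (chi c ^+ j.+1 *: (act c b - b)).
      by rewrite scalerBr e scalerBl scale1r opprB.
    by apply: idealN; [exact: mdvd_ideal | apply: idealZ => //; exact: mdvd_ideal].
  rewrite scalerA mulVf ?subr_eq0 // scale1r => -[b' bE].
  by exists b'; rewrite qE bE mulrA -exprSr.
have [b qE] := dv _ (cardG_gt0 C) (leqnn _).
pose s := \prod_(c in C) chi c.
have s0 : s != 0 by apply/prodf_neq0 => c; apply: chi0.
have piE : hyperplane_norm = s *: lin a ^+ #|C|.
  rewrite /hyperplane_norm (eq_bigr (fun c => chi c *: lin a)) => [|c /chiE //].
  by rewrite scaler_prod prodr_const.
have qr : q = hyperplane_norm * (s^-1 *: b).
  by rewrite piE -scalerAl -scalerAr scalerA mulfV // scale1r.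
exists (s^-1 *: b) => //; apply/invariantP => c cC.
apply: (mulfI hyperplane_norm_neq0); rewrite -qr -[RHS](invariantP _ _ _ qI c cC) [in RHS]qr.
by rewrite rmorphM /= (invariantP _ _ _ hyperplane_norm_inv c cC).
Qed.

End HyperplaneStabilizer.

Lemma col_eq (k : fieldType) m n (A B : 'M[k]_(m, n)) :
  (forall j, A *m delta_mx j 0 = B *m delta_mx j (0 : 'I_1)) -> A = B.
Proof.
by move=> AB; apply/matrixP => i j; have /colP/(_ i) := AB j; rewrite -!colE !mxE.
Qed.

Section GoodQuotient.
Variables (k : fieldType) (n : nat) (gT : finGroupType).
Variables (Wt G : {group gT}) (rho : mx_representation k Wt n).
Hypothesis hk : [pchar k] =i pred0.
Hypothesis faithW : {in Wt, forall g, rho g = 1%:M -> g = 1%g}.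
Hypothesis hnorm : (G <| Wt)%g.
Variables (m : nat) (f : 'I_m -> {mpoly k[n]}).
Hypothesis fI : forall j, f j \in invariant rho G.
Hypothesis fgen : forall p, p \in invariant rho G -> exists P, msub f P = p.
Variable rV : mx_representation k (Wt / G)%g m.
Hypothesis hV : is_quo_action rho Wt f rV.
Variables (r : nat) (h : 'I_r -> {mpoly k[m]}).
Hypothesis gh : generates h (quo_ideal f).
Hypothesis hinv : {in (Wt / G)%g, forall w i, mx_subst (rV w) (h i) = h i}.

Let sGW : G \subset Wt := sGW_norm hnorm.

Lemma gen_relations i : quo_ideal f (h i).
Proof.
apply/gh; exists (fun j => (j == i)%:R); rewrite (bigD1 i) //= eqxx mul1r.
by rewrite big1 ?addr0 // => j /negPf ->; rewrite mul0r.
Qed.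

Lemma mxdiff_relations y P : quo_ideal f P -> exists a : 'I_r -> k,
  mxdiff (quo_map f y) P = \sum_i a i *: mxdiff (quo_map f y) (h i).
Proof.
move=> /gh [a ->]; exists (fun i => (a i).@[(quo_map f y) 0]).
rewrite raddf_sum; apply: eq_bigr => i _ /=; rewrite mxdiffM.
by rewrite (quo_ideal_vanish y (gen_relations i)) scale0r addr0.
Qed.

Lemma mxdiff_fixed y w P : w \in rstab rV (quo_map f y) -> quo_ideal f P ->
  rV w *m mxdiff (quo_map f y) P = mxdiff (quo_map f y) P.
Proof.
case/rstabP => hw vw /(mxdiff_relations y) [a ->]; rewrite mulmx_sumr.
apply: eq_bigr => i _; rewrite -scalemxAr; congr (_ *: _).
by rewrite -{2}(hinv hw i) mxdiff_mx_subst vw.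
Qed.

Lemma quo_stab y g : g \in rstab rho y -> coset G g \in rstab rV (quo_map f y).
Proof.
case/rstabP => gW yg; apply/rstabP; split; first exact: coset_in.
by rewrite -(quo_map_action hV) // yg.
Qed.

(** Otherwise an invariant separates the two orbits: average a product that is 1 at [y] and 0 at all
    other points of both orbits. Its trace at [y] is the order of the stabiliser. *)
Lemma quo_map_fiber (y y' : 'rV[k]_n) : quo_map f y = quo_map f y' ->
  exists2 g, g \in G & y' = y *m rho g.
Proof.
move=> e; apply: contrapT => H.
have [|q [qy q0]] := @interpolation k n y [seq y' *m rho g | g <- enum G].
  apply/negP => /mapP [g]; rewrite mem_enum => gG ye; apply: H; exists g^-1%g; rewrite ?groupV //.
  by rewrite ye repr_mxK // (subsetP sGW).
have [q1 [q1y q10]] : exists q1 : {mpoly k[n]}, q1.@[y 0] = 1 /\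
    (forall g, g \in G -> y *m rho g != y -> q1.@[(y *m rho g) 0] = 0).
  have [|q1 [q1y q10]] := @interpolation k n y [seq z <- [seq y *m rho g | g <- enum G] | z != y].
    by rewrite mem_filter eqxx.
  exists q1; split=> // g gG ne; apply: q10; rewrite mem_filter ne /=.
  by apply/map_f; rewrite mem_enum.
have [P PE] := fgen (trace_invariant rho (q * q1) sGW).
have := congr1 (meval ((quo_map f y) 0)) (erefl P); rewrite {2}e -!meval_quo_map PE.
rewrite !raddf_sum /= [RHS]big1 => [|g gG]; last first.
  rewrite mx_subst_eval mevalM q0 ?mul0r //; apply/map_f; rewrite mem_enum //.
rewrite (bigID (mem (rstab rho y))) /= [X in _ + X]big1 ?addr0; last first.
  move=> g /andP[gG gy]; rewrite mx_subst_eval mevalM q10 ?mulr0 //.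
  by apply: contra gy => /eqP yg; apply/rstabP; rewrite (subsetP sGW).
rewrite (eq_bigr (fun=> 1)) => [|g /andP[gG /rstabP [_ yg]]]; last first.
  by rewrite mx_subst_eval yg mevalM qy q1y mulr1.
rewrite sumr_const => /eqP; rewrite (negPf (pnatr_neq0 hk _)) //.
by apply/card_gt0P; exists 1%g; rewrite unfold_in /= !group1.
Qed.

(** If [g] acts trivially on V, it moves a point with trivial stabiliser inside its [G]-orbit, hence
    coincides with an element of [G]. *)
Lemma quo_faithful : {in (Wt / G)%g, forall w, rV w = 1%:M -> w = 1%g}.
Proof.
move=> w /quoP [g gW ->] g1; apply: coset_id.
have [y yP] := generic_free_point hk faithW.
have [|u uG yu] := @quo_map_fiber y (y *m rho g).
  by rewrite (quo_map_action hV) // g1 mulmx1.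
have uW := subsetP sGW u uG.
suff -> : g = u by [].
apply/eqP; rewrite eq_mulgV1; apply/eqP/yP/rstabP.
by rewrite groupM ?groupV // repr_mxM ?groupV // mulmxA yu repr_mxK.
Qed.

Lemma msub_clin_action y g c : g \in rstab rho y ->
  mx_subst (rho g) (msub f (clin (quo_map f y) c)) =
  msub f (clin (quo_map f y) (rV (coset G g) *m c)).
Proof.
move=> gy; have /rstabP [gW yg] := gy; have /rstabP [_ vg] := quo_stab gy.
set v := quo_map f y in vg *.
have clinE b : clin v b = lin b - ((v *m b) 0 0)%:MP.
  rewrite /clin /lin; under eq_bigr => i _ do rewrite scalerBr.
  rewrite sumrB; congr (_ - _); rewrite mxE rmorph_sum; apply: eq_bigr => i _ /=.
  by rewrite -mul_mpolyC mulrC -mpolyCM.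
rewrite -(msub_quo_action hV) // !clinE; congr (msub f _).
by rewrite rmorphB /= mx_subst_lin mx_substE msubC mulmxA vg.
Qed.

Lemma reflection_image s : s \in Wt -> mxreflection rho s ->
  rV (coset G s) = 1%:M \/ mxreflection rV (coset G s).
Proof.
move=> sW [a [w0 [a0 w00 sE]]].
have [y ya yP] := generic_hyperplane_point hk faithW a0.
pose C := (G :&: rstab rho y)%G.
have sCW : C \subset Wt by rewrite subIset // sGW.
have sy : s \in rstab rho y.
  by apply/rstabP; rewrite sE mulmxDr mulmx1 mulmxA ya mul0mx addr0.
have Ca : {in C, forall c, exists w : 'rV[k]_n, rho c = 1%:M + a *m w}.
  move=> c /setIP [_ cy]; have [->|c1] := eqVneq c 1%g.
    by exists 0; rewrite repr_mx1 mulmx0 addr0.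
  by have [w _ cE] := yP c cy c1; exists w.
have piI := hyperplane_norm_inv rho a sCW.
have pi0 := hyperplane_norm_neq0 rho a0 sCW.
set pi := hyperplane_norm rho a C in piI pi0.
set v := quo_map f y; set M := rV (coset G s).
pose p c := msub f (clin v c).
have pI c : p c \in invariant rho C.
  by apply: (invariantS (subsetIl G (rstab rho y))); exact: (msub_invariant fI).
have sp c : mx_subst (rho s) (p c) - p c = p ((M - 1%:M) *m c).
  rewrite /p msub_clin_action // -/M -/v.
  by rewrite mulmxBl mul1mx [clin v (_ - _)]raddfB /= rmorphB.
have piy : pi.@[y 0] = 0.
  rewrite rmorph_prod (bigD1 1%g) //= (mx_subst_r1 rho) linE ya mxE mul0r //.
have piM : inv_max rho y C pi by split.
(* Here [pi * t] is in the square of the maximal ideal at [y], so the column is the gradient of a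
   relation and is fixed by [M]; [unipotent_col] concludes. *)
have key c t : t \in invariant rho C -> t.@[y 0] = 0 ->
    p ((M - 1%:M) *m c) = pi * t -> (M - 1%:M) *m c = 0.
  move=> tI t0 e.
  have hc : ipow (inv_in rho C) (inv_max rho y C) 2 (p ((M - 1%:M) *m c)).
    by rewrite e; apply: ipow2 => //; apply: rpred1.
  have [P IP PE] := cot_ker hk sGW fI fgen hc.
  apply: (unipotent_col hk); first exact: coset_in.
  by rewrite -PE mulmxBl mul1mx mxdiff_fixed ?subrr //; apply: quo_stab.
have /choice [t tP] : forall c, exists t, t \in invariant rho C /\
    p ((M - 1%:M) *m c) = pi * t.
  move=> c; have [||t tI tE] := hyperplane_norm_dvd hk faithW a0 sCW Ca (q := p ((M - 1%:M) *m c)).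
  - exact: pI.
  - by rewrite -sp sE; apply: mdvd_transvection.
  by exists t.
pose lam c := (t c).@[y 0].
(* The combination of the cofactors with these coefficients vanishes at [y], so [key] applies; the
   images of [M - 1] are therefore proportional. *)
have key2 c c' : lam c' *: ((M - 1%:M) *m c) = lam c *: ((M - 1%:M) *m c').
  apply/eqP; rewrite -subr_eq0 !scalemxAr -mulmxBr; apply/eqP.
  have [tI tE] := tP c; have [tI' tE'] := tP c'.
  apply: (key _ (lam c' *: t c - lam c *: t c')).
  - exact: rpredB (rpredZ _ tI) (rpredZ _ tI').
  - by rewrite mevalB !mevalZ /lam mulrC subrr.
  rewrite mulmxBr -!scalemxAr /p [clin v _]raddfB /= [msub f _]raddfB /= !linearZ /=.
  by rewrite -/(p _) -/(p _) tE tE' mulrDr -!scalerAr mulrN.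
have [[c lc]|lam0] := EM (exists c, lam c != 0); last first.
  left; apply/subr0_eq/col_eq => j; rewrite mul0mx.
  have [tI tE] := tP (delta_mx j 0); apply: key tI _ tE; apply: contrapT => ne.
  by apply: lam0; exists (delta_mx j 0); apply/eqP.
pose u := (M - 1%:M) *m c; pose w := \row_j (lam (delta_mx j 0) / lam c).
have ME : M = 1%:M + u *m w.
  rewrite addrC; apply/(canRL (subrK _))/col_eq => j.
  have := key2 (delta_mx j 0) c; rewrite -/u => /(canRL (scalerK lc)) ->.
  have wj : w *m delta_mx j (0 : 'I_1) = (lam (delta_mx j 0) / lam c)%:M.
    by rewrite -colE; apply/matrixP => i l; rewrite !ord1 !mxE.
  by rewrite -mulmxA wj mul_mx_scalar scalerA mulrC.
have [u0|u0] := eqVneq u 0; first by left; rewrite ME u0 mul0mx addr0.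
have [w1|w1] := eqVneq w 0; first by left; rewrite ME w1 mulmx0 addr0.
by right; exists u, w.
Qed.

End GoodQuotient.

(** * The reflection group of the stabiliser *)

Section SemisimpleRank.
Variables (k : fieldType) (n : nat) (gT : finGroupType) (Wt : {group gT}).
Variable rho : mx_representation k Wt n.
Hypothesis hk : [pchar k] =i pred0.

(** [rho g - 1] and its square have the same kernel, hence the same row space. This moves questions
    on V into the subspace of displacements, which is tangent by [tau_image]. *)
Lemma semisimple_image g : g \in Wt ->
  exists Z, rho g - 1%:M = Z *m (rho g - 1%:M) *m (rho g - 1%:M).
Proof.
move=> gW; set D := rho g - 1%:M.
suff /submxP [Z DE] : (D <= D *m D)%MS by exists Z; rewrite -mulmxA.
have le : (kermx (D *m D) <= kermx D)%MS.
  apply/sub_kermxP/row_matrixP => i; rewrite row0 row_mul.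
  apply: (unipotent_row hk gW); rewrite -/D -mulmxA -row_mul mulmx_ker row0 //.
have := mxrankS le; rewrite !mxrank_ker leq_sub2lE ?rank_leq_row // => rk.
by rewrite -(geq_leqif (mxrank_leqif_sup (submxMl D D))).
Qed.

End SemisimpleRank.

Section TangentReflections.
Variables (k : fieldType) (n : nat) (gT : finGroupType).
Variables (Wt G : {group gT}) (rho : mx_representation k Wt n).
Hypothesis hk : [pchar k] =i pred0.
Hypothesis faithW : {in Wt, forall g, rho g = 1%:M -> g = 1%g}.
Hypothesis hnorm : (G <| Wt)%g.
Variables (m : nat) (f : 'I_m -> {mpoly k[n]}).
Hypothesis fI : forall j, f j \in invariant rho G.
Hypothesis fgen : forall p, p \in invariant rho G -> exists P, msub f P = p.
Variable rV : mx_representation k (Wt / G)%g m.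
Hypothesis hV : is_quo_action rho Wt f rV.
Variables (r : nat) (h : 'I_r -> {mpoly k[m]}).
Hypothesis gh : generates h (quo_ideal f).
Hypothesis hinv : {in (Wt / G)%g, forall w i, mx_subst (rV w) (h i) = h i}.
Variable x : 'rV[k]_n.

Let sGW : G \subset Wt := sGW_norm hnorm.
Local Notation Wtx := (rstab_group rho x).
Local Notation Gx := (G :&: Wtx)%G.
Local Notation Wpx := (rstab_group rV (quo_map f x)).
Local Notation tau := (@tangent_map k n gT rho Gx x m f).
Local Notation tact := (@tangent_quo_act k n gT rho Gx x).

Lemma sWtxW : Wtx \subset Wt. Proof. exact: rstab_sub. Qed.

Lemma normal_Gx : (Gx <| Wtx)%g.
Proof.
rewrite /normal subsetIr /=; apply/subsetP => g gx.
rewrite inE; apply/subsetP => _ /imsetP [c /setIP [cG cx] ->].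
rewrite inE; apply/andP; split; last exact: groupJ.
by rewrite memJ_norm // (subsetP (normal_norm hnorm)) // (subsetP sWtxW).
Qed.

Definition quo_stab_map (c : coset_of Gx) : coset_of G := coset G (repr c).

Lemma repr_coset_stab g : g \in Wtx ->
  repr (coset Gx g) \in Wtx /\ coset G (repr (coset Gx g)) = coset G g.
Proof.
move=> gx; have gN := subsetP (normal_norm normal_Gx) g gx.
have := mem_repr_coset (coset Gx g); rewrite val_coset // => /rcosetP [u uGx ->].
have /setIP [uG ux] := uGx; split; first exact: groupM.
by rewrite coset_kerl.
Qed.

Lemma quo_stab_mapE g : g \in Wtx -> quo_stab_map (coset Gx g) = coset G g.
Proof. by case/repr_coset_stab. Qed.

Lemma stab_quoP c : c \in (Wtx / Gx)%g -> exists2 g, g \in Wtx & c = coset Gx g.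
Proof. by case/morphimP => g _ gx ->; exists g. Qed.

Lemma quo_stab_map_in c : c \in (Wtx / Gx)%g -> quo_stab_map c \in Wpx.
Proof. by case/stab_quoP => g gx ->; rewrite quo_stab_mapE //; exact: (quo_stab hV). Qed.

Lemma quo_stab_mapM : {in (Wtx / Gx)%g &, {morph quo_stab_map : c c' / (c * c')%g}}.
Proof.
move=> _ _ /stab_quoP [g gx ->] /stab_quoP [g' gx' ->].
have N := subsetP (normal_norm normal_Gx); have N' := subsetP (normal_norm hnorm).
have sx := subsetP sWtxW.
rewrite -morphM ?N // !quo_stab_mapE ?groupM //=.
by rewrite morphM; [| exact: N' (sx _ gx) | exact: N' (sx _ gx')].
Qed.

Lemma quo_stab_map_inj : {in (Wtx / Gx)%g &, injective quo_stab_map}.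
Proof.
move=> _ _ /stab_quoP [g gx ->] /stab_quoP [g' gx' ->].
have N := subsetP (normal_norm normal_Gx); have N' := subsetP (normal_norm hnorm).
have sx := subsetP sWtxW.
rewrite !quo_stab_mapE // => /eqP; rewrite eq_mulgV1 => /eqP e.
apply/eqP; rewrite eq_mulgV1 -morphV ?N // -morphM ?groupV ?N //=; apply/eqP/coset_id.
rewrite inE [X in _ && X]groupM ?groupV // andbT.
apply: coset_idr; first by rewrite groupM ?groupV ?N' ?sx.
by rewrite morphM ?groupV ?N' ?sx // morphV ?N' ?sx.
Qed.

(** A representative moves [x] within the fibre of p(x), a [G]-orbit, and can be corrected by an
    element of [G]. *)
Lemma quo_stab_surj w : w \in Wpx -> exists2 g, g \in Wtx & w = coset G g.
Proof.
case/rstabP => /quoP [g gW ->] xg.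
have [|u uG xu] := @quo_map_fiber _ _ _ _ _ _ hk hnorm _ _ fgen x (x *m rho g).
  by rewrite (quo_map_action hV).
have uW := subsetP sGW u uG.
exists (g * u^-1)%g.
  by apply/rstabP; rewrite groupM ?groupV // repr_mxM ?groupV // mulmxA xu repr_mxK.
have N' := subsetP (normal_norm hnorm).
rewrite morphM ?groupV ?N' //= morphV ?N' //=.
by rewrite [coset G u]coset_id // invg1 mulg1.
Qed.

Lemma tau_linear : linear tau.
Proof. by move=> a D E; apply/rowP => j; rewrite !mxE. Qed.
HB.instance Definition _ :=
  GRing.isLinear.Build k (tangent rho Gx x) 'rV[k]_m _ tau tau_linear.

Lemma tau_inj : injective tau.
Proof. exact: (tangent_map_inj hk sGW fI fgen). Qed.

Lemma tau_act c D : c \in (Wtx / Gx)%g -> tau (tact c D) = tau D *m rV (quo_stab_map c).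
Proof.
case/stab_quoP => g0 g0x ->; rewrite /tangent_quo_act /quo_stab_map.
have [gx _] := repr_coset_stab g0x; move: (repr _) gx => g gx.
have /rstabP [gW xg] := gx.
have gN := subsetP (normal_norm normal_Gx) g gx.
have fx j : f j \in invariant rho Gx by apply: sub_invGx.
have sGxW : Gx \subset Wt by rewrite subIset // sGW.
apply/rowP => j; rewrite [LHS]mxE.
have fjI := invariant_mx_subst sGxW gW gN (fx j).
rewrite (tangent_actE sGxW D gx gN (b' := insubd 0 (mx_subst (rho g) (f j)))).
  rewrite -/(tval D _) -[f j]msubX -(msub_quo_action hV) // (tval_msub fI).
  by rewrite mxdiff_mx_subst mxdiffX mulmxA -colE mxE.
by rewrite !insubdE.
Qed.

Lemma tau_iter c D j : c \in (Wtx / Gx)%g ->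
  tau (iter j (tact c) D) = tau D *m rV (quo_stab_map c ^+ j)%g.
Proof.
move=> hc; have /rstabP [hW _] := quo_stab_map_in hc.
elim: j => [|j IH]; first by rewrite expg0 repr_mx1 mulmx1.
by rewrite iterS tau_act // IH -mulmxA -repr_mxM ?groupX // expgSr.
Qed.

Lemma tact_linear c : c \in (Wtx / Gx)%g -> linear (tact c).
Proof.
move=> hc a D E; apply: tau_inj.
by rewrite tau_act // !linearP /= !tau_act // mulmxDl scalemxAl.
Qed.

Lemma tau_image w (y : 'rV[k]_m) : w \in Wpx ->
  exists D, tau D = y *m (rV w - 1%:M).
Proof.
move=> hw; apply: (tangent_map_exists hk sGW fI fgen) => P IP.
by rewrite -mulmxA mulmxBl mul1mx (mxdiff_fixed gh hinv) // subrr mulmx0.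
Qed.

Lemma tau_sub c D : c \in (Wtx / Gx)%g ->
  tau (tact c D - D) = tau D *m (rV (quo_stab_map c) - 1%:M).
Proof. by move=> hc; rewrite linearB /= tau_act // mulmxBr mulmx1. Qed.

(** All displacements of [w] on V lie in the tangent space, and by semisimplicity they are already
    displacements of tangent vectors; so the ranks of [w - 1] on both spaces agree. *)
Lemma tact_reflectionP c : c \in (Wtx / Gx)%g ->
  is_reflection (tact c) <-> mxreflection rV (quo_stab_map c).
Proof.
move=> hc; have wx := quo_stab_map_in hc; have /rstabP [wW _] := wx.
set w := quo_stab_map c in wx wW *.
split=> [[_ _ [th [D0 th0] thP]]|[a [b [a0 b0 wE]]]].
  pose E0 : tangent rho Gx x := tact c D0 - D0.
  pose sc D : k := (th D : k) / (th D0 : k).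
  have DE D : tact c D - D = sc D *: E0.
    have /thP : th (D - sc D *: D0) = 0.
      by rewrite linearB linearZ /= /GRing.scale /= /sc divfK // subrr.
    have -> : D - sc D *: D0 = - sc D *: D0 + D by rewrite addrC scaleNr.
    rewrite (tact_linear hc) => /subr0_eq e.
    have -> : tact c D = sc D *: tact c D0 + (- sc D *: D0 + D).
      by rewrite -e addrA -scalerDl subrr scale0r add0r.
    by rewrite -addrA addrK scaleNr -scalerBr.
  have e0 : tau E0 != 0.
    apply: contraNneq th0 => /eqP; rewrite -(raddf0 tau) => /eqP/tau_inj E00.
    by apply/eqP/thP.
  have [Z ZE] := semisimple_image rV hk wW.
  have line y : exists s : k, y *m (rV w - 1%:M) = s *: tau E0.
    have [D DE'] := tau_image (y *m Z) wx.
    exists (sc D).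
    by rewrite ZE !mulmxA -DE' -tau_sub // DE linearZ.
  have /fin_all_exists [s sE] (j : 'I_m) : exists s : k,
      delta_mx 0 j *m (rV w - 1%:M) = s *: tau E0 by exact: line.
  have wE : rV w = 1%:M + (\col_j s j) *m tau E0.
    rewrite addrC; apply/(canRL (subrK _))/row_matrixP => j.
    rewrite rowE sE row_mul; have -> : row j (\col_j s j) = (s j)%:M.
      by apply/matrixP => i l; rewrite !ord1 !mxE.
    by rewrite mul_scalar_mx.
  exists (\col_j s j), (tau E0); split=> //.
  apply: contraNneq e0 => s0; rewrite tau_sub // -/w wE s0 mul0mx addr0 subrr mulmx0 //.
have li : linear (tact c) := tact_linear hc.
split=> //.
  exists #[w]%g => // D; apply: tau_inj.
  by rewrite tau_iter // expg_order repr_mx1 mulmx1.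
have lphi : linear (fun D => ((tau D *m a) 0 0 : k^o)).
  by move=> s D E; rewrite linearP mulmxDl -scalemxAl !mxE.
have [phi phiE] := linear_bundle lphi; exists phi.
  apply: contrapT => H.
  (* If the form [a] vanished on the tangent space, [rV w - 1] would have square 0, hence be 0. *)
  have ta D : tau D *m a = 0.
    apply/matrixP => i j; rewrite !ord1 [RHS]mxE; apply: contrapT => ne.
    by apply: H; exists D; rewrite phiE; apply/eqP.
  case/eqP: a0; have wE' : rV w - 1%:M = a *m b by rewrite wE addrC addKr.
  have z (y : 'rV[k]_m) : y *m (rV w - 1%:M) = 0.
    apply: (unipotent_row hk wW); have [D <-] := tau_image y wx.
    by rewrite wE' mulmxA ta mul0mx.
  have ab : a *m b = 0 by rewrite -wE'; apply/row_matrixP => i; rewrite rowE z row0.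
  have [j bj] : exists j, b 0 j != 0.
    apply/existsP; apply: contraNT b0 => /existsPn hb; apply/eqP/matrixP=> i j.
    by rewrite ord1 mxE; apply/eqP/negPn/hb.
  apply/colP => i; rewrite [RHS]mxE; have /matrixP/(_ i j) := ab.
  by rewrite !mxE big_ord1 => /eqP; rewrite mulf_eq0 (negPf bj) orbF => /eqP.
move=> D; rewrite phiE.
have e : tau (tact c D - D) = (tau D *m a) 0 0 *: b.
  rewrite tau_sub // -/w wE addrC addKr mulmxA -mul_scalar_mx; congr (_ *m _).
  by apply/matrixP => i j; rewrite !ord1 [RHS]mxE.
split=> [D0|t0]; last by apply: tau_inj; rewrite e t0 scale0r raddf0.
by move: e; rewrite D0 raddf0 => /esym/eqP; rewrite scaler_eq0 (negPf b0) orbF => /eqP.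
Qed.

Lemma tact_faithful c : c \in (Wtx / Gx)%g -> (forall D, tact c D = D) -> c = 1%g.
Proof.
move=> hc cD; have wx := quo_stab_map_in hc; have /rstabP [wW _] := wx.
have z (y : 'rV[k]_m) : y *m (rV (quo_stab_map c) - 1%:M) = 0.
  apply: (unipotent_row hk wW); have [D <-] := tau_image y wx.
  by rewrite -tau_sub // cD subrr raddf0.
have w1 : rV (quo_stab_map c) = 1%:M.
  by apply/subr0_eq/row_matrixP => i; rewrite rowE z row0.
have e1 : quo_stab_map 1%g = 1%g.
  by rewrite -[1%g in LHS](morph1 (coset_morphism Gx)) quo_stab_mapE ?group1 ?morph1.
apply: quo_stab_map_inj; rewrite ?group1 // e1.
exact: (quo_faithful hk faithW hnorm fgen hV).
Qed.

Hypothesis genW : <<[set g in Wt | `[< mxreflection rho g >]]>>%g = Wt.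

Let T := [set g in Wtx | `[< mxreflection rho g >]].

Lemma genWtx : <<T>>%g = Wtx.
Proof. exact: steinberg. Qed.

Lemma genWpx : <<[set w in Wpx | `[< mxreflection rV w >]]>>%g = Wpx.
Proof.
apply/eqP; rewrite eqEsubset gen_subG; apply/andP; split.
  by apply/subsetP => w; rewrite inE => /andP[].
have sWN := normal_norm hnorm.
have sTN : T \subset 'N(G)%g.
  by apply/subsetP => g; rewrite inE => /andP[/(subsetP sWtxW)/(subsetP sWN)].
have sWpx : Wpx \subset (Wtx / G)%g.
  by apply/subsetP => w /quo_stab_surj [g gx ->]; apply: mem_quotient.
apply: subset_trans sWpx _; rewrite -[in X in X \subset _]genWtx quotient_gen // gen_subG.
apply/subsetP => _ /morphimP [g gN gT' ->] /=; move: gT'; rewrite inE => /andP[gx /asboolP gr].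
have gW := subsetP sWtxW g gx.
case: (reflection_image hk faithW hnorm fI fgen hV gh hinv gW gr) => [g1|gr'].
  by rewrite (quo_faithful hk faithW hnorm fgen hV _ g1) ?group1 // coset_in.
by apply: mem_gen; rewrite inE (quo_stab hV) //; apply/asboolP.
Qed.

Lemma gen_stab_quo :
  <<reflections (Wtx / Gx)%g tact>>%g = (Wtx / Gx)%g.
Proof.
apply/eqP; rewrite eqEsubset gen_subG; apply/andP; split.
  by apply/subsetP => w; rewrite inE => /andP[].
have sTN : T \subset 'N(Gx)%g.
  by apply/subsetP => g; rewrite inE => /andP[/(subsetP (normal_norm normal_Gx))].
rewrite -[in X in X \subset _]genWtx quotient_gen // gen_subG.
apply/subsetP => _ /morphimP [g gN gT' ->] /=; move: gT'; rewrite inE => /andP[gx /asboolP gr].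
have gW := subsetP sWtxW g gx; have gq : coset Gx g \in (Wtx / Gx)%g by apply: mem_quotient.
case: (reflection_image hk faithW hnorm fI fgen hV gh hinv gW gr) => [g1|gr'].
  suff -> : coset Gx g = 1%g by apply: group1.
  apply: tact_faithful => // D; apply: tau_inj.
  by rewrite tau_act // quo_stab_mapE // g1 mulmx1.
apply: mem_gen; rewrite inE gq; apply/asboolP/tact_reflectionP => //.
by rewrite quo_stab_mapE.
Qed.

Lemma tact_reflection_group : is_reflection_group (Wtx / Gx)%g tact.
Proof.
split; [exact: tact_linear | split | exact: tact_faithful | exact: gen_stab_quo].
  move=> D; apply: tau_inj; rewrite tau_act ?group1 //.
  by rewrite -[1%g in LHS](morph1 (coset_morphism Gx)) quo_stab_mapE ?group1 ?morph1 // repr_mx1 mulmx1.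
move=> c c' hc hc' D; apply: tau_inj.
have /rstabP [hW _] := quo_stab_map_in hc; have /rstabP [hW' _] := quo_stab_map_in hc'.
by rewrite !tau_act ?groupM // quo_stab_mapM // repr_mxM // mulmxA.
Qed.

Lemma quo_stab_isomorphism :
  is_reflection_isomorphism (Wtx / Gx)%g tact
    Wpx (fun w (y : 'rV[k]_m) => y *m rV w) quo_stab_map.
Proof.
have sWpx : Wpx \subset (Wt / G)%g by apply: rstab_sub.
have faithV := quo_faithful hk faithW hnorm fgen hV.
have [psi psiP] : exists psi : coset_of G -> coset_of Gx, forall w, w \in Wpx ->
    psi w \in (Wtx / Gx)%g /\ quo_stab_map (psi w) = w.
  apply: (@fin_all_exists (coset_of G) (fun=> coset_of Gx) (fun w c => w \in Wpx ->
    c \in (Wtx / Gx)%g /\ quo_stab_map c = w)) => w.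
  case: (boolP (w \in Wpx)) => [|_]; last by exists 1%g.
  case/quo_stab_surj => g gx ->; exists (coset Gx g) => _.
  by rewrite quo_stab_mapE ?mem_quotient.
split; first exact: tact_reflection_group.
- apply: is_reflection_group_repr => // [w /(subsetP sWpx)|]; [exact: faithV | exact: genWpx].
- split=> [c|c c'|c]; [exact: quo_stab_map_in | exact: quo_stab_mapM |].
  rewrite inE => /andP[hc /asboolP /(tact_reflectionP hc) hr]; right.
  by rewrite reflectionsE // inE quo_stab_map_in //; apply/asboolP.
exists psi; split; last by move=> w /psiP [].
  split=> [w /psiP []//|w w' hw hw'|w].
    have [p1 p2] := psiP w hw; have [p1' p2'] := psiP w' hw'.
    have [q1 q2] := psiP _ (groupM hw hw').
    by apply: quo_stab_map_inj; rewrite ?groupM // quo_stab_mapM // p2 p2' q2.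
  rewrite reflectionsE // inE => /andP[hw /asboolP hr]; right.
  have [p1 p2] := psiP w hw; rewrite inE p1; apply/asboolP/tact_reflectionP => //.
  by rewrite p2.
move=> c hc; have [p1 p2] := psiP _ (quo_stab_map_in hc).
exact: quo_stab_map_inj.
Qed.

End TangentReflections.

Lemma ipowM (k : fieldType) n (S J : {mpoly k[n]} -> Prop) M N p q :
    is_subring S -> (forall q, J q -> S q) ->
  ipow S J M p -> ipow S J N q -> ipow S J (M + N) (p * q).
Proof.
move=> rS JS; elim: M p => [|M IH] p hp hq; first exact: ipowMl.
rewrite addSn; elim/ideal_mul_ind: p / hp => [|a b ha hb|a b ha hb].
- by rewrite mul0r; apply: ipow0.
- by rewrite mulrDl; apply: ipowD.
by rewrite -mulrA; apply: ideal_mul1 => //; apply: IH.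
Qed.

Lemma msub_clin (k : fieldType) n m (f : 'I_m -> {mpoly k[n]}) (v : 'rV[k]_m) c :
  msub f (clin v c) = \sum_i c i 0 *: (f i - (v 0 i)%:MP).
Proof.
rewrite (raddf_sum (msub f)); apply: eq_bigr => i _ /=.
by rewrite linearZ /= rmorphB /= msubX msubC.
Qed.

(** * A presentation of V~/G_x at x *)

Section Substitute.
Variables (k : fieldType) (m n : nat) (v : 'rV[k]_m) (I : {mpoly k[n]} -> Prop).
Hypothesis idI : is_ideal I.
Implicit Types (Z dl : 'I_m -> {mpoly k[n]}).

Definition recenter Z : {mpoly k[m]} -> {mpoly k[n]} := msub (fun i => Z i + (v 0 i)%:MP).

HB.instance Definition _ Z := GRing.LRMorphism.copy (recenter Z) (msub (fun i => Z i + (v 0 i)%:MP)).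

Lemma recenter_eval Z P : (forall i, vanish 0 (Z i)) ->
  (recenter Z P).@[(0 : 'rV[k]_n) 0] = P.@[v 0].
Proof.
move=> Z0; rewrite msub_eval; apply: meval_eq => i.
by rewrite mevalD mevalC (Z0 i : _ = 0) add0r.
Qed.

Lemma recenter_clin Z c : recenter Z (clin v c) = \sum_i c i 0 *: Z i.
Proof. by rewrite /recenter msub_clin; apply: eq_bigr => i _; rewrite addrK. Qed.

(** For [P] of order two at [v], each term of the change is a function vanishing at 0 times an
    element of [I]; only the linear part of [P] remains. *)
Lemma recenter_taylor Z dl P : (forall i, vanish 0 (Z i)) ->
    (forall i, I (dl i)) -> (forall i, vanish 0 (dl i)) ->
  aug_mul I (recenter (fun i => Z i + dl i) P - recenter Z P -
    \sum_i mxdiff v P i 0 *: dl i).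
Proof.
move=> Z0 Idl dl0; set Z' := fun i => Z i + dl i.
have augI := aug_mul_ideal idI; have [a0 aD aM] := augI.
have Z0' i : vanish 0 (Z' i) by case: (vanish_ideal (0 : 'rV[k]_n)) => _ + _; apply.
have dI Q : I (recenter Z' Q - recenter Z Q).
  by apply: ideal_msub => // i; rewrite opprD addrACA subrr addr0 /Z' addrC addKr.
have e2 Q : ipow (fun=> True) (vanish v) 2 Q -> aug_mul I (recenter Z' Q - recenter Z Q).
  rewrite [ipow _ _ 2]/=; elim/ideal_mul_ind: Q / => [|p q hp hq|p q p0 /mpow1 q0].
  - by rewrite !raddf0 addr0.
  - by rewrite !rmorphD /= opprD addrACA; apply: aD.
  rewrite !rmorphM /=.
  have -> : recenter Z' p * recenter Z' q - recenter Z p * recenter Z q =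
    recenter Z' p * (recenter Z' q - recenter Z q) + recenter Z q * (recenter Z' p - recenter Z p).
    by rewrite mulrBr [recenter Z q * _]mulrC mulrBl addrA subrK.
  by apply: aD; apply: aug_mulM => //; rewrite recenter_eval.
have := e2 _ (taylor v P); congr (aug_mul I _).
rewrite !rmorphB /= !recenter_clin ![recenter _ _%:MP]msubC.
have -> : \sum_i mxdiff v P i 0 *: Z' i =
    \sum_i mxdiff v P i 0 *: Z i + \sum_i mxdiff v P i 0 *: dl i.
  by rewrite -big_split; apply: eq_bigr => i _; rewrite scalerDr.
move: (recenter Z' P) (recenter Z P) (\sum_i _ *: Z i) (\sum_i _ *: dl i) => A B C D.
by ring.
Qed.

End Substitute.

Section Shift.
Variables (k : fieldType) (n : nat).

Definition shift (z : 'rV[k]_n) : {mpoly k[n]} -> {mpoly k[n]} :=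
  msub (fun i => 'X_i + (z 0 i)%:MP).

HB.instance Definition _ z := GRing.LRMorphism.copy (shift z) (msub (fun i => 'X_i + (z 0 i)%:MP)).

Lemma shift_eval z p (y : 'rV[k]_n) : (shift z p).@[y 0] = p.@[(y + z) 0].
Proof.
by rewrite msub_eval; apply: meval_eq => i; rewrite mevalD mevalXU mevalC mxE.
Qed.

Lemma shiftK z p : shift z (shift (- z) p) = p.
Proof.
rewrite /shift msub_msub -[RHS]msub_id; apply: eq_msub => i.
by rewrite rmorphD /= msubX msubC mxE mpolyCN addrK.
Qed.

Lemma shift_mx_subst z (A : 'M[k]_n) p : z *m A = z ->
  mx_subst A (shift z p) = shift z (mx_subst A p).
Proof.
move=> zA; rewrite /shift mx_subst_msub mx_substE msub_msub; apply: eq_msub => i.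
rewrite rmorphD /= msubX msubC (raddf_sum (msub _)) /=.
under [RHS]eq_bigr => l _ do rewrite linearZ /= msubX scalerDr.
rewrite big_split /=; congr (_ + _); rewrite -{1}zA mxE rmorph_sum.
by apply: eq_bigr => l _ /=; rewrite -mul_mpolyC mulrC mpolyCM.
Qed.

End Shift.

Section HighOrder.
Variables (k : fieldType) (n : nat) (d : 'I_n -> nat).
Hypothesis hd : forall i, (0 < d i)%N.

Lemma pihomogX_mul D i p : pihomog (wdeg d) D ('X_i * p : {mpoly k[n]}) =
  if (d i <= D)%N then 'X_i * pihomog (wdeg d) (D - d i) p else 0.
Proof. by apply: pihomogM; rewrite dhomogX /= wdegU. Qed.

(** Weights are at least 1, so order [N] at the origin forces weighted degree at least [N]. *)
Lemma pihomog_high_order N D p :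
  ipow (fun=> True) (vanish (0 : 'rV[k]_n)) N p -> (D < N)%N -> pihomog (wdeg d) D p = 0.
Proof.
elim: N D p => [|N IH] D p hp DN //.
elim/ideal_mul_ind: p / hp => [|p q hp hq|p q /vanish0_span [a ->] hq].
- exact: raddf0.
- by rewrite raddfD /= hp hq addr0.
rewrite mulr_suml (raddf_sum (pihomog (wdeg d) D)) big1 // => i _ /=.
rewrite -mulrA pihomogX_mul; case: leqP => // le.
rewrite IH ?mulr0 //; first exact: ipowMl (true_subring _ _) I hq.
by rewrite -ltnS (leq_trans _ DN) // ltnS ltn_subrL hd (leq_trans (hd i) le).
Qed.

Lemma aug_mul_pihomog (I : {mpoly k[n]} -> Prop) D p :
    is_ideal I -> (forall D p, I p -> I (pihomog (wdeg d) D p)) ->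
  aug_mul I p -> aug_mul I (pihomog (wdeg d) D p).
Proof.
move=> idI homI [a Ia ->]; have augI := aug_mul_ideal idI.
rewrite (raddf_sum (pihomog (wdeg d) D)); apply: ideal_sum => // i _ /=.
rewrite pihomogX_mul; case: leqP => _; last by case: augI.
apply: aug_mulM => //; first by rewrite mevalXU mxE.
exact: homI.
Qed.

End HighOrder.

Section StabilizerPresentation.
Variables (k : fieldType) (n : nat) (d : 'I_n -> nat) (gT : finGroupType).
Variables (Wt G : {group gT}) (rho : mx_representation k Wt n).
Hypothesis hk : [pchar k] =i pred0.
Hypothesis hd : forall i, (0 < d i)%N.
Hypothesis hgrad : {in Wt, forall g, GLgrad d (rho g)}.
Hypothesis hnorm : (G <| Wt)%g.
Variables (m : nat) (f : 'I_m -> {mpoly k[n]}).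
Hypothesis fI : forall j, f j \in invariant rho G.
Hypothesis fgen : forall p, p \in invariant rho G -> exists P, msub f P = p.
Variable x : 'rV[k]_n.

Let sGW : G \subset Wt := sGW_norm hnorm.
Local Notation Wtx := (rstab_group rho x).
Local Notation Gx := (G :&: Wtx)%G.
Local Notation v := (quo_map f x).

Variables (m' : nat) (e' : 'I_m' -> nat) (f' : 'I_m' -> {mpoly k[n]}).
Hypothesis hf' : is_splitting d rho Gx e' f'.

Local Notation I' := (quo_ideal f').
Local Notation mpow := (ipow (fun=> True) (vanish (0 : 'rV[k]_m'))).
Local Notation inv2 := (ipow (inv_in rho Gx) (inv_max rho x Gx)).

Let sGxW : Gx \subset Wt := subset_trans (subsetIl _ _) sGW.

(** Translation by [x] commutes with [Gx], so these generate the same invariants with the same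
    relations, but the origin of the presentation now lies over [x]. *)
Definition centered j : {mpoly k[n]} := shift (- x) (f' j).

Lemma msub_centered P : msub centered P = shift (- x) (msub f' P).
Proof. by rewrite /shift msub_msub; apply: eq_msub. Qed.

Lemma quo_ideal_centered P : I' P <-> msub centered P = 0.
Proof.
rewrite msub_centered; split=> [/quo_idealE ->|h]; first exact: raddf0.
by apply/quo_idealE; rewrite -(shiftK x (msub f' P)) h raddf0.
Qed.

Lemma shift_invariant z p : {in Gx, forall g, z *m rho g = z} ->
  p \in invariant rho Gx -> shift z p \in invariant rho Gx.
Proof.
move=> zg /invariantP pI; apply/invariantP => g gx.
by rewrite shift_mx_subst ?zg // pI.
Qed.

Lemma stab_fixN : {in Gx, forall g, - x *m rho g = - x}.
Proof. by move=> g gx; rewrite mulNmx (stab_fix gx). Qed.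

Lemma centered_gen p : p \in invariant rho Gx -> exists P, msub centered P = p.
Proof.
move=> pI.
have [P PE] := splitting_gen hk hd hgrad sGxW hf' (shift_invariant (@stab_fix _ _ _ _ rho G x) pI).
exists P; rewrite msub_centered PE.
by have := shiftK (- x) p; rewrite opprK.
Qed.

Lemma centered_inv P : msub centered P \in invariant rho Gx.
Proof.
rewrite msub_centered; apply: (shift_invariant stab_fixN).
exact: (msub_invariant (splitting_inv hf')).
Qed.

Lemma centered_eval P : (msub centered P).@[x 0] = P.@[(0 : 'rV[k]_m') 0].
Proof.
by rewrite msub_centered shift_eval subrr meval_quo_map (quo_map0 hf').
Qed.

Lemma centered_ipow N P : mpow N P -> inv2 N (msub centered P).
Proof.
apply: ipow_map; [exact: inv_subring | by move=> Q _; apply: centered_inv |].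
by move=> Q Q0; split; [apply: centered_inv | rewrite centered_eval].
Qed.

Lemma centered_lift N p : inv2 N p -> exists2 P, mpow N P & msub centered P = p.
Proof.
apply: ipow_lift => // [q /centered_gen [P <-]|q [/centered_gen [P <-] q0]].
  by exists P.
by exists P => //; rewrite /vanish -centered_eval.
Qed.

Lemma quo_ideal_mpow P : I' P -> mpow 2 P.
Proof. exact: (quo_ideal_mpow2 hk hd hgrad sGxW hf'). Qed.

Definition lifting (Z : 'I_m -> {mpoly k[m']}) : Prop :=
  forall i, msub centered (Z i) = f i - (v 0 i)%:MP.

Lemma lifting_exists : exists Z, lifting Z.
Proof.
have /fin_all_exists [Z ZP] i : exists Z, msub centered Z = f i - (v 0 i)%:MP.
  apply: centered_gen; apply: rpredB; first exact: sub_invGx.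
  exact: constI.
by exists Z.
Qed.

Section Lifting.
Variable Z : 'I_m -> {mpoly k[m']}.
Hypothesis hZ : lifting Z.
Local Notation psi := (recenter v Z).

Lemma lifting_vanish i : vanish 0 (Z i).
Proof. by rewrite /vanish -centered_eval hZ mevalB mevalC mxE subrr. Qed.

Lemma centered_psi P : msub centered (psi P) = msub f P.
Proof.
rewrite /recenter msub_msub; apply: eq_msub => i.
by rewrite rmorphD /= hZ msubC subrK.
Qed.

Lemma psi_mpow N P : ipow (fun=> True) (vanish v) N P -> mpow N (psi P).
Proof.
apply: ipow_map => // Q Q0; rewrite /vanish recenter_eval //; exact: lifting_vanish.
Qed.

Lemma psi_relations P : quo_ideal f P -> I' (psi P).
Proof. by move=> /quo_idealE P0; apply/quo_ideal_centered; rewrite centered_psi. Qed.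

(** [cot_surj] lifted to the polynomial ring, where it holds modulo relations; these have order
    two. *)
Lemma psi_cot_surj j : exists c, mpow 2 ('X_j - psi (clin v c)).
Proof.
have [|c hc] := cot_surj hk sGW fI fgen (x := x) (b := centered j).
  split; first by rewrite -[centered j]msubX centered_inv.
  by rewrite -[centered j]msubX centered_eval mevalXU mxE.
have [Q Q2 QE] := centered_lift hc; exists c.
have : I' ('X_j - psi (clin v c) - Q).
  by apply/quo_ideal_centered; rewrite !rmorphB /= QE centered_psi msubX subrr.
by move=> /quo_ideal_mpow h; rewrite -[_ - psi _](subrK Q); apply: ipowD.
Qed.

Lemma psi_approx1 p : vanish 0 p -> exists b, mpow 2 (p - psi b).
Proof.
move=> p0; have /fin_all_exists [c hc] j : exists c, mpow 2 ('X_j - psi (clin v c)).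
  exact: psi_cot_surj.
exists (\sum_j mxdiff 0 p j 0 *: clin v (c j)).
have t := taylor (0 : 'rV[k]_m') p; rewrite (p0 : _ = 0) mpolyC0 subr0 in t.
rewrite -[X in X - psi _](subrK (clin 0 (mxdiff 0 p))) -addrA; apply: ipowD => //.
rewrite (raddf_sum psi) /clin -sumrB; apply: ipow_sum => // j _ /=.
rewrite [psi _]linearZ /= [(0 : 'rV[k]_m') 0 j]mxE mpolyC0 subr0 -scalerBr -mul_mpolyC.
exact: (ipowMl (N := 2) (true_subring _ _) I (hc j)).
Qed.

Lemma psi_approx_step N P : mpow N P -> exists a, mpow N.+1 (P - psi a).
Proof.
elim: N P => [|N IH] P hP.
  exists (P.@[(0 : 'rV[k]_m') 0])%:MP; rewrite [psi _]msubC; apply/mpow1.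
  by rewrite /vanish mevalB mevalC subrr.
elim/ideal_mul_ind: P / hP => [|p q [a ha] [b hb]|p q p0 hq].
- by exists 0; rewrite raddf0 subrr; apply: ipow0.
- exists (a + b); rewrite rmorphD opprD addrACA.
  exact: (ipowD (N := N.+2) (true_subring _ _) ha hb).
have [b hb] := psi_approx1 p0; have [a ha] := IH q hq.
exists (b * a); rewrite rmorphM.
have -> : p * q - psi b * psi a = (p - psi b) * q + psi b * (q - psi a) by ring.
have b0 : vanish 0 (psi b).
  have [_ hD _] := vanish_ideal (0 : 'rV[k]_m').
  rewrite -[psi b](subKr p); apply: idealB => //; first exact: vanish_ideal.
  exact/mpow1/(ipowS (true_subring _ _) (fun _ _ => I)).
apply: ipowD => //.
  by rewrite -[N.+2]/(2 + N)%N; apply: ipowM.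
by apply: ideal_mul1.
Qed.

Lemma psi_approx N P : exists a, mpow N (P - psi a).
Proof.
elim: N => [|N [a ha]]; first by exists 0.
have [b hb] := psi_approx_step ha; exists (a + b).
by rewrite rmorphD /= opprD addrA.
Qed.

(** Approximate [P] by [psi a] with [a] arbitrary. Then [msub f a] has order [N] at [x], by
    [descend] also over the invariants of [G], and subtracting a lift of order [N] turns [a] into a
    relation. *)
Lemma psi_approx_relations N P : I' P -> exists2 a, quo_ideal f a & mpow N (P - psi a).
Proof.
move=> IP; have [a ha] := psi_approx N P.
have hb : inv2 N (msub f a).
  have := centered_ipow (ipowMl (true_subring k m') (I : (fun=> True) (-1 : {mpoly k[m']})) ha).
  congr (inv2 N _); rewrite mulN1r opprB rmorphB /= centered_psi.
  by rewrite ((quo_ideal_centered P).1 IP) subr0.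
have := descend hk sGW (msub_invariant fI a) hb.
case/(ipow_lift (f := f) (S := fun=> True) (J := vanish v)) => [//|p /fgen [Q <-]|p [pI p0]|Q Q2 QE].
- by exists Q.
- by have [Q QE] := fgen pI; exists Q => //; rewrite /vanish -meval_quo_map QE.
exists (a - Q); first by apply/quo_idealE; rewrite rmorphB /= QE subrr.
rewrite rmorphB /= opprB addrA addrAC; apply: ipowD => //.
exact: psi_mpow.
Qed.

Variables (r : nat) (h : 'I_r -> {mpoly k[m]}).
Hypothesis gh : generates h (quo_ideal f).

Lemma psi_generators_mod a : quo_ideal f a ->
  exists c : 'I_r -> k, aug_mul I' (psi a - \sum_i c i *: psi (h i)).
Proof.
have idI := quo_ideal_ideal f'.
move=> /gh [b ->]; exists (fun i => (psi (b i)).@[(0 : 'rV[k]_m') 0]).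
rewrite (raddf_sum psi) -sumrB; apply: ideal_sum => [|i _ /=]; first exact: aug_mul_ideal.
rewrite rmorphM /= -mul_mpolyC -mulrBl; apply: aug_mulM => //.
  by rewrite mevalB mevalC subrr.
exact/psi_relations/(gen_relations gh).
Qed.

(** An approximation of order [K] leaves components of degree at least [K] only, and [high] absorbs
    these in A'_+ I'. *)
Lemma psi_spans : spans_mod I' (fun i => psi (h i)).
Proof.
have idI := quo_ideal_ideal f'; have augI := aug_mul_ideal idI; have [a0 aD aM] := augI.
have epos := splitting_pos hf'.
have homI D p : I' p -> I' (pihomog (wdeg e') D p) by apply: quo_ideal_pihomog hf' _ _.
pose K := (\max_(i < r) mmeasure (wdeg e') (psi (h i)))%N.
(* Take the component of degree [D] of an approximation of order [D.+1]: neither the error nor the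
   combination of the [psi (h i)] contributes. *)
have high D p : (K <= D)%N -> I' p -> aug_mul I' (pihomog (wdeg e') D p).
  move=> KD Ip; have [a Ia ha] := psi_approx_relations D.+1 (homI D p Ip).
  have [c hc] := psi_generators_mod Ia.
  rewrite -(pihomog_id (wdeg e') D p).
  have -> : pihomog (wdeg e') D p = (psi a - \sum_i c i *: psi (h i)) +
      \sum_i c i *: psi (h i) + (pihomog (wdeg e') D p - psi a).
    by rewrite subrK addrC subrK.
  rewrite 2!(raddfD (pihomog (wdeg e') D)) /= [X in _ + X](pihomog_high_order epos ha) // addr0.
  rewrite (raddf_sum (pihomog (wdeg e') D)) [X in _ + X]big1 ?addr0 => [|i _ /=].
    exact: aug_mul_pihomog.
  rewrite linearZ /= (_ : pihomog _ _ _ = 0) ?scaler0 //; apply/mpolyP=> u.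
  rewrite mcoeff_pihomog mcoeff0; case: eqP => // uD; apply: memN_msupp_eq0.
  apply: (@mmeasure_mnm_ge _ _ (wdeg e')); rewrite uD (leq_trans _ KD) //.
  exact: (leq_bigmax (F := fun i => mmeasure (wdeg e') (psi (h i)))).
move=> P IP; have [a Ia ha] := psi_approx_relations K IP.
have [c hc] := psi_generators_mod Ia; exists c.
rewrite -[P](subrK (psi a)) -addrA; apply: (aD) => //.
apply: (@pihomog_closed_sum _ _ e') => // D.
case: (ltnP D K) => DK; first by rewrite (pihomog_high_order epos ha).
apply: high => //; apply: idealB => //; exact: psi_relations.
Qed.

End Lifting.

End StabilizerPresentation.

(** * Goodness of the stabiliser *)

Section DifferentialRank.
Variables (k : fieldType) (n : nat) (gT : finGroupType).
Variables (Wt G : {group gT}) (rho : mx_representation k Wt n).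
Hypothesis hk : [pchar k] =i pred0.
Hypothesis sGW : G \subset Wt.
Variables (m : nat) (f : 'I_m -> {mpoly k[n]}).
Hypothesis fI : forall j, f j \in invariant rho G.
Hypothesis fgen : forall p, p \in invariant rho G -> exists P, msub f P = p.
Variables (r : nat) (h : 'I_r -> {mpoly k[m]}).
Hypothesis gh : generates h (quo_ideal f).
Variable x : 'rV[k]_n.

Definition relation_jacobian : 'M[k]_(r, m) := \matrix_(i, l) mxdiff (quo_map f x) (h i) l 0.

Lemma cot_ker_jacobian (c : 'cV[k]_m) :
    ipow (inv_in rho (G :&: rstab rho x)) (inv_max rho x (G :&: rstab rho x)) 2
      (msub f (clin (quo_map f x) c)) ->
  (c^T <= relation_jacobian)%MS.
Proof.
move=> /(cot_ker hk sGW fI fgen) [P IP <-].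
have [a ->] := mxdiff_relations gh x IP.
apply/submxP; exists (\row_i a i); apply/rowP => j; rewrite !mxE summxE.
by apply: eq_bigr => i _; rewrite !mxE.
Qed.

(** A map to [N] dimensions that detects the nonzero cotangent vectors bounds the cotangent space by
    [N], leaving at least [m - N] independent gradients of relations. *)
Lemma relation_jacobian_rank N (L : 'M[k]_(m, N)) :
    (forall c : 'rV[k]_m, c *m L = 0 ->
      ipow (inv_in rho (G :&: rstab rho x)) (inv_max rho x (G :&: rstab rho x)) 2
        (msub f (clin (quo_map f x) c^T))) ->
  (m <= \rank relation_jacobian + N)%N.
Proof.
move=> hL; have /mxrankS : (kermx L <= relation_jacobian)%MS.
  apply/row_subP => i; rewrite -[row i _]trmxK; apply: cot_ker_jacobian.
  by apply: hL; rewrite -row_mul mulmx_ker row0.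
rewrite mxrank_ker => le; rewrite addnC -leq_subLR.
apply: leq_trans le; exact: leq_sub2l (rank_leq_col L).
Qed.

End DifferentialRank.

Section RelationNumber.
Variables (k : fieldType) (n : nat) (gT : finGroupType).
Variables (Wt G : {group gT}) (rho : mx_representation k Wt n).
Hypothesis hk : [pchar k] =i pred0.
Hypothesis faithW : {in Wt, forall g, rho g = 1%:M -> g = 1%g}.
Hypothesis sGW : G \subset Wt.
Variables (m : nat) (f : 'I_m -> {mpoly k[n]}).
Hypothesis fI : forall j, f j \in invariant rho G.
Hypothesis fgen : forall p, p \in invariant rho G -> exists P, msub f P = p.

(* At a point with trivial stabiliser the quotient is smooth of dimension n,  *)
(* so the differentials of the relations span a space of dimension m - n.     *)
Lemma relation_number r (h : 'I_r -> {mpoly k[m]}) :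
  generates h (quo_ideal f) -> (m <= r + n)%N.
Proof.
move=> gh; have [y yP] := generic_free_point hk faithW.
pose L := \matrix_(i < m, j < n) mxdiff y (f i) j 0.
have all_inv p : p \in invariant rho (G :&: rstab rho y).
  by apply/invariantP => g /setIP [_ /yP ->]; rewrite mx_subst_r1.
have := relation_jacobian_rank hk sGW fI fgen gh (x := y) (L := L).
move=> H; apply: leq_trans (H _) _; last by rewrite leq_add2r rank_leq_row.
move=> c cL.
suff h2 : ipow (fun=> True) (vanish y) 2 (msub f (clin (quo_map f y) c^T)).
  have := ipow_map (f := fun i => 'X_i) (inv_subring rho (G :&: rstab rho y)) _ _ h2.
  rewrite msub_id; apply => Q; rewrite msub_id; first by move=> _; apply: all_inv.
  by move=> Q0; split.
apply/mpow2P; split.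
  by rewrite /vanish meval_quo_map; apply: clin_vanish.
rewrite msub_clin (raddf_sum (mxdiff y)); apply/colP => j.
have /rowP/(_ j) := cL; rewrite summxE !mxE => {2}<-; apply: eq_bigr => i _ /=.
by rewrite linearZ linearB /= mxdiffC subr0 !mxE.
Qed.

End RelationNumber.

Section StabilizerGood.
Variables (k : fieldType) (n : nat) (d : 'I_n -> nat) (gT : finGroupType).
Variables (Wt G : {group gT}) (rho : mx_representation k Wt n).
Hypothesis hk : [pchar k] =i pred0.
Hypothesis hd : forall i, (0 < d i)%N.
Hypothesis hgrad : {in Wt, forall g, GLgrad d (rho g)}.
Hypothesis faithW : {in Wt, forall g, rho g = 1%:M -> g = 1%g}.
Hypothesis hnorm : (G <| Wt)%g.
Variables (m : nat) (f : 'I_m -> {mpoly k[n]}).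
Hypothesis fI : forall j, f j \in invariant rho G.
Hypothesis fgen : forall p, p \in invariant rho G -> exists P, msub f P = p.
Variable rV : mx_representation k (Wt / G)%g m.
Hypothesis hV : is_quo_action rho Wt f rV.
Variables (r : nat) (h : 'I_r -> {mpoly k[m]}).
Hypothesis gh : generates h (quo_ideal f).
Hypothesis hinv : {in (Wt / G)%g, forall w i, mx_subst (rV w) (h i) = h i}.
Hypothesis rn : (r + n <= m)%N.
Variable x : 'rV[k]_n.

Let sGW : G \subset Wt := sGW_norm hnorm.
Local Notation Wtx := (rstab_group rho x).
Local Notation Gx := (G :&: Wtx)%G.
Local Notation v := (quo_map f x).

Variables (m' : nat) (e' : 'I_m' -> nat) (f' : 'I_m' -> {mpoly k[n]}).
Hypothesis hf' : is_splitting d rho Gx e' f'.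
Variable rV' : mx_representation k (Wtx / Gx)%g m'.
Hypothesis hV' : is_quo_action rho Wtx f' rV'.

Let sGxW : Gx \subset Wt := subset_trans (subsetIl _ _) sGW.
Local Notation I' := (quo_ideal f').
Local Notation Dh := (relation_jacobian f h x).

(* Correcting a lifting by the relations psi (h i) kills, modulo A'_+ I', the *)
(* relations with independent differentials: what remains spans I' / A'_+ I', *)
(* and consists of relations whose differential at p(x) is zero.              *)
Lemma reduced_relations : exists N (C : 'M[k]_(N, r)) Z,
  [/\ (N + n <= m')%N, C *m Dh = 0, lifting f x f' Z
    & spans_mod I' (fun a => recenter v Z (\sum_j C a j *: h j))].
Proof.
have idI := quo_ideal_ideal f'; have augI := aug_mul_ideal idI; have [a0 aD aM] := augI.
have [Z hZ] := lifting_exists hk hd hgrad hnorm fI hf'.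
(* [Q] is a generalised inverse, so the rows of [E] are linear relations between the gradients. *)
pose Q := pinvmx Dh; pose E := 1%:M - Dh *m Q.
have EDh : E *m Dh = 0 by rewrite mulmxBl mul1mx mulmxKpV ?submx_refl // subrr.
pose C := row_base E.
have CDh : C *m Dh = 0.
  have /submxP [M ->] : (C <= E)%MS by rewrite eq_row_base.
  by rewrite -mulmxA EDh mulmx0.
have rkE : (\rank E + n <= m')%N.
  have le1 : (\rank E <= r - \rank Dh)%N.
    by rewrite -mxrank_ker; apply: mxrankS; apply/sub_kermxP.
  have le2 : (m <= \rank Dh + m')%N.
    (* A combination of the [Z i] killed by this Jacobian has order two at 0, so its image lies in
       the square of the maximal ideal at [x]. *)
    pose L := \matrix_(i < m, j < m') mxdiff 0 (Z i) j 0.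
    apply: (relation_jacobian_rank hk sGW fI fgen gh (L := L)) => c cL.
    rewrite -(centered_psi hZ); apply: (centered_ipow hf').
    rewrite recenter_clin; apply/mpow2P; split.
      apply: ideal_sum => [|i _]; first exact: vanish_ideal.
      by apply: idealZ; [exact: vanish_ideal | exact: (lifting_vanish hf' hZ)].
    rewrite (raddf_sum (mxdiff 0)); apply/colP => j.
    have /rowP/(_ j) := cL; rewrite summxE !mxE => {2}<-; apply: eq_bigr => i _ /=.
    by rewrite linearZ /= !mxE.
  have rD := rank_leq_row Dh.
  rewrite -(leq_add2l (\rank Dh)) addnA.
  apply: leq_trans le2; apply: leq_trans rn; rewrite leq_add2r.
  by rewrite -leq_subRL.
exists (\rank E), C, Z; split=> //.
pose ps i := recenter v Z (h i).
have Ips i : I' (ps i) by apply: (psi_relations hZ); apply: (gen_relations gh).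
(* By [recenter_taylor] this correction subtracts [Dh *m Q] applied to [ps], which leaves [E]
   applied to [ps]. *)
pose dl l := - \sum_j Q l j *: ps j.
have Idl l : I' (dl l).
  by apply: idealN => //; apply: ideal_sum => // j _; apply: idealZ.
pose Z' l := Z l + dl l.
have hZ' : lifting f x f' Z'.
  move=> l; rewrite rmorphD /= hZ.
  by rewrite (quo_ideal_centered x f' (dl l)).1 // addr0.
have Z0 := lifting_vanish hf' hZ.
have dl0 l : vanish 0 (dl l).
  by apply: (mpow1 _ _).1; apply: (ipowS (true_subring _ _) (fun _ _ => I));
     apply: (quo_ideal_mpow hk hd hgrad hnorm hf').
have red i : aug_mul I' (recenter v Z' (h i) - \sum_j E i j *: ps j).
  have := recenter_taylor v idI (h i) Z0 Idl dl0; congr (aug_mul _ _).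
  rewrite -/Z' -/(ps i) -addrA; congr (_ + _); rewrite -opprD; congr (- _).
  have -> : \sum_j E i j *: ps j = \sum_j (i == j)%:R *: ps j - \sum_j (Dh *m Q) i j *: ps j.
    by rewrite -sumrB; apply: eq_bigr => j _; rewrite !mxE scalerBl.
  congr (_ + _).
    rewrite (bigD1 i) //= eqxx scale1r big1 ?addr0 // => j /negPf ij.
    by rewrite eq_sym ij scale0r.
  transitivity (- \sum_l mxdiff v (h i) l 0 *: \sum_j Q l j *: ps j).
    by rewrite -sumrN; apply: eq_bigr => l _; rewrite /dl scalerN.
  congr (- _).
  under eq_bigr => l _ do rewrite scaler_sumr.
  rewrite exchange_big /=; apply: eq_bigr => j _.
  rewrite [in RHS]mxE scaler_suml; apply: eq_bigr => l _.
  by rewrite scalerA [in RHS]mxE.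
move=> P IP; have [c hc] := psi_spans hk hd hgrad hnorm fI fgen hf' hZ' gh IP.
(* [E] factors as [col_base E *m C], which re-expresses the span through the rows of [C]. *)
exists (fun a => \sum_i c i * col_base E i a).
have := aD _ _ hc (ideal_sum (index_enum _) (P := xpredT) augI (fun i _ => idealZ (c i) augI (red i))).
congr (aug_mul _ _).
under [X in _ + X = _]eq_bigr => i _ do rewrite scalerBr.
rewrite sumrB addrA subrK; congr (_ - _).
have EE i j : E i j = \sum_a col_base E i a * C a j.
  by rewrite -{1}(mulmx_base E) mxE.
under eq_bigr => i _ do rewrite scaler_sumr.
rewrite exchange_big /=.
transitivity (\sum_j \sum_a (\sum_i c i * col_base E i a) *: (C a j *: ps j)).
  apply: eq_bigr => j _.
  under eq_bigr => i _ do rewrite scalerA EE mulr_sumr scaler_suml.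
  rewrite exchange_big /=; apply: eq_bigr => a _; rewrite scaler_suml.
  by apply: eq_bigr => i _; rewrite scalerA mulrA.
rewrite exchange_big /=; apply: eq_bigr => a _.
rewrite (raddf_sum (recenter v Z)) scaler_sumr; apply: eq_bigr => j _ /=.
by rewrite [recenter v Z _]linearZ.
Qed.

(** The upper bound on the number of generators is [reduced_relations], the lower one
    [relation_number] applied to [Gx]; they meet at [m' - n]. *)
Lemma stab_complete_intersection : is_complete_intersection f'.
Proof.
have idI := quo_ideal_ideal f'.
have [N [C [Z [Nn CD hZ sp]]]] := reduced_relations.
have f'I := splitting_inv hf'.
have f'gen := splitting_gen hk hd hgrad sGxW hf'.
have Ieta a : I' (recenter v Z (\sum_j C a j *: h j)).
  apply: (psi_relations hZ); apply: ideal_sum => [|j _]; first exact: quo_ideal_ideal.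
  by apply: idealZ; [exact: quo_ideal_ideal | exact: (gen_relations gh)].
have [N' N'N [q [_ _ gq]]] := homogeneous_generators (splitting_pos hf') idI
  (fun D P => @quo_ideal_pihomog _ _ _ _ _ _ _ _ _ _ hf' D P) Ieta sp.
have lower s (q' : 'I_s -> {mpoly k[m']}) : generates q' I' -> (m' <= s + n)%N.
  exact: (relation_number hk faithW sGxW f'I f'gen).
exists N'.
  by apply/eqP; rewrite eqn_leq (lower _ q) // andbT (leq_trans _ Nn) // leq_add2r.
split; first by exists q.
move=> s q' gq'; rewrite -(leq_add2r n); apply: leq_trans (lower _ _ gq').
by apply: leq_trans Nn; rewrite leq_add2r.
Qed.

Lemma stab_trivial_relations : acts_trivially_on_relations Wtx e' f' rV'.
Proof.
have idI := quo_ideal_ideal f'; have augI := aug_mul_ideal idI; have [a0 aD aM] := augI.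
have [N [C [Z [Nn CD hZ sp]]]] := reduced_relations.
have Z0 := lifting_vanish hf' hZ.
move=> w hw P IP; apply/(aug_mulP (splitting_pos hf') idI).
have [g gx wE] := stab_quoP hw.
have /rstabP [gW xg] := gx.
have hw0 : coset G g \in rstab rV v by apply: (quo_stab hV).
have /rstabP [w0W vw] := hw0.
set w0 := coset G g in hw0 w0W vw; set M := rV' w.
have cact Q : msub (centered x f') (mx_subst M Q) = mx_subst (rho g) (msub (centered x f') Q).
  have xgN : - x *m rho g = - x by rewrite mulNmx xg.
  rewrite !msub_centered shift_mx_subst //; congr (shift _ _).
  rewrite mx_subst_msub mx_substE msub_msub; apply: eq_msub => j.
  rewrite hV' // (raddf_sum (msub f')) /M wE; apply: eq_bigr => i _ /=.
  by rewrite linearZ /= msubX.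
have Iact Q : I' Q -> I' (mx_subst M Q).
  move=> /(quo_ideal_centered x f') Q0; apply/(quo_ideal_centered x f').
  by rewrite cact Q0 raddf0.
have v0act Q : vanish 0 Q -> vanish 0 (mx_subst M Q).
  by rewrite /vanish mx_subst_eval mul0mx.
have augact Q : aug_mul I' Q -> aug_mul I' (mx_subst M Q).
  case=> a Ia ->; rewrite (raddf_sum (mx_subst M)); apply: ideal_sum => // j _ /=.
  rewrite rmorphM /=; apply: aug_mulM => //; last exact: Iact.
  by apply: v0act; rewrite /vanish mevalXU mxE.
have eta_triv a : aug_mul I' (mx_subst M (recenter v Z (\sum_j C a j *: h j)) -
    recenter v Z (\sum_j C a j *: h j)).
  set eta := \sum_j C a j *: h j.
  have deta : mxdiff v eta = 0.
    apply/colP => l; rewrite (raddf_sum (mxdiff v)) summxE.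
    have /matrixP/(_ a l) := CD; rewrite !mxE => {2}<-; apply: eq_bigr => j _ /=.
    by rewrite linearZ !mxE.
  have einv : mx_subst (rV w0) eta = eta.
    rewrite (raddf_sum (mx_subst _)); apply: eq_bigr => j _ /=.
    by rewrite linearZ /= hinv.
  (* [Z1] lets [w0] act on V, while [mx_subst M (Z l)] lets [w] act on the source. Both lift the
     same functions, so they differ by relations, and [eta], having zero gradient, does not see the
     difference modulo A'_+ I'. *)
  pose Z1 l := \sum_i rV w0 i l *: Z i.
  have Z10 l : vanish 0 (Z1 l).
    apply: ideal_sum => [|i _]; first exact: vanish_ideal.
    by apply: idealZ => //; exact: vanish_ideal.
  pose dl l := mx_subst M (Z l) - Z1 l.
  have Idl l : I' (dl l).
    apply/(quo_ideal_centered x f'); rewrite rmorphB /= cact hZ rmorphB /=.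
    rewrite [mx_subst _ _%:MP]msubC (hV gW) (raddf_sum (msub _)) /=.
    under [X in _ - X = _]eq_bigr => i _ do rewrite linearZ /= hZ scalerBr.
    rewrite sumrB.
    have -> : \sum_i rV w0 i l *: (v 0 i)%:MP = (v 0 l)%:MP :> {mpoly k[n]}.
      rewrite -{2}vw mxE rmorph_sum; apply: eq_bigr => i _ /=.
      by rewrite -mul_mpolyC mulrC mpolyCM.
    by rewrite subrr.
  have dl0 l : vanish 0 (dl l).
    by apply: idealB; [exact: vanish_ideal | apply: v0act | apply: Z10].
  have e1 : recenter v Z eta = recenter v Z1 eta.
    rewrite -{1}einv /recenter mx_substE msub_msub; apply: eq_msub => l.
    rewrite (raddf_sum (msub _)) /=.
    under eq_bigr => i _ do rewrite linearZ /= msubX scalerDr.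
    rewrite big_split /=; congr (_ + _); rewrite -{2}vw mxE rmorph_sum.
    by apply: eq_bigr => i _ /=; rewrite -mul_mpolyC mulrC mpolyCM.
  have e2 : mx_subst M (recenter v Z eta) = recenter v (fun l => Z1 l + dl l) eta.
    rewrite /recenter mx_subst_msub; apply: eq_msub => l.
    by rewrite rmorphD /= [mx_subst M _%:MP]msubC /dl [Z1 l + _]addrC subrK.
  have := recenter_taylor v idI eta Z10 Idl dl0.
  rewrite -e2 -e1 deta big1 ?subr0 // => l _; by rewrite mxE scale0r.
have [c hc] := sp P IP.
set S := \sum_a _ in hc.
have -> : mx_subst M P - P = mx_subst M (P - S) + (mx_subst M S - S) - (P - S).
  rewrite [mx_subst M (P - S)]rmorphB /=; move: (mx_subst M P) (mx_subst M S) => A B.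
  by ring.
apply: (idealB augI) => //; apply: aD; first exact: augact.
rewrite (raddf_sum (mx_subst M)) -sumrB; apply: ideal_sum => // a _ /=.
by rewrite linearZ /= -scalerBr; apply: idealZ.
Qed.

End StabilizerGood.

Theorem mainTheorem3 (k : fieldType) (n : nat) (d : 'I_n -> nat)
    (gT : finGroupType) (Wt G : {group gT}) (rVt : mx_representation k Wt n)
    (m : nat) (e : 'I_m -> nat) (f : 'I_m -> {mpoly k[n]})
    (rV : mx_representation k (Wt / G)%g m)
    (hk : [pchar k] =i pred0)
    (hd : forall i, (0 < d i)%N)
    (hgrad : {in Wt, forall g, GLgrad d (rVt g)})
    (hf : is_splitting d rVt G e f)
    (hV : is_quo_action rVt Wt f rV)
    (hgood : is_good rVt Wt e f rV)
    (x : 'rV[k]_n) :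
  let Wtx := rstab rVt x in
  let Gx := (G :&: Wtx)%g in
  let Wpx := rstab rV (quo_map f x) in
  [/\ (* G_x is good in Wt_x *)
      forall (m' : nat) (e' : 'I_m' -> nat) (f' : 'I_m' -> {mpoly k[n]})
        (rV' : mx_representation k (Wtx / Gx)%g m'),
        is_splitting d rVt Gx e' f' -> is_quo_action rVt Wtx f' rV' ->
        is_good rVt Wtx e' f' rV',
      (* the map from the tangent space of V~/G_x at x to V is injective *)
      injective (@tangent_map k n gT rVt Gx x m f)
    & (* and it induces an isomorphism of reflection groups *)
      exists phi : coset_of Gx -> coset_of G,
        [/\ {in Wtx, forall g, phi (coset Gx g) = coset G g},
            {in (Wtx / Gx)%g, forall c, forall D : tangent rVt Gx x,
              tangent_map f (tangent_quo_act c D)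
                = tangent_map f D *m rV (phi c)}
          & is_reflection_isomorphism
              (Wtx / Gx)%g (@tangent_quo_act k n gT rVt Gx x)
              Wpx (fun w (v : 'rV[k]_m) => v *m rV w) phi]].
Proof.
move=> Wtx Gx Wpx; have [hrefl hnorm hci htriv] := hgood.
have faithW := reflection_group_faithful hrefl.
have genW := reflection_group_gen (subxx Wt) hrefl.
have sGW := normal_sub hnorm.
have fI := splitting_inv hf.
have fgen := splitting_gen hk hd hgrad sGW hf.
have [r [h [rn gh hinv]]] := invariant_relations hk hgrad hf hV htriv hci.
split.
- move=> m' e' f' rV' hf' hV'; split.
  + apply: (@is_reflection_group_repr _ _ _ _ rVt (rstab_group rVt x)).
    * exact: sWtxW.
    * by move=> g /(subsetP (sWtxW rVt x)); apply: faithW.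
    * exact: genWtx.
  + exact: (normal_Gx rVt hnorm x).
  + exact: (stab_complete_intersection hk hd hgrad faithW hnorm fI fgen gh rn hf').
  + exact: (stab_trivial_relations hk hd hgrad hnorm fI fgen hV gh hinv rn hf' hV').
- exact: (tau_inj hk hnorm fI fgen).
exists (@quo_stab_map _ _ _ Wt G rVt x); split.
- move=> g; exact: quo_stab_mapE.
- move=> c hc D; exact: (tau_act hnorm fI hV D hc).
exact: (quo_stab_isomorphism hk faithW hnorm fI fgen hV gh hinv x genW).
Qed.
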